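(* Let $X=\{X_n\}_{n\ge 0}$ be a time-homogeneous Markov chain with state space a Borel set $S\subseteq\mathbb{R}$, with arbitrary initial distribution, such that $\limsup_{n\to\infty}X_n=\infty$ almost surely. Let $v>0$ be a decreasing differentiable function such that $xv(x)\to\infty$ and $v'(x)=o(v^2(x))$ as $x\to\infty$. Suppose there exist $b\in(0,\infty)$ and an increasing function $s(x)>0$ with $s(x)=o(1/v(x))$ such that $$m_1^{[s(x)]}(x)\sim v(x),\qquad m_2^{[s(x)]}(x)\to b\qquad\text{as }x\to\infty.$$ Assume also that $$\mathbb{P}\{|\xi(y)|\ge s(y)\}\le p(y)v(y)\quad\text{for all }y\ge0,$$ where $p$ is a non-increasing, non-negative function that is integrable at infinity, and that there is a random variable $\widehat\xi$ with $\mathbb{E}\widehat\xi^{\,2}<\infty$ such that $$|\xi(y)|\,\mathbb{I}\{|\xi(y)|<s(y)\}\le_{\rm st}\widehat\xi\qquad\text{for all }y\ge 0.$$ Then, for every function $h(x)\uparrow\infty$ with $h(x)=o(1/v(x))$ as $x\to\infty$, $$H(x,x+h(x)]\sim\frac{h(x)}{v(x)}\qquad\text{as }x\to\infty.$$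
   Context: For a time-homogeneous Markov chain $X_n$ with state space a Borel set $S\subseteq\mathbb{R}$, $\xi(x)$ denotes a random variable with the distribution of the jump of the chain from state $x\in S$, i.e. $\mathbb{P}\{\xi(x)\in B\}=\mathbb{P}\{X_{n+1}-X_n\in B\mid X_n=x\}$ for Borel $B\subseteq\mathbb{R}$. All conditions involving $\xi(x)$ are understood for $x\in S$. For $s>0$, the $s$-truncated $k$th moment of the jump is $m_k^{[s]}(x):=\mathbb{E}\{\xi^k(x);\ |\xi(x)|\le s\}$, where $\mathbb{E}\{Y;A\}$ means $\mathbb{E}[Y\mathbb{I}_A]$. For random variables, $\xi\le_{\rm st}\eta$ means $\mathbb{P}\{\xi>t\}\le\mathbb{P}\{\eta>t\}$ for all $t\in\mathbb{R}$. The renewal measure (Green function) of the chain is $H(B):=\sum_{n=0}^\infty\mathbb{P}\{X_n\in B\}$ for Borel $B\subseteq\mathbb{R}$. The notation $h(x)\uparrow\infty$ means that $h$ increases to infinity as $x\to\infty$, and $f\sim g$ means $f/g\to1$. *)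

(* Defs.v *)
From HB Require Import structures.
From mathcomp Require Export all_boot all_order all_algebra.
From mathcomp Require Export all_classical all_reals all_analysis.
From mathcomp Require Export measurable_realfun.

Set Implicit Arguments.
Unset Strict Implicit.
Unset Printing Implicit Defensive.

Export Order.TTheory GRing.Theory Num.Theory.
Export numFieldNormedType.Exports.

#[export] Set Implicit Arguments.
#[export] Unset Strict Implicit.
#[export] Unset Printing Implicit Defensive.

Local Open Scope classical_set_scope.
Local Open Scope ring_scope.
Local Open Scope ereal_scope.

Section markov_chain.
Context {R : realType} {d : measure_display} {T : measurableType d}.
Variable P : probability T R.
Implicit Types (X : nat -> {RV P >-> R}) (S : set R).

(* sigma(X_0, ..., X_n) *)
Definition history X (n : nat) : set_system T :=
  <<s \bigcup_(k in [set k | (k <= n)%N]) g_sigma_algebra_preimage (X k) >>.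

(* The kernel K is total on R, but only its values at points of S matter: a
   transition kernel on the Borel set S is extended outside S arbitrarily. The
   law of X 0 is left unconstrained. *)
Record markov_chain S (K : R.-pker (measurableTypeR R) ~> (measurableTypeR R))
    X : Prop := MarkovChain {
  measurable_states : measurable S ;
  transitions_in_states : forall x, S x -> K x S = 1 ;
  chain_in_states : forall n w, S (X n w) ;
  markov_property : forall n A B, history X n A -> measurable B ->
    P (A `&` X n.+1 @^-1` B) = \int[P]_(w in A) K (X n w) B }.

Definition renewal_measure X (B : set R) : \bar R :=
  \sum_(0 <= n <oo) P (X n @^-1` B).

End markov_chain.

Section jumps.
Context {R : realType}.
Variable K : R.-pker (measurableTypeR R) ~> (measurableTypeR R).

(* The law of the jump xi(x); xi(x) itself is the identity under this law. *)
Definition jump (x y : measurableTypeR R) : measurableTypeR R := (y - x)%R.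

Definition jump_law (x : R) : set (measurableTypeR R) -> \bar R :=
  pushforward (K x) (jump x).

Lemma measurable_jump x : measurable_fun [set: measurableTypeR R] (jump x).
Proof. exact: measurable_funB. Qed.

Section jump_law_probability.
Variable x : R.

Let jump_law_measure : {measure set (measurableTypeR R) -> \bar R} :=
  measure_function_pushforward__canonical__measure_function_Measure
    (K x) (measurable_jump x).

Let jump_law0 : jump_law x set0 = 0.
Proof. exact: (measure0 jump_law_measure). Qed.

Let jump_law_ge0 A : 0 <= jump_law x A.
Proof. exact: (measure_ge0 jump_law_measure). Qed.

Let jump_law_sigma_additive : semi_sigma_additive (jump_law x).
Proof. exact: (@measure_semi_sigma_additive _ _ _ jump_law_measure). Qed.

HB.instance Definition _ := isMeasure.Build _ _ _ (jump_law x)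
  jump_law0 jump_law_ge0 jump_law_sigma_additive.

Let jump_law_setT : jump_law x [set: _] = 1.
Proof. by rewrite /jump_law /pushforward preimage_setT prob_kernel. Qed.

HB.instance Definition _ :=
  Measure_isProbability.Build _ _ _ (jump_law x) jump_law_setT.

End jump_law_probability.

(* m_k^{[s]}(x) *)
Definition truncated_moment (k : nat) (s x : R) : R :=
  (\int[jump_law x]_(z in [set z | `|z| <= s]) z ^+ k)%R.

End jumps.

(* f under mu is stochastically dominated by g under nu. *)
Definition st_le {R : realType} {d d' : measure_display}
    {T : measurableType d} {T' : measurableType d'}
    (mu : set T -> \bar R) (f : T -> R) (nu : set T' -> \bar R) (g : T' -> R) :=
  forall t : R, mu [set w | (t < f w)%R] <= nu [set w | (t < g w)%R].

Local Close Scope ereal_scope.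

Definition nondecreasing_on {R : realType} (D : set R) (f : R -> R) :=
  forall x y, D x -> D y -> x <= y -> f x <= f y.

Definition nonincreasing_on {R : realType} (D : set R) (f : R -> R) :=
  forall x y, D x -> D y -> x <= y -> f y <= f x.

(* h(x) increases to infinity; monotonicity is only required eventually. *)
Definition increases_to_infty {R : realType} (h : R -> R) :=
  (exists a : R, nondecreasing_on `[a, +oo[ h) /\ h x @[x --> +oo] --> +oo.

(* Enables the Landau notation f =o_ (pinfty_nbhs R) g. *)
Canonical pinfty_filter_on (R : numFieldType) :=
  FilterType (pinfty_nbhs R) _.

(* Main.v *)
(* Let L f y = E f(y + xi(y)) - f y, so that, for a bounded f, the sum over k < n
   of E (L f)(X_k) is E f(X_n) - E f(X_0), hence bounded in n. For f = a u / (a + u),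
   where u is a function of Huber type (zero, then quadratic, then linear), L f is
   bounded below by a multiple of the indicator of a unit cell; this gives a bound
   C / v x for the Green function of a cell near x, uniformly in n, and similar
   bounds for the large jumps and for the far right. They also show that the chain
   eventually stays above any given level with probability close to 1.

   Next let f be the approximate potential of the indicator of ]x, x + h], namely
   h / v x times 1 - exp(-2 v x u / (b h)) with u as above. Then E f(X_n) - E f(X_0)
   comes close to h / v x, while L f differs from that indicator by errors whose
   Green function is o(h / v x) by the bounds of the first step. *)

Require Import Defs.
From mathcomp Require Import lra ring.

Local Open Scope classical_set_scope.
Local Open Scope ring_scope.

(** * Bounded measurable functions and the transition operator *)

(** Finiteness of the renewal measure is a conclusion, so all estimates are for sums over k < n,
    uniformly in n. The function a u / (a + u) is bounded, yet its curvature relative to its slope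
    is only of order 1 / (a + u): the drift, about v y, still beats the variance term, because y v y
    tends to infinity and 1 / v has slope o(1). An exponential has constant relative curvature, too
    much once v y is small; in the potential it is harmless, since there the errors carry an
    exponentially small weight on the scale 1 / v x. The obstacle is the large jumps. Nothing is
    known of where they land, so each may cost the full height of the test function, and bounding
    their number by the same Lyapunov argument is circular. The circle closes because the sum of 2^k
    p(2^k) has small tails. The square integrable majorant serves twice: uniform integrability of
    the squared jumps yields the gain b / 2 inside the window, and summability over j of the tails
    E[|xi|; |xi| > j] makes the gain outside the window negligible although the slope h of u is
    unbounded. *)

Definition bmf {R : realType} {d} {T : measurableType d} (f : T -> R) :=
  measurable_fun setT f /\ exists M, forall x, `|f x| <= M.

Section bounded_measurable.
Context {R : realType} {d : measure_display} {T : measurableType d}.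
Implicit Types (f g : T -> R) (A : set T).

Lemma bmfD f g : bmf f -> bmf g -> bmf (fun x => f x + g x).
Proof.
move=> [mf [M fM]] [mg [N gN]]; split; first exact: measurable_funD.
by exists (M + N) => x; rewrite (le_trans (ler_normD _ _))// lerD.
Qed.

Lemma bmfM f g : bmf f -> bmf g -> bmf (fun x => f x * g x).
Proof.
move=> [mf [M fM]] [mg [N gN]]; split; first exact: measurable_funM.
by exists (M * N) => x; rewrite normrM ler_pM.
Qed.

Lemma bmf_cst (c : R) : bmf (fun _ : T => c).
Proof. by split; [exact: measurable_cst | exists `|c|]. Qed.

Lemma bmfN f : bmf f -> bmf (fun x => - f x).
Proof.
move=> [mf [M fM]]; split; first exact: measurable_funN.
by exists M => x; rewrite normrN.
Qed.

Lemma bmfB f g : bmf f -> bmf g -> bmf (fun x => f x - g x).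
Proof. by move=> bf bg; apply: bmfD => //; exact: bmfN. Qed.

Lemma bmfZ (c : R) f : bmf f -> bmf (fun x => c * f x).
Proof. by move=> bf; apply: bmfM => //; exact: bmf_cst. Qed.

Lemma bmf_indic A : measurable A -> bmf (\1_A : T -> R).
Proof.
move=> mA; split; first exact: measurable_indic.
by exists 1 => x; rewrite indicE; case: (_ \in _); rewrite ?normr1 ?normr0.
Qed.

Lemma eq_bmf f g : f =1 g -> bmf f -> bmf g.
Proof. by move=> /funext ->. Qed.

Lemma bmf_sum (I : Type) (r : seq I) (Q : pred I) (f : I -> T -> R) :
  (forall i, Q i -> bmf (f i)) -> bmf (fun x => \sum_(i <- r | Q i) f i x).
Proof.
move=> bf; elim: r => [|i r IH].
  by apply: eq_bmf (bmf_cst 0) => x; rewrite big_nil.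
have [Qi|nQi] := boolP (Q i).
  by apply: eq_bmf (bmfD (bf i Qi) IH) => x; rewrite big_cons Qi.
by apply: eq_bmf IH => x; rewrite big_cons (negbTE nQi).
Qed.

Variable mu : probability T R.

Lemma bmf_integrable f A : measurable A -> bmf f -> mu.-integrable A (EFin \o f).
Proof.
move=> mA [mf [M fM]]; apply: (@measurable_bounded_integrable _ _ _ mu) => //.
- by rewrite (le_lt_trans (probability_le1 mu mA))// ltry.
- exact: measurable_funTS.
- exists M; split; first exact: num_real.
  by move=> N MN x _; exact: le_trans (fM x) (ltW MN).
Qed.

Lemma bmf_intD f g : bmf f -> bmf g ->
  \int[mu]_x (f x + g x) = \int[mu]_x f x + \int[mu]_x g x.
Proof. by move=> bf bg; rewrite RintegralD//; exact: bmf_integrable. Qed.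

Lemma bmf_intB f g : bmf f -> bmf g ->
  \int[mu]_x (f x - g x) = \int[mu]_x f x - \int[mu]_x g x.
Proof. by move=> bf bg; rewrite RintegralB//; exact: bmf_integrable. Qed.

Lemma bmf_intZ (c : R) f : bmf f -> \int[mu]_x (c * f x) = c * \int[mu]_x f x.
Proof. by move=> bf; rewrite RintegralZl//; exact: bmf_integrable. Qed.

Lemma bmf_int_cst (c : R) : \int[mu]_x c = c.
Proof.
by rewrite Rintegral_cst// [X in fine X]probability_setT mulr1.
Qed.

Lemma le_bmf_int f g : bmf f -> bmf g -> (forall x, f x <= g x) ->
  \int[mu]_x f x <= \int[mu]_x g x.
Proof. by move=> bf bg fg; apply: le_Rintegral => //; exact: bmf_integrable. Qed.

Lemma bmf_int_ge0 f : (forall x, 0 <= f x) -> 0 <= \int[mu]_x f x.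
Proof. by move=> f0; apply: Rintegral_ge0. Qed.

Lemma bmf_int_indic A : measurable A -> (\int[mu]_x \1_A x)%:E = mu A.
Proof.
move=> mA; rewrite /Rintegral integral_indic// setIT fineK//.
by rewrite fin_num_measure.
Qed.

Lemma bmf_int_setI A f : \int[mu]_(x in A) f x = \int[mu]_x (\1_A x * f x).
Proof.
rewrite Rintegral_mkcond; apply: eq_Rintegral => x _.
by rewrite patchE indicE; case: ifPn => _; rewrite ?mul1r ?mul0r.
Qed.

Lemma bmf_int_sum (I : Type) (r : seq I) (Q : pred I) (f : I -> T -> R) :
  (forall i, Q i -> bmf (f i)) ->
  \int[mu]_x (\sum_(i <- r | Q i) f i x) = \sum_(i <- r | Q i) \int[mu]_x f i x.
Proof.
move=> bf; elim: r => [|i r IH].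
  by under eq_Rintegral do rewrite big_nil; rewrite bmf_int_cst big_nil.
under eq_Rintegral do rewrite big_cons; rewrite big_cons; case: ifPn => // Qi.
by rewrite bmf_intD ?IH//; [exact: bf | exact: bmf_sum].
Qed.

End bounded_measurable.

Lemma bmf_comp {R : realType} d d' (T : measurableType d)
    (T' : measurableType d') (f : T' -> R) (g : T -> T') :
  measurable_fun setT g -> bmf f -> bmf (fun x => f (g x)).
Proof.
move=> mg [mf [M fM]]; split; last by exists M => x; exact: fM.
exact: (measurableT_comp mf mg).
Qed.

(** * Positive linear functionals are determined by indicators *)

Section functionals.
Context {R : realType} {d : measure_display} {T : measurableType d}.

Lemma staircase (eps h : R) (n : nat) : 0 < eps -> 0 <= h ->
  let g := \sum_(i < n) eps * (eps * i.+1%:R <= h)%R%:R in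
  if eps * n%:R <= h then g = eps * n%:R else g <= h <= g + eps.
Proof.
move=> e0 h0 /=; elim: n => [|n]; first by rewrite mulr0 h0 big_ord0.
rewrite big_ord_recr/=; set g := \sum_(i < n) _.
have -> : eps * n.+1%:R = eps * n%:R + eps by rewrite -natr1 mulrDr mulr1.
case: (leP (eps * n%:R + eps) h) => hn.
  by rewrite (le_trans _ hn) ?lerDl ?(ltW e0)// mulr1 => ->.
rewrite mulr0 addr0; case: ifPn => [enh -> |//].
by rewrite enh (ltW hn).
Qed.

Definition positive_linear (L : (T -> R) -> R) :=
  [/\ forall f g, bmf f -> bmf g -> L (fun x => f x + g x) = L f + L g,
      forall c f, bmf f -> L (fun x => c * f x) = c * L f &
      forall f g, bmf f -> bmf g -> (forall x, f x <= g x) -> L f <= L g].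

Lemma positive_linear_sum L (I : Type) (r : seq I) (f : I -> T -> R) :
  positive_linear L -> (forall i, bmf (f i)) ->
  L (fun x => \sum_(i <- r) f i x) = \sum_(i <- r) L (f i).
Proof.
move=> [LD LZ _] bf; elim: r => [|i r IH].
  rewrite big_nil -[RHS](mul0r (L (fun=> 1))) -LZ; last exact: bmf_cst.
  by congr L; apply/funext => x; rewrite big_nil mul0r.
rewrite big_cons -IH -LD//; last exact: bmf_sum.
by congr L; apply/funext => x; rewrite big_cons.
Qed.

(** A finite staircase of superlevel sets approximates [f + |M|] from below within [eps], uniformly;
    by positivity the functionals differ on [f] by at most [eps] times the mass of 1. This carries
    the Markov property from events to bounded functions. *)
Lemma positive_linear_ext L1 L2 : positive_linear L1 -> positive_linear L2 ->
  (forall A, measurable A -> L1 \1_A = L2 \1_A) ->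
  forall f, bmf f -> L1 f = L2 f.
Proof.
move=> pL1 pL2 L12 f bf.
have [mf [M fM]] := bf.
have LT : L1 (fun=> 1) = L2 (fun=> 1).
  have := L12 _ measurableT; congr (L1 _ = L2 _);
    by apply/funext => x; rewrite indicE in_setT.
have L1_ge0 : 0 <= L1 (fun=> 1).
  have [_ LZ LM] := pL1; rewrite -(mul0r (L1 (fun=> 1))) -LZ; last exact: bmf_cst.
  by apply: LM => [||x]; [apply: bmfZ|..|rewrite mul0r]; by [exact: bmf_cst|].
apply/eqP; rewrite eq_le; apply/andP.
suff H L L' : positive_linear L -> positive_linear L' ->
    (forall A, measurable A -> L \1_A = L' \1_A) -> L (fun=> 1) = L' (fun=> 1) ->
    0 <= L (fun=> 1) -> L f <= L' f.
  split; first exact: H.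
  by apply: H => //; [move=> A mA; rewrite L12 | rewrite -LT].
move=> {L12 LT L1_ge0 pL1 pL2 L1 L2} pL pL' LL' L1 L0.
apply/ler_addgt0Pr => e e0.
(* The added 1 keeps [c] positive when [L] vanishes. *)
pose c := L (fun=> 1) + 1.
have c0 : 0 < c by rewrite ltr_wpDl.
pose eps := e / c; have eps0 : 0 < eps by rewrite divr_gt0.
(* The values of [f + |M|] lie in [0, 2 |M|], so with this many steps the staircase never
   saturates. *)
have [N NM] : exists N : nat, 2 * `|M| + 1 < eps * N%:R.
  exists (Num.bound ((2 * `|M| + 1) / eps)).
  rewrite [ltRHS]mulrC -ltr_pdivrMr//; apply: archi_boundP.
  by rewrite divr_ge0// ?(ltW eps0)// addr_ge0// mulr_ge0.
pose A (i : nat) : set T := [set x | eps * i.+1%:R <= f x + `|M|].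
have mA i : measurable (A i).
  rewrite -[A i]setTI.
  apply: (@measurable_fun_le _ _ _ setT (fun=> eps * i.+1%:R)
    (fun x => f x + `|M|)) => //; exact: measurable_funD.
pose g x := \sum_(i <- iota 0 N) eps * \1_(A i) x.
have bA i : bmf (fun x => eps * \1_(A i) x) by apply/bmfZ/bmf_indic.
have bg : bmf g by exact: bmf_sum.
have gE x : g x = \sum_(i < N) eps * (eps * i.+1%:R <= f x + `|M|)%R%:R.
  rewrite /g -[N in iota 0 N]subn0 -/(index_iota 0 N) big_mkord.
  apply: eq_bigr => i _; rewrite indicE; congr (_ * (nat_of_bool _)%:R).
  by apply/idP/idP; rewrite inE.
have fg x : g x <= f x + `|M| <= g x + eps.
  have fM0 : 0 <= f x + `|M|.
    have := fM x; rewrite ler_norml => /andP[fM1 _].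
    by have := ler_norm M; lra.
  have := staircase N eps0 fM0; rewrite /= -gE; case: ifPn => // h.
  exfalso; have := fM x; rewrite ler_norml => /andP[_ fM2].
  have := ler_norm M; have := normr_ge0 M; lra.
have Lg : L g = L' g.
  rewrite /g !positive_linear_sum//; apply: eq_bigr => i _.
  have [_ LZ _] := pL; have [_ LZ' _] := pL'.
  by rewrite LZ ?LZ' ?LL'//; exact: bmf_indic.
have [LD LZ LM] := pL; have [LD' LZ' LM'] := pL'.
have b1 : bmf (fun x : T => 1 : R) by exact: bmf_cst.
have lhs : L f <= L g + (eps - `|M|) * L (fun=> 1).
  rewrite -LZ// -LD//; last exact: bmfZ.
  by apply: LM => // [|x]; [apply: bmfD => //; exact: bmfZ|]; have := fg x; lra.
have rhs : L' g + (- `|M|) * L (fun=> 1) <= L' f.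
  rewrite L1 -LZ'// -LD'//; last exact: bmfZ.
  by apply: LM' => // [|x]; [apply: bmfD => //; exact: bmfZ|]; have := fg x; lra.
have : eps * L (fun=> 1) <= e.
  rewrite /eps mulrAC ler_pdivrMr// ler_wpM2l ?(ltW e0)//.
  by rewrite /c lerDl.
lra.
Qed.

End functionals.

(** * The transition operator and the Markov property for bounded functions *)

Section chain.
Context {R : realType} {d : measure_display} {T : measurableType d}.
Variable K : R.-pker (measurableTypeR R) ~> (measurableTypeR R).
Implicit Types (f g : measurableTypeR R -> R).

Definition jint (y : R) (g : measurableTypeR R -> R) : R :=
  (\int[jump_law K y]_t g t)%R.

(** The transition operator, written through the jump law because the hypotheses speak of jumps;
    [kopE] is the form through the kernel, which gives measurability in [y]. *)
Definition kop f : measurableTypeR R -> R := fun y => jint y (fun t => f (y + t)).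

Lemma bmf_shift (y : R) f : bmf f ->
  bmf (fun t : measurableTypeR R => f (y + t)).
Proof.
move=> bf; apply: (@bmf_comp _ _ _ (measurableTypeR R) (measurableTypeR R) f) => //.
by apply: measurable_funD => //; exact: measurable_cst.
Qed.

Lemma kopE f y : bmf f -> (forall x, 0 <= f x) ->
  kop f y = fine (\int[K y]_z (f z)%:E)%E.
Proof.
move=> bf f0; rewrite /kop /jint /Rintegral; congr fine.
rewrite /jump_law ge0_integral_pushforward//.
- by apply: eq_integral => z _ /=; rewrite /jump addrC subrK.
- exact: measurable_jump.
- by apply/measurable_EFinP; case: (bmf_shift y bf).
- by move=> z _; rewrite lee_fin.
Qed.

Lemma bmf_kop f : bmf f -> bmf (kop f).
Proof.
suff H g : bmf g -> (forall x, 0 <= g x) -> bmf (kop g).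
  move=> bf; have [mf [M fM]] := bf.
  have bg : bmf (fun x => f x + M) by apply: bmfD => //; exact: bmf_cst.
  have g0 x : 0 <= f x + M.
    by have := fM x; rewrite ler_norml => /andP[]; lra.
  have := bmfB (H _ bg g0) (bmf_cst M).
  apply: eq_bmf => y; rewrite /kop /jint.
  rewrite bmf_intD; [|exact: bmf_shift|exact: bmf_cst].
  by rewrite bmf_int_cst addrK.
move=> bg g0; have [mg [M gM]] := bg; split; last first.
  exists M => y; rewrite ger0_norm; last by apply: bmf_int_ge0 => t; exact: g0.
  rewrite -[leRHS](bmf_int_cst (jump_law K y)); apply: le_bmf_int.
  - exact: bmf_shift.
  - exact: bmf_cst.
  - by move=> t; exact: le_trans (ler_norm _) (gM _).
rewrite (_ : kop g = fun y => fine (\int[K y]_z (g z)%:E)%E); last first.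
  by apply/funext => y; rewrite kopE.
apply: measurableT_comp => //.
apply: measurable_fun_integral_kernel.
- by move=> U mU; exact: measurable_kernel.
- by move=> z; rewrite lee_fin.
- exact/measurable_EFinP.
Qed.

Variables (S : set R) (P : probability T R) (X : nat -> {RV P >-> R}).
Hypothesis chainX : markov_chain S K X.

Lemma history_measurable n A : history X n A -> measurable A.
Proof.
apply: smallest_sub; first exact: sigma_algebra_measurable.
move=> B [k _]; case=> C mC <-.
by apply: measurable_funP => //; exact: mC.
Qed.

Lemma kop_indic B y : measurable B -> kop \1_B y = fine (K y B).
Proof.
move=> mB; rewrite kopE; [|exact: bmf_indic|by move=> x; rewrite indicE].
by rewrite integral_indic// setIT.
Qed.

Lemma bmfX f n : bmf f -> bmf (fun w => f (X n w)).
Proof.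
apply: (@bmf_comp _ _ _ _ (measurableTypeR R) f (X n)).
by move=> mD B mB; exact: (measurable_funPT (X n) mD B mB).
Qed.

(** Both sides are positive linear in [f], and the Markov property equates them on indicators. The
    event [A] of the past is kept for the stopping argument in [expect_ge_hit]. *)
Lemma markov_kop n A f : history X n A -> bmf f ->
  \int[P]_w (\1_A w * f (X n.+1 w)) = \int[P]_w (\1_A w * kop f (X n w)).
Proof.
move=> hA; have mA := history_measurable hA; move: f.
have bA : bmf (\1_A : T -> R) by exact: bmf_indic.
apply: (@positive_linear_ext _ _ _
  (fun f => \int[P]_w (\1_A w * f (X n.+1 w)))
  (fun f => \int[P]_w (\1_A w * kop f (X n w)))).
- split=> [f g bf bg|c f bf|f g bf bg fg].
  + rewrite -bmf_intD; [|by apply: bmfM => //; exact: bmfX..].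
    by apply: eq_Rintegral => w _; rewrite mulrDr.
  + rewrite -bmf_intZ; last by apply: bmfM => //; exact: bmfX.
    by apply: eq_Rintegral => w _; rewrite mulrCA.
  + apply: le_bmf_int => [||w]; [by apply: bmfM => //; exact: bmfX..|].
    by rewrite ler_wpM2l.
- split=> [f g bf bg|c f bf|f g bf bg fg].
  + rewrite -bmf_intD; [|by apply: bmfM => //; apply: bmfX; exact: bmf_kop..].
    apply: eq_Rintegral => w _; rewrite -mulrDr; congr (_ * _).
    by rewrite /kop /jint bmf_intD//; exact: bmf_shift.
  + rewrite -bmf_intZ; last by apply: bmfM => //; apply: bmfX; exact: bmf_kop.
    apply: eq_Rintegral => w _; rewrite mulrCA; congr (_ * _).
    by rewrite /kop /jint bmf_intZ//; exact: bmf_shift.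
  + apply: le_bmf_int => [||w].
    1,2: by apply: bmfM => //; apply: bmfX; exact: bmf_kop.
    rewrite ler_wpM2l// /kop /jint; apply: le_bmf_int => //; exact: bmf_shift.
- move=> B mB; have mXB : measurable (X n.+1 @^-1` B).
    by rewrite -[_ @^-1` _]setTI; apply: measurable_funPT.
  transitivity (fine (P (A `&` X n.+1 @^-1` B))).
    rewrite -(bmf_int_indic P); last exact: measurableI.
    by apply: eq_Rintegral => w _; rewrite indicI.
  rewrite (markov_property chainX hA mB) integral_mkcond; congr fine.
  apply: eq_integral => w _; rewrite patchE indicE kop_indic//.
  case: ifPn => _; last by rewrite mul0r.
  rewrite mul1r fineK// ge0_fin_numE//.
  apply: le_lt_trans (ltry 1); rewrite -(@prob_kernel _ _ _ _ _ K (X n w)).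
  by apply: le_measure => //; rewrite inE.
Qed.

End chain.

(** * Finite-horizon Green functions and visits to high levels *)

Section green.
Context {R : realType} {d : measure_display} {T : measurableType d}.
Variable K : R.-pker (measurableTypeR R) ~> (measurableTypeR R).
Variables (S : set R) (P : probability T R) (X : nat -> {RV P >-> R}).
Implicit Types (f g : measurableTypeR R -> R) (n : nat).

Let bmX f n : bmf f -> bmf (fun w => f (X n w)) := @bmfX _ _ _ _ X f n.

Definition expect n g : R := \int[P]_w g (X n w).
(** Stopped at time n: the finite sum exists without any transience, and can be absorbed into the
    left side of an inequality, as in [big_jumps_small]. *)
Definition green n g : R := \sum_(k < n) expect k g.

Hypothesis chainX : markov_chain S K X.

Lemma expectD n f g : bmf f -> bmf g ->
  expect n (fun y => f y + g y) = expect n f + expect n g.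
Proof. by move=> bf bg; rewrite /expect bmf_intD//; exact: bmX. Qed.

Lemma expectZ n (c : R) f : bmf f -> expect n (fun y => c * f y) = c * expect n f.
Proof. by move=> bf; rewrite /expect bmf_intZ//; exact: bmX. Qed.

Lemma expect_cst n (c : R) : expect n (fun=> c) = c.
Proof. exact: bmf_int_cst. Qed.

Lemma le_expect n f g : bmf f -> bmf g -> (forall y, S y -> f y <= g y) ->
  expect n f <= expect n g.
Proof.
move=> bf bg fg; apply: le_bmf_int; [exact: bmX..|] => w.
by apply: fg; exact: (chain_in_states chainX).
Qed.

Lemma expect_ge0 n f : (forall y, 0 <= f y) -> 0 <= expect n f.
Proof. by move=> f0; apply: bmf_int_ge0. Qed.

Lemma expectE n (B : set R) : measurable B ->
  (expect n \1_B)%:E = P (X n @^-1` B).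
Proof.
move=> mB; rewrite /expect -bmf_int_indic//.
by rewrite -[_ @^-1` _]setTI; apply: measurable_funPT.
Qed.

Lemma greenD n f g : bmf f -> bmf g ->
  green n (fun y => f y + g y) = green n f + green n g.
Proof.
by move=> bf bg; rewrite /green -big_split; apply: eq_bigr => k _; rewrite expectD.
Qed.

Lemma greenZ n (c : R) f : bmf f -> green n (fun y => c * f y) = c * green n f.
Proof.
by move=> bf; rewrite /green mulr_sumr; apply: eq_bigr => k _; rewrite expectZ.
Qed.

Lemma greenB n f g : bmf f -> bmf g ->
  green n (fun y => f y - g y) = green n f - green n g.
Proof.
move=> bf bg; rewrite greenD//; last exact: bmfN.
rewrite -[in RHS](mul1r (green n g)) -mulNr -greenZ//.
by congr (_ + green n _); apply/funext => y; rewrite mulN1r.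
Qed.

Lemma green_cst n (c : R) : green n (fun=> c) = c * n%:R.
Proof.
rewrite /green; under eq_bigr do rewrite expect_cst.
by rewrite sumr_const card_ord mulr_natr.
Qed.

Lemma le_green n f g : bmf f -> bmf g -> (forall y, S y -> f y <= g y) ->
  green n f <= green n g.
Proof. by move=> bf bg fg; apply: ler_sum => k _; exact: le_expect. Qed.

Lemma green_ge0 n f : (forall y, 0 <= f y) -> 0 <= green n f.
Proof. by move=> f0; apply: sumr_ge0 => k _; exact: expect_ge0. Qed.

Lemma green_sum n (I : Type) (r : seq I) (f : I -> measurableTypeR R -> R) :
  (forall i, bmf (f i)) ->
  green n (fun y => \sum_(i <- r) f i y) = \sum_(i <- r) green n (f i).
Proof.
move=> bf; rewrite /green [RHS]exchange_big/=; apply: eq_bigr => k _.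
by rewrite /expect bmf_int_sum// => i _; exact: bmX.
Qed.

Lemma expect_kop n f : bmf f -> expect n.+1 f = expect n (kop K f).
Proof.
move=> bf; rewrite /expect.
have hT : history X n setT.
  rewrite -setC0; apply: sigma_algebraC.
  by have [] := smallest_sigma_algebra setT
    (\bigcup_(k in [set k | (k <= n)%N]) g_sigma_algebra_preimage (X k)).
have := markov_kop chainX hT bf.
by congr (_ = _); apply: eq_Rintegral => w _; rewrite indicE in_setT mul1r.
Qed.

Lemma green_kop n f : bmf f ->
  green n (fun y => kop K f y - f y) = expect n f - expect 0 f.
Proof.
move=> bf; rewrite greenB//; last exact: bmf_kop.
elim: n => [|n IH]; first by rewrite /green !big_ord0 !subrr.
rewrite /green !big_ord_recr/= -/(green n f) -/(green n (kop K f)).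
by rewrite -expect_kop// in IH *; lra.
Qed.

Lemma greenE n (B : set R) : measurable B ->
  (green n \1_B)%:E = (\sum_(0 <= k < n) P (X k @^-1` B))%E.
Proof.
move=> mB; rewrite big_mkord -sumEFin; apply: eq_bigr => k _.
by rewrite expectE.
Qed.

Lemma green_le_renewal n (B : set R) : measurable B ->
  ((green n \1_B)%:E <= renewal_measure X B)%E.
Proof.
move=> mB; rewrite greenE//; apply: nneseries_lim_ge => k _ _.
exact: measure_ge0.
Qed.

Lemma renewal_le_green (c : R) (B : set R) : measurable B ->
  (forall n, green n \1_B <= c) -> (renewal_measure X B <= c%:E)%E.
Proof.
move=> mB gc; apply: lime_le; first exact: is_cvg_nneseries.
by apply: nearW => n; rewrite -greenE// lee_fin.
Qed.

Definition hit (r : R) n : set T := \bigcup_(k in [set k | (k <= n)%N])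
  X k @^-1` `]r, +oo[.

Lemma history_hit r n : history X n (hit r n).
Proof.
rewrite /hit bigcup_mkcond; apply: sigma_algebra_bigcup => k.
case: ifPn => [|_]; last first.
  by have [] := smallest_sigma_algebra setT
    (\bigcup_(k in [set k | (k <= n)%N]) g_sigma_algebra_preimage (X k)).
rewrite inE/= => kn; apply: sub_gen_smallest; exists k => //.
by exists [set` `]r, +oo[] => //; rewrite setTI.
Qed.

Lemma measurable_hit r n : measurable (hit r n).
Proof. by apply: history_measurable; exact: history_hit. Qed.

Lemma hit_succ r n : hit r n.+1 = hit r n `|` X n.+1 @^-1` `]r, +oo[.
Proof.
apply/seteqP; split => w /=.
  move=> [k /= kn Xk]; case: (leqP k n) => kn'; first by left; exists k.
  by right; have -> : n.+1 = k by apply/eqP; rewrite eqn_leq kn kn'.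
by move=> [[k /= kn Xk]|Xn]; [exists k => //=; exact: leqW | exists n.+1 => /=].
Qed.

(* A bounded function that is a submartingale up to the error g is at least
   c P(hit) after the level r, above which it exceeds c, has been visited. *)
Lemma expect_ge_hit f g (c r : R) n : bmf f -> bmf g ->
  (forall y, 0 <= f y) -> (forall y, 0 <= g y) ->
  (forall y, S y -> f y - g y <= kop K f y) -> (forall y, r < y -> c <= f y) ->
  c * fine (P (hit r n)) - green n g <= expect n f.
Proof.
move=> bf bg f0 g0 fg fc.
have bH k : bmf (\1_(hit r k) : T -> R) by apply: bmf_indic; exact: measurable_hit.
have bXr k (h : T -> R) : bmf h -> bmf (fun w : T => \1_(hit r k) w * h w)
  by move=> bh; exact: (bmfM (bH k) bh).
have PE k : fine (P (hit r k)) = \int[P]_w \1_(hit r k) w.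
  by rewrite -(bmf_int_indic P (measurable_hit r k)).
(* The induction runs on the expectation restricted to paths that have already exceeded [r]. *)
suff: c * fine (P (hit r n)) - green n g <= \int[P]_w (\1_(hit r n) w * f (X n w)).
  move=> /le_trans; apply; apply: le_bmf_int; [|exact: bmX|].
    exact/bXr/bmX.
  by move=> w; rewrite indicE; case: (_ \in _); rewrite ?mul1r ?mul0r//.
have cE k : c * fine (P (hit r k)) = \int[P]_w (c * \1_(hit r k) w).
  by rewrite PE bmf_intZ.
elim: n => [|n IH].
  rewrite /green big_ord0 subr0 cE; apply: le_bmf_int.
  - exact: bmfZ.
  - exact/bXr/bmX.
  - move=> w; rewrite indicE; case: (boolP (w \in _)) => [|_]; last by rewrite mulr0 mul0r.
    rewrite inE => -[k /=]; rewrite leqn0 => /eqP ->; rewrite in_itv/= andbT => rX.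
    by rewrite mulr1 mul1r fc.
rewrite /green big_ord_recr/= -/(green n g).
(* Paths exceeding [r] for the first time at time n + 1 bring in at least [c] each; the earlier ones
   move by one transition, in which [f] loses at most [g] on average. *)
apply: (@le_trans _ _ (\int[P]_w (\1_(hit r n) w * f (X n.+1 w)) +
    (c * fine (P (hit r n.+1)) - c * fine (P (hit r n))))); last first.
  have bB := bmfB (bmfZ c (bH n.+1)) (bmfZ c (bH n)).
  have bX := bXr n _ (bmX n.+1 bf).
  rewrite !cE -(bmf_intB P (bmfZ c (bH n.+1)) (bmfZ c (bH n))) -(bmf_intD P bX bB).
  apply: le_bmf_int; [exact: bmfD|exact/bXr/bmX|].
  move=> w; rewrite hit_succ !indicE in_setU.
  case: (boolP (w \in hit r n)) => _ /=; first by rewrite subrr addr0.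
  case: (boolP (w \in _)); rewrite ?(mul0r,mulr0,subr0,add0r)//.
  by rewrite inE/= in_itv/= andbT => rX; rewrite mulr1 mul1r fc.
rewrite (markov_kop chainX (@history_hit r n) bf).
have : \int[P]_w (\1_(hit r n) w * (f (X n w) - g (X n w))) <=
    \int[P]_w (\1_(hit r n) w * kop K f (X n w)).
  apply: le_bmf_int.
  - by apply/bXr/bmfB; exact: bmX.
  - exact/bXr/bmX/bmf_kop.
  - by move=> w; rewrite ler_wpM2l// fg//; exact: (chain_in_states chainX).
have : \int[P]_w (\1_(hit r n) w * f (X n w)) - expect n g <=
    \int[P]_w (\1_(hit r n) w * (f (X n w) - g (X n w))).
  rewrite -(bmf_intB P (bXr n _ (bmX n bf)) (bmX n bg)).
  apply: le_bmf_int.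
  - by apply: bmfB; [exact/bXr/bmX|exact: bmX].
  - by apply/bXr/bmfB; exact: bmX.
  - by move=> w; rewrite mulrBr lerB// ler_piMl// indicE.
lra.
Qed.

(** Off the union of the events [hit r n] the path never exceeds [r], so its limsup is at most [r].
    That union therefore has full measure, and continuity from below applies. *)
Lemma hit_cvg1 r (e : R) : 0 < e ->
  {ae P, forall w, limn_esup (fun n => (X n w)%:E) = +oo%E} ->
  exists N, forall n, (N <= n)%N -> 1 - e <= fine (P (hit r n)).
Proof.
move=> e0 limX; have mH := measurable_hit r.
have mU : measurable (\bigcup_n hit r n) by exact: bigcup_measurable.
have PU : P (\bigcup_n hit r n) = 1%E.
  rewrite -[X in P X]setCK probability_setC; last exact: measurableC.
  rewrite (measure_negligible (measurableC mU)) ?sube0//.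
  apply: negligibleS limX => w /= nU lw; apply: nU; apply: contrapT => nU.
  suff : (limn_esup (fun n => (X n w)%:E) <= r%:E)%E by rewrite lw leye_eq.
  apply: ereal_inf_le; exists (ereal_sup [set (X n w)%:E | n in setT]).
    by exists setT => //; exact: filterT.
  apply: ge_ereal_sup => _ [n _ <-]; rewrite lee_fin leNgt; apply/negP => rX.
  by apply: nU; exists n => //; exists n => //=; rewrite in_itv/= andbT.
have hitS : {homo hit r : n m / (n <= m)%N >-> (n <= m)%O}.
  by move=> n m nm; apply/subsetPset => w [k /= kn Xk]; exists k => //=; exact: leq_trans nm.
have : P (hit r n) @[n --> \oo] --> 1%E.
  by rewrite -PU; exact: nondecreasing_cvg_mu.
move=> /fine_cvgP[_] /cvgrPdist_le /(_ _ e0)[N _ NP]; exists N => n Nn.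
by have := NP n Nn; rewrite /= ler_norml => /andP[_]; lra.
Qed.

End green.

(** * Test functions *)

Section huber.
Context {R : realType}.
Implicit Types L u t D : R.

Definition huber L u : R :=
  if u <= 0 then 0 else if u <= L then u ^+ 2 / 2 else L * u - L ^+ 2 / 2.

Definition hslope L u : R := if u <= 0 then 0 else if u <= L then u else L.

(** The excess over the tangent. Only steps that meet the curved part [0, L] contribute: t^2 / 2
    when both ends lie in it, nothing when both ends lie on the same side of it. *)
Definition hgain L u t : R := huber L (u + t) - huber L u - hslope L u * t.

Lemma hslope_bounds L u : 0 <= L -> 0 <= hslope L u <= L.
Proof.
move=> L0; rewrite /hslope; case: (leP u 0) => [_|u0]; first by rewrite lexx.
by case: (leP u L) => uL; rewrite ?L0 ?lexx ?uL ?(ltW u0).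
Qed.

Lemma huber_ge0 L u : 0 <= L -> 0 <= huber L u.
Proof.
move=> L0; rewrite /huber; case: (leP u 0) => // u0; case: (leP u L) => uL; nra.
Qed.

Lemma huber0 L u : u <= 0 -> huber L u = 0.
Proof. by rewrite /huber => ->. Qed.

Lemma huber_ge_linear L u : 0 <= L -> L * u - L ^+ 2 / 2 <= huber L u.
Proof.
move=> L0; rewrite /huber; case: (leP u 0) => [u0|u0]; [nra|].
case: (leP u L) => uL; last by rewrite lexx.
have := sqr_ge0 (u - L); lra.
Qed.

Lemma huber_le_linear L u : 0 <= L -> 0 <= u -> huber L u <= L * u.
Proof.
move=> L0 u0; rewrite /huber; case: (leP u 0) => [_|u1]; [nra|].
by case: (leP u L) => uL; nra.
Qed.

Lemma huber_right L u : 0 <= L -> L <= u -> huber L u = L * u - L ^+ 2 / 2.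
Proof.
move=> L0 Lu; rewrite /huber; case: (leP u 0) => u0.
  have -> : u = 0 by lra.
  by rewrite (_ : L = 0); lra.
by case: (leP u L) => // uL; rewrite (_ : u = L); lra.
Qed.

Lemma hslope_right L u : 0 <= L -> L <= u -> hslope L u = L.
Proof.
move=> L0 Lu; rewrite /hslope; case: (leP u 0) => u0; first by lra.
by case: (leP u L) => // uL; lra.
Qed.

Lemma hslope_mid L u : 0 <= u <= L -> hslope L u = u.
Proof. by move=> /andP[u0 uL]; rewrite /hslope uL; case: (leP u 0) => // u1; lra. Qed.

Lemma huber_mid L u : 0 <= u <= L -> huber L u = u ^+ 2 / 2.
Proof.
move=> /andP[u0 uL]; rewrite /huber uL; case: (leP u 0) => // u1.
by rewrite (_ : u = 0); lra.
Qed.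

Lemma hgain_ge0 L u t : 0 <= L -> 0 <= hgain L u t.
Proof.
move=> L0; rewrite /hgain /huber /hslope.
have := sqr_ge0 (u - L); have := sqr_ge0 (u + t - L); have := sqr_ge0 t.
by case: (leP u 0) => ?; case: (leP u L) => ?; case: (leP (u + t) 0) => ?;
  case: (leP (u + t) L) => ?; nra.
Qed.

Lemma hgain_le_sqr L u t : 0 <= L -> hgain L u t <= t ^+ 2 / 2.
Proof.
move=> L0; rewrite /hgain /huber /hslope.
have := sqr_ge0 (u - L); have := sqr_ge0 (u + t - L); have := sqr_ge0 (u + t).
have := sqr_ge0 u.
by case: (leP u 0) => ?; case: (leP u L) => ?; case: (leP (u + t) 0) => ?;
  case: (leP (u + t) L) => ?; nra.
Qed.

Lemma huber_nd L u v : 0 <= L -> u <= v -> huber L u <= huber L v.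
Proof.
by move=> L0 uv; rewrite /huber; case: (leP u 0) => ?; case: (leP u L) => ?;
  case: (leP v 0) => ?; case: (leP v L) => ?; nra.
Qed.

Lemma huber_lip L u v : 0 <= L -> u <= v -> huber L v - huber L u <= L * (v - u).
Proof.
by move=> L0 uv; rewrite /huber; case: (leP u 0) => ?; case: (leP u L) => ?;
  case: (leP v 0) => ?; case: (leP v L) => ?; nra.
Qed.

Lemma huber_dist L u t : 0 <= L -> `|huber L (u + t) - huber L u| <= L * `|t|.
Proof.
move=> L0; have [t0|t0] := leP 0 t.
  have ut : u <= u + t by lra.
  have h1 := huber_lip L0 ut; have h2 := huber_nd L0 ut.
  by rewrite (ger0_norm t0) ger0_norm; lra.
have ut : u + t <= u by lra.
have h1 := huber_lip L0 ut; have h2 := huber_nd L0 ut.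
by rewrite (ltr0_norm t0) ler0_norm; lra.
Qed.

Lemma hgain_le_abs L u t : 0 <= L -> hgain L u t <= L * `|t|.
Proof.
move=> L0; rewrite /hgain; have /andP[k0 kL] := hslope_bounds u L0.
have [t0|t0] := leP 0 t.
  have ut : u <= u + t by lra.
  by rewrite ger0_norm//; have := huber_lip L0 ut; nra.
have ut : u + t <= u by lra.
by rewrite ltr0_norm//; have := huber_nd L0 ut; nra.
Qed.

Lemma hgain_far L u t D : 0 <= L -> 0 <= D -> u <= - D \/ L + D <= u ->
  `|t| <= D -> hgain L u t = 0.
Proof.
move=> L0 D0 uD; rewrite ler_norml => /andP[t1 t2]; rewrite /hgain.
case: uD => uD.
  by rewrite !huber0/hslope; [case: (leP u 0); lra|lra|lra].
by rewrite !huber_right ?hslope_right//; lra.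
Qed.

Lemma hgain_mid L u t : 0 <= u <= L -> 0 <= u + t <= L -> hgain L u t = t ^+ 2 / 2.
Proof. by move=> h1 h2; rewrite /hgain !huber_mid// hslope_mid//; lra. Qed.

Lemma hgain_split L u t k : k = hslope L u ->
  huber L (u + t) = huber L u + (k * t + hgain L u t).
Proof. by rewrite /hgain => ->; lra. Qed.

Lemma measurable_huber L : 0 <= L ->
  measurable_fun [set: measurableTypeR R] (huber L).
Proof. by move=> L0; apply: nondecreasing_measurable => //; by move=> u v; exact: huber_nd. Qed.

(** Its slope is (a / (a + u))^2 and its curvature is -2 / (a + u) times the slope, so the loss
    caused by the variance fades as [u] grows. *)
Definition hyper (a u : R) : R := a * u / (a + u).

Lemma hyper_bounds a u : 0 < a -> 0 <= u -> 0 <= hyper a u <= a.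
Proof.
move=> a0 u0; rewrite /hyper divr_ge0//=; [|nra|lra].
by rewrite ler_pdivrMr; nra.
Qed.

Lemma hyper_nd a u v : 0 < a -> 0 <= u -> u <= v -> hyper a u <= hyper a v.
Proof.
by move=> a0 u0 uv; rewrite /hyper ler_pdivrMr; [rewrite mulrAC ler_pdivlMr; nra|lra].
Qed.

(* The deviation of [hyper] from its tangent is quadratic in the increment
   [k * t + g]; the part of it due to [g] is absorbed by half of [g]. *)
Lemma hyper_increment a u k t g D : 0 < a -> 0 <= u -> 0 <= g -> g <= D ->
  `|k * t + g| <= D -> 8 * D <= a + u ->
  (a / (a + u)) ^+ 2 * (k * t + g / 2 - 4 * k ^+ 2 * t ^+ 2 / (a + u)) <=
  hyper a (u + (k * t + g)) - hyper a u.
Proof.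
move=> a0 u0 g0 gD; have [dl dlE] : exists dl, dl = k * t + g by eexists.
rewrite -dlE ler_norml => /andP[d1 d2] Da.
set A := a + u in Da *; have A0 : 0 < A by rewrite /A; lra.
have Ad0 : 0 < A + dl by lra.
have -> : hyper a (u + dl) - hyper a u =
    (a / A) ^+ 2 * (dl - dl ^+ 2 / (A + dl)).
  rewrite /hyper (_ : a + (u + dl) = A + dl); last by rewrite /A; lra.
  rewrite -/A (_ : u + dl = A - a + dl); last by rewrite /A; lra.
  rewrite (_ : a * u = a * (A - a)); last by rewrite /A; lra.
  by field; rewrite !gt_eqF.
apply: ler_wpM2l; first exact: sqr_ge0.
suff : dl ^+ 2 / (A + dl) <= g / 2 + 4 * k ^+ 2 * t ^+ 2 / A.
  by lra.
rewrite ler_pdivrMr//.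
set X := 4 * k ^+ 2 * t ^+ 2 / A.
have XE : X * A = 4 * (k * t) ^+ 2 by rewrite /X exprMn; field; rewrite gt_eqF.
have X0 : 0 <= X.
  rewrite /X; apply: divr_ge0; last exact: ltW.
  by have := sqr_ge0 k; have := sqr_ge0 t; nra.
have dl2 : dl ^+ 2 <= 2 * (k * t) ^+ 2 + 2 * g ^+ 2.
  by have := sqr_ge0 (k * t - g); rewrite dlE; lra.
have gg : g ^+ 2 <= g * D by nra.
(* [|dl| <= D <= A / 8], hence the factor 7/8. *)
have : (g / 2 + X) * (7 / 8 * A) <= (g / 2 + X) * (A + dl).
  by apply: ler_wpM2l; [lra|lra].
have : g * (8 * D) <= g * A by apply: ler_wpM2l.
nra.
Qed.

End huber.

(** * Taylor estimates for the exponential *)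

Section exponential.
Context {R : realType}.
Implicit Types x : R.

(** Since 1 / (n + 3)! <= 1 / n!, the series from degree 3 on is at most |x|^3 times the series of
    exp |x|, term by term. *)
Lemma expR_taylor2 x :
  `|expR x - (1 + x + x ^+ 2 / 2)| <= `|x| ^+ 3 * expR `|x|.
Proof.
have S3 n : `|series (exp_coeff x) (n + 3)%N - (1 + x + x ^+ 2 / 2)| <=
    `|x| ^+ 3 * series (exp_coeff `|x|) n.
  elim: n => [|n IH].
    rewrite !seriesEnat/= [X in _ <= _ * X]big_geq// mulr0 ?add0n big_nat_recr//= big_nat_recr//=.
    rewrite big_nat1 /exp_coeff/= expr0 expr1 divr1 divr1.
    by rewrite subrr normr0.
  rewrite addSn !seriesEnat/= !big_nat_recr//= mulrDr addrAC.
  rewrite (le_trans (ler_normD _ _))// lerD//.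
  rewrite normrM normrX normfV (ger0_norm (ler0n _ _)).
  rewrite mulrA -exprD addnC ler_wpM2l ?exprn_ge0// lef_pV2 ?posrE ?ltr0n ?fact_gt0//.
  by rewrite ler_nat leq_fact ?leq_addl.
have SE n : series (exp_coeff `|x|) n <= expR `|x|.
  apply: nondecreasing_cvgn_le; last exact: is_cvg_series_exp_coeff.
  apply/nondecreasing_seqP => k; rewrite !seriesEnat/= big_nat_recr//= lerDl.
  exact: exp_coeff_ge0.
have cx : `|series (exp_coeff x) (n + 3)%N - (1 + x + x ^+ 2 / 2)| @[n --> \oo] -->
    `|expR x - (1 + x + x ^+ 2 / 2)|.
  apply: cvg_norm; apply: cvgB; last exact: cvg_cst.
  by rewrite (cvg_shiftn 3); exact: is_cvg_series_exp_coeff.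
rewrite -(cvg_lim (@Rhausdorff R) cx); apply: limr_le; first exact: cvgP cx.
apply: nearW => n; apply: le_trans (S3 n) _; rewrite ler_wpM2l// exprn_ge0//.
Qed.

(* [D] is the drift-diffusion part of the increment; the remainder is small
   relative to [g] and to the quadratic term as soon as [eta] is small. *)
Lemma expR_increment (c be h s u k t g eta D : R) : 0 <= c -> 0 < be -> 0 <= h ->
  0 <= k <= h -> `|t| <= s -> 0 <= g -> g <= h * `|t| ->
  `|k * t + g| <= h * `|t| ->
  eta = be * h * s -> D = c * be * expR (- (be * u)) ->
  `|c * (1 - expR (- (be * (u + (k * t + g))))) - c * (1 - expR (- (be * u))) -
    D * (k * t - be / 2 * k ^+ 2 * t ^+ 2 + g)| <=
  D * (2 * eta * expR (2 * eta)) * (g + be * h * k * t ^+ 2).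
Proof.
move=> c0 be0 h0 /andP[k0 kh] ts g0 gh; have [dl dlE] : exists dl, dl = k * t + g by eexists.
rewrite -dlE => dlh etaE DE.
have s0 : 0 <= s by exact: le_trans ts.
have hts : h * `|t| <= h * s by rewrite ler_wpM2l.
have eta0 : 0 <= eta by rewrite etaE !mulr_ge0// ltW.
have dleta : `|be * dl| <= eta.
  by rewrite normrM (gtr0_norm be0) etaE -mulrA ler_wpM2l ?(ltW be0)//; exact: le_trans hts.
set E := expR (- (be * u)).
have E0 : 0 <= E by exact: expR_ge0.
have -> : expR (- (be * (u + dl))) = E * expR (- (be * dl)).
  by rewrite mulrDr opprD expRD.
have [r rE] : exists r, r = expR (- (be * dl)) - (1 + - (be * dl) + (- (be * dl)) ^+ 2 / 2).
  by eexists.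
have r3 : `|r| <= eta * (be * dl) ^+ 2 * expR eta.
  rewrite rE; apply: le_trans (expR_taylor2 _) _; rewrite normrN.
  apply: ler_pM; rewrite ?exprn_ge0 ?expR_ge0//; last by rewrite ler_expR.
  by rewrite exprS -normrX (ger0_norm (sqr_ge0 _)) ler_wpM2r ?sqr_ge0.
(* Beyond drift, diffusion and gain there remain the cross terms of the square of [k * t + g] and
   the cubic Taylor remainder [r]. *)
have -> : c * (1 - E * expR (- (be * dl))) - c * (1 - E) -
    D * (k * t - be / 2 * k ^+ 2 * t ^+ 2 + g) =
  - (D * (be / 2 * (2 * (k * t) * g + g ^+ 2))) - c * E * r.
  by rewrite rE DE -/E dlE; ring.
have D0 : 0 <= D by rewrite DE !mulr_ge0// ltW.
have cE0 : 0 <= c * E by exact: mulr_ge0.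
have ktn : `|k * t| <= h * s.
  rewrite normrM (ger0_norm k0); apply: le_trans hts.
  by rewrite ler_wpM2r.
have gs : g <= h * s by exact: le_trans hts.
have t1 : `|D * (be / 2 * (2 * (k * t) * g + g ^+ 2))| <= D * (3 / 2 * eta * g).
  rewrite normrM (ger0_norm D0) ler_wpM2l// normrM.
  rewrite (_ : `|be / 2| = be / 2); last by rewrite ger0_norm ?divr_ge0// ltW.
  have : `|2 * (k * t) * g + g ^+ 2| <= 3 * (h * s) * g.
    apply: le_trans (ler_normD _ _) _; rewrite (ger0_norm (sqr_ge0 g)).
    rewrite (_ : `|2 * (k * t) * g| = 2 * `|k * t| * g); last first.
      by rewrite normrM (ger0_norm g0) normrM ger0_norm.
    have : `|k * t| * g <= (h * s) * g by rewrite ler_wpM2r.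
    have : g * g <= (h * s) * g by rewrite ler_wpM2r.
    by lra.
  move=> H; have := ler_wpM2l (ltW be0) H; rewrite etaE; lra.
have t2 : `|c * E * r| <= D * (2 * eta * expR eta * (be * h * k * t ^+ 2 + eta * g)).
  rewrite normrM (ger0_norm cE0).
  have : `|r| <= be * (2 * eta * expR eta * (be * h * k * t ^+ 2 + eta * g)).
    apply: le_trans r3 _.
    have dl2 : dl ^+ 2 <= 2 * (h * k * t ^+ 2) + 2 * (h * s * g).
      have := sqr_ge0 (k * t - g).
      have : g * g <= (h * s) * g by rewrite ler_wpM2r.
      have : k * (k * t ^+ 2) <= h * (k * t ^+ 2).
        by rewrite ler_wpM2r// mulr_ge0// sqr_ge0.
      by rewrite dlE; lra.
    have be2 : 0 <= be ^+ 2 * (eta * expR eta).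
      apply: mulr_ge0; first exact: sqr_ge0.
      by apply: mulr_ge0 => //; exact: expR_ge0.
    have hg : eta * g = be * h * s * g by rewrite etaE.
    by have := ler_wpM2l be2 dl2; rewrite hg; lra.
  by move=> H; have := ler_wpM2l cE0 H; rewrite DE -/E; lra.
rewrite (le_trans (ler_normB _ _))// normrN.
have e1 : 1 <= expR eta by have := expR_ge1Dx eta; lra.
have e2 : 1 + eta <= expR eta by exact: expR_ge1Dx.
apply: le_trans (lerD t1 t2) _; rewrite -mulrDr -(mulrA D) ler_wpM2l//.
have q0 : 0 <= be * h * k * t ^+ 2.
  apply: mulr_ge0; last exact: sqr_ge0.
  by apply: mulr_ge0 => //; apply: mulr_ge0 => //; exact: ltW.
move: (be * h * k * t ^+ 2) q0 => q q0.
have -> : expR (2 * eta) = expR eta * expR eta.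
  by rewrite -expRD; congr expR; lra.
move: (expR eta) e1 e2 => e e1 e2.
have h1 : e * (1 + eta) <= e * e by rewrite ler_wpM2l//; lra.
have h2 : 3 / 2 * g + 2 * e * (q + eta * g) <= 2 * (e * e) * (g + q).
  have := ler_wpM2r g0 h1; have : e * 1 * q <= e * e * q.
    by rewrite ler_wpM2r// ler_wpM2l//; lra.
  by have := ler_wpM2r g0 e1; lra.
by have := ler_wpM2l eta0 h2; lra.
Qed.

End exponential.

(** * Truncated moments *)

Section truncation.
Context {R : realType}.
Variables (K : R.-pker (measurableTypeR R) ~> (measurableTypeR R)) (s : R -> R).
Implicit Types (phi psi f : measurableTypeR R -> R) (c y t : R).

(** Strict, so that the complement is exactly the event |z| >= s y of the large-jump hypothesis. The
    moments of the theorem include |z| = s y; [trunc_momentE] pays for the difference. *)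
Definition below c : set (measurableTypeR R) := [set t : R | `|t| < c].

Lemma measurable_below c : measurable (below c).
Proof.
rewrite (_ : below c = [set` `]- c, c[]); first exact: measurable_itv.
by apply/seteqP; split => t; rewrite /below/= in_itv/= ltr_norml.
Qed.

Lemma below1 c t : `|t| < c -> \1_(below c) t = 1 :> R.
Proof. by move=> tc; rewrite indicE mem_set. Qed.

Lemma below0 c t : ~~ (`|t| < c) -> \1_(below c) t = 0 :> R.
Proof. by move=> /negP tc; rewrite indicE memNset. Qed.

(** Powers and Huber gains are unbounded, but their restrictions to |t| < c are bounded: this is the
    class on which [trunc] is linear and monotone. *)
Definition tbm c phi := bmf (fun t : measurableTypeR R => \1_(below c) t * phi t).

Lemma tbm_bound c (C : R) phi : measurable_fun setT phi ->
  (forall t, `|t| < c -> `|phi t| <= C) -> tbm c phi.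
Proof.
move=> mphi phiC; split.
  apply: measurable_funM => //; apply: measurable_indic; exact: measurable_below.
exists `|C| => t; have [tc|tc] := boolP (`|t| < c).
  by rewrite below1// mul1r (le_trans (phiC _ tc))// ler_norm.
by rewrite below0// mul0r normr0.
Qed.

Lemma tbm_bmf c phi : bmf phi -> tbm c phi.
Proof. by move=> bphi; apply: bmfM => //; apply: bmf_indic; exact: measurable_below. Qed.

Lemma tbmD c phi psi : tbm c phi -> tbm c psi -> tbm c (fun t => phi t + psi t).
Proof.
move=> b1 b2; apply: eq_bmf (bmfD b1 b2) => t; by rewrite mulrDr.
Qed.

Lemma tbmZ c (a : R) phi : tbm c phi -> tbm c (fun t => a * phi t).
Proof. by move=> b1; apply: eq_bmf (bmfZ a b1) => t; rewrite mulrCA. Qed.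

Lemma tbm_pow c k : tbm c (fun t => t ^+ k).
Proof.
apply: (@tbm_bound _ (`|c| ^+ k)) => [|t tc].
  by apply: measurable_funX; exact: measurable_id.
rewrite normrX lerXn2r ?nnegrE//; exact: le_trans (ltW tc) (ler_norm _).
Qed.

Lemma tbm_abs c : tbm c (fun t => `|t|).
Proof.
apply: (@tbm_bound _ c) => [|t tc]; first exact: measurableT_comp.
by rewrite normr_id ltW.
Qed.

Lemma measurable_hgain L u : 0 <= L ->
  measurable_fun setT (hgain L u : measurableTypeR R -> R).
Proof.
move=> L0; apply: measurable_funB; last by apply: measurable_funM.
apply: measurable_funB => //.
apply: (@measurableT_comp _ _ _ (measurableTypeR R) (measurableTypeR R) _ (huber L)).
  exact: measurable_huber.
by apply: measurable_funD.
Qed.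

Lemma tbm_hgain c L u : 0 <= L -> tbm c (hgain L u).
Proof.
move=> L0; apply: (@tbm_bound _ (L * c)); first exact: measurable_hgain.
move=> t tc; rewrite ger0_norm ?hgain_ge0//.
by apply: le_trans (hgain_le_abs _ _ L0) _; rewrite ler_wpM2l// ltW.
Qed.

Definition trunc y phi : R := jint K y (fun t => \1_(below (s y)) t * phi t).

Lemma truncD y phi psi : tbm (s y) phi -> tbm (s y) psi ->
  trunc y (fun t => phi t + psi t) = trunc y phi + trunc y psi.
Proof.
move=> b1 b2; rewrite /trunc /jint -bmf_intD//.
by apply: eq_Rintegral => t _; rewrite mulrDr.
Qed.

Lemma truncZ y (a : R) phi : tbm (s y) phi ->
  trunc y (fun t => a * phi t) = a * trunc y phi.
Proof.
move=> b1; rewrite /trunc /jint -bmf_intZ//.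
by apply: eq_Rintegral => t _; rewrite mulrCA.
Qed.

Lemma le_trunc y phi psi : tbm (s y) phi -> tbm (s y) psi ->
  (forall t, `|t| < s y -> phi t <= psi t) -> trunc y phi <= trunc y psi.
Proof.
move=> b1 b2 H; apply: le_bmf_int => // t.
have [tc|tc] := boolP (`|t| < s y); first by rewrite below1// !mul1r H.
by rewrite below0// !mul0r.
Qed.

Lemma trunc_ge0 y phi : (forall t, `|t| < s y -> 0 <= phi t) -> 0 <= trunc y phi.
Proof.
move=> H; apply: bmf_int_ge0 => t.
have [tc|tc] := boolP (`|t| < s y); first by rewrite below1// !mul1r H.
by rewrite below0// !mul0r.
Qed.

Lemma trunc0 y phi : (forall t, `|t| < s y -> phi t = 0) -> trunc y phi = 0.
Proof.
move=> H; rewrite -[RHS](bmf_int_cst (jump_law K y) 0); apply: eq_Rintegral => t _.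
have [tc|tc] := boolP (`|t| < s y); first by rewrite below1// H// mulr0.
by rewrite below0// !mul0r.
Qed.

Variables (S : set R) (rho : R -> R).
Hypothesis large_jumps : forall y, S y -> 0 <= y ->
  (jump_law K y [set z | (s y <= `|z|)%R] <= (rho y)%:E)%E.

Lemma large_jumps_le y : S y -> 0 <= y -> jint K y \1_(~` below (s y)) <= rho y.
Proof.
move=> Sy y0; rewrite -lee_fin /jint bmf_int_indic; last first.
  by apply: measurableC; exact: measurable_below.
apply: le_trans (large_jumps Sy y0); rewrite le_eqVlt; apply/orP; left; apply/eqP.
congr (jump_law K y _); apply/seteqP; split => t /=.
  by rewrite /below/= => /negP; rewrite -leNgt.
by rewrite /below/= => H; apply/negP; rewrite -leNgt.
Qed.

Lemma above1 c t : `|t| < c -> \1_(~` below c) t = 0 :> R.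
Proof. by move=> tc; rewrite indicE memNset//= /below/= => /(_ tc). Qed.

Lemma above0 c t : ~~ (`|t| < c) -> \1_(~` below c) t = 1 :> R.
Proof. by move=> /negP tc; rewrite indicE mem_set. Qed.

Lemma bmf_above c : bmf (\1_(~` below c) : measurableTypeR R -> R).
Proof. by apply: bmf_indic; apply: measurableC; exact: measurable_below. Qed.

Lemma kopB y f : bmf f -> kop K f y - f y = jint K y (fun t => f (y + t) - f y).
Proof.
move=> bf; rewrite /kop /jint bmf_intB; [|exact: bmf_shift|exact: bmf_cst].
by rewrite bmf_int_cst.
Qed.

(** Since [f] is nonnegative, a large jump loses at most [f y <= c], wherever it lands. *)
Lemma kop_lower y f psi (c : R) : S y -> 0 <= y -> bmf f -> (forall x, 0 <= f x) ->
  f y <= c -> tbm (s y) psi ->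
  (forall t, `|t| < s y -> psi t <= f (y + t) - f y) ->
  trunc y psi - c * rho y <= kop K f y - f y.
Proof.
move=> Sy y0 bf f0 fc bpsi H; rewrite kopB//.
have c0 : 0 <= c by exact: le_trans (f0 y) fc.
have := ler_wpM2l c0 (large_jumps_le Sy y0).
suff : trunc y psi - c * jint K y \1_(~` below (s y)) <=
  jint K y (fun t => f (y + t) - f y) by lra.
have ba := bmf_above (s y).
rewrite /trunc /jint -(bmf_intZ _ c ba) -(bmf_intB _ bpsi (bmfZ c ba)).
apply: le_bmf_int; first exact: (bmfB bpsi (bmfZ c ba)).
  by apply: bmfB; [exact: bmf_shift|exact: bmf_cst].
move=> t; have [tc|tc] := boolP (`|t| < s y).
  by rewrite below1// above1// mulr0 subr0 mul1r H.
by rewrite below0// above0// mul0r; have := f0 (y + t); lra.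
Qed.

(** Since [f] takes values in [0, c], a large jump changes it by at most [c] in either direction. *)
Lemma kop_near y f psi chi (c : R) : S y -> 0 <= y -> bmf f ->
  (forall x, 0 <= f x <= c) -> tbm (s y) psi -> tbm (s y) chi ->
  (forall t, `|t| < s y -> `|f (y + t) - f y - psi t| <= chi t) ->
  `|kop K f y - f y - trunc y psi| <= trunc y chi + c * rho y.
Proof.
move=> Sy y0 bf f0 bpsi bchi H; rewrite kopB//.
have c0 : 0 <= c by have /andP[a1 a2] := f0 y; exact: le_trans a2.
have bs : bmf (fun t : measurableTypeR R => f (y + t) - f y).
  by apply: bmfB; [exact: bmf_shift|exact: bmf_cst].
have ba := bmf_above (s y).
have := ler_wpM2l c0 (large_jumps_le Sy y0).
suff : `|jint K y (fun t => f (y + t) - f y) - trunc y psi| <=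
  trunc y chi + c * jint K y \1_(~` below (s y)) by lra.
rewrite /trunc /jint -(bmf_intZ _ c ba) -(bmf_intD _ bchi (bmfZ c ba)).
rewrite -(bmf_intB _ bs bpsi).
apply: le_trans (le_normr_Rintegral _ _) _ => //.
  by apply: bmf_integrable => //; exact: bmfB.
have bl : bmf (fun t : measurableTypeR R =>
    f (y + t) - f y - \1_(below (s y)) t * psi t) by exact: (bmfB bs bpsi).
apply: le_bmf_int.
- have [ml [M lM]] := bl; split; first exact: measurableT_comp.
  by exists M => t; rewrite normr_id.
- exact: (bmfD bchi (bmfZ c ba)).
move=> t; have [tc|tc] := boolP (`|t| < s y).
  by rewrite below1// above1// mulr0 addr0 !mul1r H.
rewrite below0// above0// !mul0r subr0 add0r mulr1 ler_norml.
by have := f0 (y + t); have := f0 y; lra.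
Qed.

(** The two truncations differ only on |t| = s y, which is part of the large-jump event. *)
Lemma trunc_momentE y k : S y -> 0 <= y -> 0 <= s y ->
  `|truncated_moment K k (s y) y - trunc y (fun t => t ^+ k)| <= s y ^+ k * rho y.
Proof.
move=> Sy y0 s0; pose B : set (measurableTypeR R) := [set t : R | `|t| <= s y].
have mB : measurable B.
  rewrite -[B]setTI.
  apply: (@measurable_fun_le _ _ _ setT (fun t : measurableTypeR R => `|t|)
    (cst (s y))) => //; exact: measurableT_comp.
have bB : bmf (fun t : measurableTypeR R => \1_B t * t ^+ k).
  split.
    by apply: measurable_funM => //; exact: measurable_indic.
  exists (`|s y| ^+ k) => t; rewrite indicE; case: (boolP (t \in B)).
    rewrite inE => tB; rewrite mul1r normrX lerXn2r ?nnegrE//.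
    exact: le_trans tB (ler_norm _).
  by rewrite mul0r normr0 exprn_ge0.
rewrite /truncated_moment bmf_int_setI.
have bp := tbm_pow (s y) k; have ba := bmf_above (s y).
rewrite /trunc /jint -(bmf_intB _ bB bp).
have sk0 : 0 <= `|s y| ^+ k by exact: exprn_ge0.
apply: le_trans (le_normr_Rintegral _ _) _ => //.
  by apply: bmf_integrable => //; exact: bmfB.
apply: (@le_trans _ _ (s y ^+ k * jint K y \1_(~` below (s y)))); last first.
  by rewrite ler_wpM2l ?exprn_ge0//; exact: large_jumps_le.
rewrite /jint -(bmf_intZ _ _ ba); apply: le_bmf_int.
- have [ml [M lM]] := bmfB bB bp; split; first exact: measurableT_comp.
  by exists M => t; rewrite normr_id.
- exact: bmfZ.
move=> t; have [tc|tc] := boolP (`|t| < s y).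
  rewrite below1// above1// indicE mem_set; last by rewrite /B/= ltW.
  by rewrite !mul1r subrr normr0 mulr0.
rewrite below0// above0// mul0r subr0 mulr1 indicE; case: (boolP (t \in B)).
  rewrite inE => tB; rewrite mul1r normrX lerXn2r ?nnegrE//.
by rewrite mul0r normr0 exprn_ge0.
Qed.

End truncation.

(** * Staircase functions and stochastic domination *)

Section staircase.
Context {R : realType}.
Implicit Types (f : R -> R) (m i n : nat) (x : R).

(** The weights are such that the staircase takes the value f (k + 1) on ]k, k + 1] for m <= k < n.
    This lies between f x and f (x + 1), and the comparison of integrals reduces to that of the
    tails at integers. *)
Definition step f m i : R :=
  if i == m then f m.+1%:R else f i.+1%:R - f i%:R.

Definition stairs f m n x : R :=
  \sum_(i <- index_iota m n) step f m i * (i%:R < x)%R%:R.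

Lemma stairs_bounds f m n x : nondecreasing_on `[0, +oo[ f -> (m < n)%N -> m%:R < x ->
  [/\ x <= n%:R -> f x <= stairs f m n x,
      stairs f m n x <= f (x + 1) &
      n.-1%:R < x -> stairs f m n x = f n%:R].
Proof.
move=> nf; have nf' u w : 0 <= u -> u <= w -> f u <= f w.
  by move=> u0 uw; apply: nf => //=; rewrite in_itv/= andbT//; exact: le_trans uw.
elim: n => // n IH; rewrite ltnS leq_eqVlt => /orP[/eqP mn mx|mn mx].
  have x0 : 0 <= x by rewrite (le_trans _ (ltW mx)).
  rewrite /stairs mn /index_iota subSnn/= big_seq1 /step eqxx -mn mx mulr1.
  split => //; first by move=> xm; rewrite nf'.
  by apply: nf' => //; rewrite -natr1 lerD2r ltW.
have [H1 H2 H3] := IH mn mx.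
have x0 : 0 <= x by rewrite (le_trans _ (ltW mx)).
have nm : (n == m) = false by rewrite gtn_eqF.
rewrite /stairs big_nat_recr/=; last exact: ltnW.
rewrite -/(stairs f m n x) /step nm.
have n10 : n.-1%:R <= n%:R :> R by rewrite ler_nat leq_pred.
case: (ltP n%:R x) => nx; rewrite ?mulr1 ?mulr0 ?addr0.
  rewrite H3; last exact: le_lt_trans nx.
  rewrite addrC subrK; split => //; first by move=> xn; rewrite nf'.
  by rewrite nf'// -natr1 lerD2r ltW.
split => //; first by move=> _; exact: H1.
Qed.

Lemma stairs_eq0 f m n x : x <= m%:R -> stairs f m n x = 0.
Proof.
move=> xm; rewrite /stairs big_nat_cond; apply: big1 => i; rewrite andbT => /andP[mi _].
rewrite (_ : (i%:R < x) = false) ?mulr0//; apply/negbTE; rewrite -leNgt.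
by apply: le_trans xm _; rewrite ler_nat.
Qed.

Lemma step_ge0 f m i : nondecreasing_on `[0, +oo[ f -> 0 <= f 0 -> 0 <= step f m i.
Proof.
move=> nf f00; have nf' u w : 0 <= u -> u <= w -> f u <= f w.
  by move=> u0 uw; apply: nf => //=; rewrite in_itv/= andbT//; exact: le_trans uw.
rewrite /step; case: ifP => _; first by rewrite (le_trans f00)// nf'.
by rewrite subr_ge0 nf'// ler_nat.
Qed.

End staircase.

Definition over (R : realType) (m : nat) : set (measurableTypeR R) := [set t : R | m%:R < `|t|].

Section domination.
Context {R : realType}.
Variables (K : R.-pker (measurableTypeR R) ~> (measurableTypeR R)) (s : R -> R).
Variable S : set R.
Context {d' : measure_display} {T' : measurableType d'} (P' : probability T' R).
Variable xihat : {RV P' >-> R}.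
Hypothesis xihat_sq : ('E_P'[fun w => (xihat w ^+ 2)%R] < +oo)%E.
Hypothesis small_jumps : forall y, S y -> 0 <= y ->
     st_le (jump_law K y) (fun z : measurableTypeR R =>
                             `|z| * \1_[set z : R | `|z| < s y] z)
           P' xihat.

Lemma measurable_over m : measurable (over m : set (measurableTypeR R)).
Proof.
have -> : over m = ~` [set` `[- m%:R, m%:R : R]].
  apply/seteqP; split => t; rewrite /over/= in_itv/= -ler_norml.
    by move=> H; apply/negP; rewrite -ltNge.
  by move=> /negP; rewrite -ltNge.
by apply: measurableC; exact: measurable_itv.
Qed.

Lemma measurable_hat (f : R -> R) : measurable_fun [set: measurableTypeR R] f ->
  measurable_fun setT (fun w => f (xihat w)).
Proof.
move=> mf; apply: (@measurableT_comp _ _ _ _ (measurableTypeR R) (measurableTypeR R) f) => //.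
by move=> mD B mB; exact: (measurable_funPT xihat mD B mB).
Qed.

Definition hat_over (m : nat) : set T' := [set w | m%:R < xihat w].

Lemma measurable_hat_over m : measurable (hat_over m).
Proof.
rewrite (_ : hat_over m = setT `&` xihat @^-1` `]m%:R, +oo[).
  by apply: measurable_funPT => //; exact: measurable_itv.
by apply/seteqP; split => w; rewrite /hat_over/= in_itv/= andbT// => -[].
Qed.

Lemma trunc_over y m : S y -> 0 <= y ->
  trunc K s y \1_(over m) <= \int[P']_w \1_(hat_over m) w.
Proof.
move=> Sy y0; rewrite -lee_fin bmf_int_indic; last exact: measurable_hat_over.
apply: le_trans (small_jumps Sy y0 m%:R).
have -> : [set w | m%:R < `|w| * \1_[set z : R | `|z| < s y] w] =
    below (s y) `&` over m.
  apply/seteqP; split => t; rewrite /below /over/= indicE.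
    case: (boolP (t \in _)) => [|_]; last by rewrite mulr0 ltrn0.
    by rewrite inE/= mulr1.
  by move=> [ts tm]; rewrite mem_set// mulr1.
rewrite -bmf_int_indic; last by apply: measurableI; [exact: measurable_below|exact: measurable_over].
rewrite lee_fin le_eqVlt; apply/orP; left; apply/eqP.
by apply: eq_Rintegral => t _; rewrite indicI.
Qed.

Lemma hat_sq_integrable : P'.-integrable setT (fun w => ((xihat w + 1) ^+ 2)%:E).
Proof.
have i2 : P'.-integrable setT (fun w => (xihat w ^+ 2)%:E).
  apply/integrableP; split.
    by apply/measurable_EFinP; apply: (@measurable_hat (fun x => x ^+ 2)); exact: measurable_funX.
  move: xihat_sq; rewrite unlock; apply: le_lt_trans.
  rewrite le_eqVlt; apply/orP; left; apply/eqP.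
  by apply: eq_integral => w _ /=; rewrite ger0_norm// sqr_ge0.
have i1 : P'.-integrable setT (EFin \o (fun=> 2 : R)).
  by apply: bmf_integrable => //; exact: bmf_cst.
have := integrableD measurableT (integrableZl measurableT 2 i2) i1.
apply: le_integrable => //.
  apply/measurable_EFinP; apply: (@measurable_hat (fun x => (x + 1) ^+ 2)).
  by apply: measurable_funX; exact: measurable_funD.
move=> w _ /=; rewrite lee_fin !ger0_norm ?sqr_ge0//; last first.
  by have := sqr_ge0 (xihat w); lra.
by have := sqr_ge0 (xihat w - 1); lra.
Qed.

Lemma hat_integrable (f : R -> R) m : measurable_fun [set: measurableTypeR R] f ->
  (forall x, 0 <= x -> 0 <= f x) -> (forall x, 1 <= x -> f x <= x ^+ 2) ->
  P'.-integrable setT (EFin \o (fun w => \1_(hat_over m) w * f (xihat w + 1))).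
Proof.
move=> mf f0 fb; apply: le_integrable hat_sq_integrable => //.
  apply/measurable_EFinP; apply: measurable_funM.
    by apply: measurable_indic; exact: measurable_hat_over.
  apply: (@measurable_hat (fun x => f (x + 1))).
  apply: (@measurableT_comp _ _ _ (measurableTypeR R) (measurableTypeR R) _ f) => //.
  exact: measurable_funD.
move=> w _ /=; rewrite lee_fin (ger0_norm (sqr_ge0 _)) indicE.
case: (boolP (w \in _)) => [|_]; last by rewrite mul0r normr0 sqr_ge0.
rewrite inE /hat_over/= => mw; rewrite mul1r.
have h1 : 1 <= xihat w + 1 by rewrite lerDr (le_trans _ (ltW mw)).
by rewrite ger0_norm ?fb// f0// (le_trans _ h1).
Qed.

(** Domination gives the inequality for each tail indicator, hence for the staircase of [f], which
    has nonnegative steps. The staircase exceeds [f] on one side and stays below the shift of [f] by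
    1 on the other, whence [xihat + 1]. *)
Lemma trunc_dominated (f : R -> R) m y : S y -> 0 <= y ->
  measurable_fun [set: measurableTypeR R] f ->
  nondecreasing_on `[0, +oo[ f -> (forall x, 0 <= x -> 0 <= f x) ->
  (forall x, 1 <= x -> f x <= x ^+ 2) ->
  trunc K s y (fun t => \1_(over m) t * f `|t|) <=
  \int[P']_w (\1_(hat_over m) w * f (xihat w + 1)).
Proof.
move=> Sy y0 mf nf f0 fb.
have f00 : 0 <= f 0 by exact: f0.
(* The truncated jump stays below [s y], so finitely many steps suffice. *)
have [n [mn sn]] : exists n : nat, (m < n)%N /\ s y <= n%:R.
  exists (maxn m.+1 (Num.bound `|s y|)); split; first by rewrite leq_maxl.
  apply: le_trans (ler_norm _) _; apply: le_trans (ltW (archi_boundP _)) _ => //.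
  by rewrite ler_nat leq_maxr.
have bo i : bmf (\1_(over i) : measurableTypeR R -> R).
  by apply: bmf_indic; exact: measurable_over.
have bh i : bmf (\1_(hat_over i) : T' -> R).
  by apply: bmf_indic; exact: measurable_hat_over.
pose g := fun t : measurableTypeR R =>
  \sum_(i <- index_iota m n) step f m i * \1_(over i) t.
have gE t : g t = stairs f m n `|t|.
  apply: eq_bigr => i _; rewrite indicE; congr (_ * (nat_of_bool _)%:R).
  by apply/idP/idP; rewrite inE.
pose g' := fun w : T' => \sum_(i <- index_iota m n) step f m i * \1_(hat_over i) w.
have g'E w : g' w = stairs f m n (xihat w).
  apply: eq_bigr => i _; rewrite indicE; congr (_ * (nat_of_bool _)%:R).
  by apply/idP/idP; rewrite inE.
have bg : bmf g by apply: bmf_sum => i _; exact: bmfZ.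
have bg' : bmf g' by apply: bmf_sum => i _; exact: bmfZ.
apply: (@le_trans _ _ (trunc K s y g)).
  apply: le_trunc; last 1 first.
  - move=> t ts; rewrite gE indicE; case: (boolP (t \in _)).
      rewrite inE /over/= mul1r => mt.
      have [H _ _] := stairs_bounds nf mn mt; apply: H.
      exact: le_trans (ltW ts) sn.
    rewrite mul0r => /negP; rewrite inE /over/= => /negP; rewrite -leNgt => tm.
    by rewrite stairs_eq0.
  - apply: (@tbm_bound _ _ (f (s y))) => [|t ts].
      apply: measurable_funM; first by case: (bo m).
      exact: (measurableT_comp mf (@normr_measurable R setT)).
    have h1 := f0 _ (normr_ge0 t).
    apply: (@le_trans _ _ (f `|t|)).
      by rewrite normrM (ger0_norm h1) ler_piMl// indicE; case: (t \in _); rewrite ?normr1 ?normr0.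
    apply: nf; rewrite /= ?in_itv/= ?andbT ?normr_ge0 ?(ltW ts)//.
    exact: le_trans (normr_ge0 t) (ltW ts).
  - exact: tbm_bmf.
have -> : trunc K s y g = \sum_(i <- index_iota m n) step f m i * trunc K s y \1_(over i).
  rewrite /trunc /jint.
  transitivity (\sum_(i <- index_iota m n) \int[jump_law K y]_t
    (step f m i * (\1_(below (s y)) t * \1_(over i) t))); last first.
    by apply: eq_bigr => i _; rewrite bmf_intZ//; exact: tbm_bmf.
  rewrite -bmf_int_sum; last by move=> i _; apply: bmfZ; exact: tbm_bmf.
  apply: eq_Rintegral => t _; rewrite /g mulr_sumr; apply: eq_bigr => i _.
  by rewrite mulrCA.
apply: (@le_trans _ _ (\int[P']_w g' w)).
  rewrite /g' bmf_int_sum; last by move=> i _; exact: bmfZ.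
  apply: ler_sum => i _; rewrite bmf_intZ// ler_wpM2l ?step_ge0//.
  exact: trunc_over.
apply: le_Rintegral => //; [exact: bmf_integrable|exact: hat_integrable|].
move=> w _; rewrite g'E indicE; case: (boolP (w \in _)).
  rewrite inE /hat_over/= mul1r => mw.
  by have [_ + _] := stairs_bounds nf mn mw.
rewrite mul0r => /negP; rewrite inE /hat_over/= => /negP; rewrite -leNgt => tm.
by rewrite stairs_eq0.
Qed.

Definition tail1 m : R := \int[P']_w (\1_(hat_over m) w * (xihat w + 1)).
Definition tail2 m : R := \int[P']_w (\1_(hat_over m) w * (xihat w + 1) ^+ 2).

Let sqr_nd : nondecreasing_on `[0, +oo[ (fun x : R => x ^+ 2).
Proof.
move=> x y; rewrite /= !in_itv/= !andbT => x0 y0 xy.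
by rewrite lerXn2r ?nnegrE.
Qed.

Lemma trunc_tail1 m y : S y -> 0 <= y ->
  trunc K s y (fun t => \1_(over m) t * `|t|) <= tail1 m.
Proof.
move=> Sy y0; apply: (@trunc_dominated id) => // x x1.
by rewrite expr2 ler_peMl// (le_trans _ x1).
Qed.

Lemma trunc_tail2 m y : S y -> 0 <= y ->
  trunc K s y (fun t => \1_(over m) t * `|t| ^+ 2) <= tail2 m.
Proof.
move=> Sy y0; apply: (@trunc_dominated (fun x => x ^+ 2)) => //.
by move=> x _; exact: sqr_ge0.
Qed.

Let integrable2 m :
  P'.-integrable setT (EFin \o (fun w => \1_(hat_over m) w * (xihat w + 1) ^+ 2)).
Proof.
apply: (@hat_integrable (fun x => x ^+ 2)) => //.
by move=> x _; exact: sqr_ge0.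
Qed.

Let integrable1 m :
  P'.-integrable setT (EFin \o (fun w => \1_(hat_over m) w * (xihat w + 1))).
Proof.
apply: (@hat_integrable id) => // x x1.
by rewrite expr2 ler_peMl// (le_trans _ x1).
Qed.

Lemma tail1_ge0 m : 0 <= tail1 m.
Proof.
apply: Rintegral_ge0 => w _; rewrite indicE; case: (boolP (w \in _)).
  by rewrite inE /hat_over/= mul1r => mw; rewrite addr_ge0// (le_trans _ (ltW mw)).
by rewrite mul0r.
Qed.

(** The number of integers j in [m, n[ below [xihat] is at most [xihat + 1], so summing first-moment
    tails over j costs one more power. This is where the second moment of the majorant pays for the
    cells outside the window. *)
Lemma sum_tail1 m n : (m <= n)%N -> \sum_(m <= j < n) tail1 j <= tail2 m.
Proof.
move=> mn; have H : forall k, (m <= k)%N ->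
    P'.-integrable setT (EFin \o (fun w =>
      \sum_(m <= j < k) \1_(hat_over j) w * (xihat w + 1))) /\
    \sum_(m <= j < k) tail1 j =
    \int[P']_w (\sum_(m <= j < k) \1_(hat_over j) w * (xihat w + 1)).
  elim=> [|k IH].
    rewrite leqn0 => /eqP ->; rewrite big_geq//; split.
      rewrite (_ : _ \o _ = EFin \o (fun=> 0)).
        by apply: bmf_integrable => //; exact: bmf_cst.
      by apply/funext => w /=; rewrite big_geq.
    rewrite -[LHS](bmf_int_cst P' 0); apply: eq_Rintegral => w _.
    by rewrite big_geq.
  rewrite leq_eqVlt => /orP[/eqP mk|].
    rewrite mk big_geq//; split.
      rewrite (_ : _ \o _ = EFin \o (fun=> 0)).
        by apply: bmf_integrable => //; exact: bmf_cst.
      by apply/funext => w /=; rewrite big_geq.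
    rewrite -[LHS](bmf_int_cst P' 0); apply: eq_Rintegral => w _.
    by rewrite big_geq.
  rewrite ltnS => mk; have [i1 e1] := IH mk; split.
    have := integrableD measurableT i1 (integrable1 k).
    congr (_.-integrable _ _); apply/funext => w /=.
    by rewrite big_nat_recr.
  rewrite big_nat_recr//= e1 -RintegralD//; apply: eq_Rintegral => w _.
  by rewrite big_nat_recr.
have [i1 ->] := H n mn; apply: le_Rintegral => // w _.
rewrite -mulr_suml; have [mx|xm] := ltP m%:R (xihat w); last first.
  rewrite big_nat_cond big1 ?mul0r; last first.
    move=> j; rewrite andbT => /andP[mj _]; rewrite indicE memNset//.
    rewrite /hat_over/= => jx; have := lt_le_trans jx xm.
    by rewrite ltr_nat ltnNge mj.
  by apply: mulr_ge0; [rewrite indicE|exact: sqr_ge0].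
have -> : \1_(hat_over m) w = 1 :> R by rewrite indicE mem_set.
rewrite mul1r expr2 ler_wpM2r ?addr_ge0 ?(le_trans _ (ltW mx))//.
have x0 : 0 <= xihat w by exact: le_trans (ltW mx).
have [mn'|nm] := ltnP m n; last by rewrite big_geq// addr_ge0.
(* For the identity every step is at least 1, so the staircase counts the indices below [xihat w],
   and it is at most [xihat w + 1]. *)
have [_ + _] := @stairs_bounds _ id _ _ _ (fun _ _ _ _ => id) mn' mx.
apply: le_trans; apply: ler_sum => j _; rewrite indicE.
case: (boolP (w \in _)) => [|_]; last first.
  by rewrite mulr_ge0// step_ge0.
rewrite inE /hat_over/= => ->; rewrite mulr1 /step; case: ifP => _.
  by rewrite /= ler1n.
by rewrite /= -[j.+1]addn1 natrD; lra.
Qed.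

Lemma tail2_cvg0 (e : R) : 0 < e -> exists m0, forall m, (m0 <= m)%N -> tail2 m <= e.
Proof.
move=> e0.
pose f_ m w := (\1_(hat_over m) w * (xihat w + 1) ^+ 2)%:E.
have mf m : measurable_fun setT (f_ m) by case/integrableP : (integrable2 m).
have f0 : {ae P', forall w, setT w -> f_ m w @[m --> \oo] --> 0%E}.
  apply: aeW => w _; apply: cvg_near_cst.
  exists (Num.bound `|xihat w|) => // m /= wm.
  rewrite /f_ indicE memNset ?mul0r// /hat_over/= => H.
  have := lt_le_trans H (ler_norm _).
  rewrite ltNge => /negP; apply; apply: le_trans (ltW (archi_boundP _)) _ => //.
  by rewrite ler_nat.
have fg : {ae P', forall w m, setT w -> (`|f_ m w| <= ((xihat w + 1) ^+ 2)%:E)%E}.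
  apply: aeW => w m _; rewrite lee_fin normrM (ger0_norm (sqr_ge0 _)).
  by rewrite ler_piMl ?sqr_ge0// indicE; case: (w \in _); rewrite ?normr1 ?normr0.
have [_ _] := dominated_convergence measurableT mf (measurable_cst _) f0
  hat_sq_integrable fg.
rewrite integral0 => /fine_cvgP[_] /cvgrPdist_le /(_ _ e0)[m0 _ H].
exists m0 => m m0m; have := H m m0m; rewrite /= sub0r normrN.
exact: le_trans (ler_norm _).
Qed.

End domination.

(** * Monotone functions cut off to a half-line *)

Section monotone.
Context {R : realType}.
Implicit Types (f : R -> R) (x y : R).

Definition from x : set (measurableTypeR R) := [set t : R | x <= t].

Lemma measurable_from x : measurable (from x).
Proof.
rewrite (_ : from x = [set` `[x, +oo[]); first exact: measurable_itv.
by apply/seteqP; split => t; rewrite /from/= in_itv/= andbT.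
Qed.

Lemma from1 x y : x <= y -> \1_(from x) y = 1 :> R.
Proof. by move=> xy; rewrite indicE mem_set. Qed.

Lemma from0 x y : y < x -> \1_(from x) y = 0 :> R.
Proof. by rewrite ltNge => /negP yx; rewrite indicE memNset. Qed.

Lemma bmf_from f x : nonincreasing_on `[0, +oo[ f -> 0 <= x ->
  (forall y, 0 <= y -> 0 <= f y) ->
  bmf (fun y : measurableTypeR R => \1_(from x) y * f y).
Proof.
move=> nf x0 f0.
have nf' u w : 0 <= u -> u <= w -> f w <= f u.
  by move=> u0 uw; apply: nf => //=; rewrite in_itv/= andbT//; exact: le_trans uw.
(* [f] is monotone only on [0, +oo[; composed with the maximum of x and y it is monotone, hence
   measurable, on the whole line. *)
have : bmf (fun y : measurableTypeR R => \1_(from x) y * f (Num.max x y)).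
  split; last first.
    exists (f x) => y; rewrite normrM ger0_norm// ger0_norm; last first.
      by apply: f0; rewrite le_max x0.
    case: (leP x y) => xy; first by rewrite from1// mul1r nf'.
    by rewrite from0// mul0r f0.
  apply: measurable_funM; first by apply: measurable_indic; exact: measurable_from.
  apply: nonincreasing_measurable => // u w uw; apply: nf'.
    by rewrite le_max x0.
  by rewrite ge_max le_max lexx/= le_max uw orbT.
apply: eq_bmf => y; case: (leP x y) => xy; first by rewrite !from1.
by rewrite !from0// !mul0r.
Qed.

End monotone.

(* The hypotheses of the theorem in epsilon form, with the moments truncated at
   |t| < s y, and with tl j a summable bound for the tails E[|xi|; j < |xi| < s]. *)
Record regime {R : realType} (K : R.-pker (measurableTypeR R) ~> (measurableTypeR R))
    (S : set R) (v s p : R -> R) (b : R) (tl : nat -> R) : Prop := Regime {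
  reg_b_gt0 : 0 < b ;
  reg_v_gt0 : forall x : R, 0 <= x -> 0 < v x ;
  reg_v_decr : nonincreasing_on `[0, +oo[ v ;
  reg_p_decr : nonincreasing_on `[0, +oo[ p ;
  reg_p_ge0 : forall x : R, 0 <= x -> 0 <= p x ;
  reg_s_gt0 : forall x : R, 0 <= x -> 0 < s x ;
  reg_s_incr : nondecreasing_on `[0, +oo[ s ;
  reg_large : forall y, S y -> 0 <= y ->
    (jump_law K y [set z | (s y <= `|z|)%R] <= (p y * v y)%:E)%E ;
  reg_moment1 : forall e, 0 < e -> exists x0, forall y, S y -> x0 <= y ->
    `|trunc K s y (fun t => t ^+ 1) - v y| <= e * v y ;
  reg_moment2 : forall e, 0 < e -> exists x0, forall y, S y -> x0 <= y ->
    `|trunc K s y (fun t => t ^+ 2) - b| <= e ;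
  reg_unif_int : forall e, 0 < e -> exists m : nat, forall y, S y -> 0 <= y ->
    trunc K s y (fun t => \1_(over m) t * `|t| ^+ 2) <= e ;
  reg_tl_ge0 : forall m, 0 <= tl m ;
  reg_trunc_tl : forall m y, S y -> 0 <= y ->
    trunc K s y (fun t => \1_(over m) t * `|t|) <= tl m ;
  reg_tl_sum : forall e, 0 < e -> exists m0 : nat, forall m n : nat, (m0 <= m)%N ->
    \sum_(m <= j < n) tl j <= e ;
  reg_inv_v : forall e, 0 < e -> exists x0, forall x y, x0 <= x -> x <= y ->
    (v y)^-1 <= (v x)^-1 + e * (y - x) ;
  reg_v_small : forall e, 0 < e -> exists x0, forall y, x0 <= y -> v y <= e ;
  reg_sv_small : forall e, 0 < e -> exists x0, forall y, x0 <= y -> s y * v y <= e ;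
  reg_yv_large : forall A, exists x0, forall y, x0 <= y -> A <= y * v y ;
  reg_p_sum : forall e, 0 < e -> exists k0 : nat, forall n,
    \sum_(k0 <= k < n) 2 ^+ k * p (2 ^+ k) <= e }.

(** * Lyapunov bounds for the Green function *)

Section lyapunov.
Context {R : realType} {d : measure_display} {T : measurableType d}.
Variable K : R.-pker (measurableTypeR R) ~> (measurableTypeR R).
Variables (S : set R) (P : probability T R) (X : nat -> {RV P >-> R}).
Variables (v s p : R -> R) (b : R) (tl : nat -> R).
Hypothesis reg : regime K S v s p b tl.

Let b_gt0 := reg_b_gt0 reg.
Let v_gt0 := reg_v_gt0 reg.
Let v_decr := reg_v_decr reg.
Let p_decr := reg_p_decr reg.
Let p_ge0 := reg_p_ge0 reg.
Let s_gt0 := reg_s_gt0 reg.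
Let large_jumps := reg_large reg.
Let xv_infty := reg_yv_large reg.
Let p_sum := reg_p_sum reg.
Let rho y := p y * v y.

Definition good x0 := 0 <= x0 /\ forall y, S y -> x0 <= y ->
  [/\ 3 / 4 * v y <= trunc K s y (fun t => t ^+ 1),
      trunc K s y (fun t => t ^+ 2) <= 2 * b & s y * v y <= 4 * b].

Definition test a L z : measurableTypeR R -> R := fun y => hyper a (huber L (y - z)).

Lemma test_bounds a L z y : 0 < a -> 0 <= L -> 0 <= test a L z y <= a.
Proof. by move=> a0 L0; apply: hyper_bounds => //; exact: huber_ge0. Qed.

Lemma bmf_test a L z : 0 < a -> 0 <= L -> bmf (test a L z).
Proof.
move=> a0 L0; split; last first.
  exists a => y; have /andP[h1 h2] := test_bounds z y a0 L0.
  by rewrite ger0_norm.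
apply: nondecreasing_measurable => // u w uw; apply: hyper_nd => //.
  exact: huber_ge0.
by apply: huber_nd => //; lra.
Qed.

(** The condition 32 L b <= v y (a + huber) has two uses. With a second moment at most 2 b, the
    curvature loss 4 k^2 M2 / (a + huber) is at most k v y / 4, a third of the available drift. With
    s y v y <= 4 b, increments of the Huber function stay below an eighth of a + huber, as
    [hyper_increment] requires. *)
Lemma test_lower a L z y x0 : good x0 -> x0 <= z -> 0 < L -> 0 < a ->
  S y -> z <= y -> 32 * L * b <= v y * (a + huber L (y - z)) ->
  (a / (a + huber L (y - z))) ^+ 2 *
    (hslope L (y - z) * v y / 4 + trunc K s y (hgain L (y - z)) / 2) -
    test a L z y * rho y <= kop K (test a L z) y - test a L z y.
Proof.
move=> [x00 gx] xz L0 a0 Sy zy C.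
have y0 : 0 <= y by lra.
have [m1 m2 sv] := gx y Sy (le_trans xz zy).
have vy := v_gt0 y0; have sy := s_gt0 y0; have L0' := ltW L0.
set u := huber L (y - z) in C *; have u0 : 0 <= u by exact: huber_ge0.
set k := hslope L (y - z); have /andP[k0 kL] := hslope_bounds (y - z) L0'.
rewrite -/k in k0 kL.
have au : 0 < a + u by lra.
pose psi t := (a / (a + u)) ^+ 2 *
  (k * t ^+ 1 + (2^-1 * hgain L (y - z) t + (- (4 * k ^+ 2 / (a + u))) * t ^+ 2)).
have b1 := tbm_pow (s y) 1; have b2 := tbm_pow (s y) 2.
have bg := tbm_hgain (s y) (y - z) L0'.
have b1' := tbmZ k b1; have bg' := tbmZ 2^-1 bg.
have b2' := tbmZ (- (4 * k ^+ 2 / (a + u))) b2.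
have bi := tbmD b1' (tbmD bg' b2'); have bpsi : tbm (s y) psi by exact: tbmZ bi.
have sL : 8 * (L * s y) <= a + u.
  rewrite -(ler_pM2l vy); apply: le_trans C.
  have := ler_wpM2l L0' sv; lra.
have incr t : `|t| < s y -> psi t <= test a L z (y + t) - test a L z y.
  move=> ts; have ts' := ltW ts.
  have Lt : L * `|t| <= L * s y by rewrite ler_wpM2l.
  have ytz : y + t - z = y - z + t by lra.
  rewrite /test ytz (hgain_split _ (erefl (hslope L (y - z)))) -/u -/k.
  have gD : hgain L (y - z) t <= L * s y.
    exact: le_trans (hgain_le_abs _ _ L0') Lt.
  have kD : `|k * t + hgain L (y - z) t| <= L * s y.
    have := huber_dist (y - z) t L0'.
    rewrite (hgain_split _ (erefl (hslope L (y - z)))) -/u -/k addrAC subrr add0r.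
    by move=> /le_trans; exact.
  have := hyper_increment a0 u0 (hgain_ge0 (y - z) t L0') gD kD sL.
  apply: le_trans; rewrite /psi expr1 ler_wpM2l ?sqr_ge0//.
  by lra.
have := kop_lower large_jumps Sy y0 (bmf_test z a0 L0')
  (fun x => proj1 (andP (test_bounds z x a0 L0'))) (lexx _) bpsi incr.
apply: le_trans; rewrite lerB//.
rewrite /psi (truncZ K _ bi) ler_wpM2l ?sqr_ge0//.
rewrite (truncD K b1' (tbmD bg' b2')) (truncD K bg' b2') !truncZ//.
have h1 : k * (3 / 4 * v y) <= k * trunc K s y (fun t => t ^+ 1) by rewrite ler_wpM2l.
have h2 : 4 * k ^+ 2 / (a + u) * trunc K s y (fun t => t ^+ 2) <= k * v y / 4.
  apply: (@le_trans _ _ (4 * k ^+ 2 / (a + u) * (2 * b))).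
    rewrite ler_wpM2l// divr_ge0 ?(ltW au)// mulr_ge0 ?sqr_ge0//.
  rewrite mulrAC ler_pdivrMr//.
  have kk : k ^+ 2 <= k * L by rewrite expr2 ler_wpM2l.
  have := ler_wpM2l k0 C; have := ler_wpM2r (ltW b_gt0) kk; lra.
have h3 : 0 <= k * v y by rewrite mulr_ge0// ltW.
lra.
Qed.

Lemma kop_test_ge0 a L z y : 0 < a -> 0 <= L -> 0 <= kop K (test a L z) y.
Proof.
by move=> a0 L0; apply: bmf_int_ge0 => t; have /andP[] := test_bounds z (y + t) a0 L0.
Qed.

Lemma test0 a L z y : y <= z -> test a L z y = 0.
Proof. by move=> yz; rewrite /test huber0 ?subr_le0// /hyper mulr0 mul0r. Qed.

Lemma bmf_hslope L z : 0 <= L -> bmf (fun y : measurableTypeR R => hslope L (y - z)).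
Proof.
move=> L0; split; last first.
  exists L => y; have /andP[h1 h2] := hslope_bounds (y - z) L0.
  by rewrite ger0_norm.
apply: nondecreasing_measurable => // u w uw; rewrite /hslope.
case: (leP (u - z) 0) => ?; case: (leP (w - z) 0) => ?; case: (leP (u - z) L) => ?;
  case: (leP (w - z) L) => ?; lra.
Qed.

(** Bounds the cost of large jumps by the same weight [hslope] that multiplies the drift, so that
    the argument of [big_jumps_small] closes on a single weighted sum. *)
Lemma test_le_hslope a z y : 1 <= a -> z <= y ->
  test a 1 z y <= a * hslope 1 (y - z).
Proof.
move=> a1 zy; have a0 : 0 < a by lra.
have [y1|y1] := leP 1 (y - z).
  rewrite hslope_right// mulr1.
  by have /andP[] := test_bounds z y a0 ler01.
have u01 : 0 <= y - z <= 1 by rewrite subr_ge0 zy ltW.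
rewrite hslope_mid// /test huber_mid// /hyper.
move/andP: u01; move: (y - z) => u [u0 u1].
have u2 : 0 <= u ^+ 2 / 2 by rewrite divr_ge0// sqr_ge0.
have q : u ^+ 2 / 2 <= u by nra.
have au : 0 <= a * u by rewrite mulr_ge0// ltW.
rewrite ler_pdivrMr; last by lra.
apply: (@le_trans _ _ (a * u * 1)); first by rewrite mulr1 ler_wpM2l// ltW.
by rewrite ler_wpM2l//; lra.
Qed.

Hypothesis chainX : markov_chain S K X.

Lemma green_lyapunov f g e (a : R) n : bmf f -> bmf g -> bmf e ->
  (forall y, 0 <= f y <= a) ->
  (forall y, S y -> g y - e y <= kop K f y - f y) ->
  green X n g <= a + green X n e.
Proof.
move=> bf bg be fa H.
have bge : bmf (fun y => g y - e y) by exact: bmfB.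
have bkf : bmf (fun y => kop K f y - f y) by apply: bmfB => //; exact: bmf_kop.
have := le_green chainX n bge bkf H.
rewrite (greenB X n bg be) (green_kop chainX n bf).
have : expect X n f <= a.
  rewrite -(expect_cst X n a); apply: (le_expect chainX) => // [|y _].
    exact: bmf_cst.
  by case/andP: (fa y).
have : 0 <= expect X 0 f by apply: expect_ge0 => y; case/andP: (fa y).
lra.
Qed.

Let rho_decr : nonincreasing_on `[0, +oo[ rho.
Proof.
move=> x y /=; rewrite !in_itv/= !andbT => x0 y0 xy.
apply: ler_pM; [exact: p_ge0|exact: ltW (v_gt0 y0)|..].
  by apply: p_decr => //=; rewrite in_itv/= andbT.
by apply: v_decr => //=; rewrite in_itv/= andbT.
Qed.

Let rho_ge0 y : 0 <= y -> 0 <= rho y.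
Proof. by move=> y0; rewrite mulr_ge0 ?p_ge0// ltW// v_gt0. Qed.

(** For x >= 0 this bounds the expected number, before time n, of jumps of length at least [s] made
    from states at or above x. *)
Definition big_jumps x n := green X n (fun y => \1_(from x) y * rho y).

Lemma bmf_rho x : 0 <= x -> bmf (fun y : measurableTypeR R => \1_(from x) y * rho y).
Proof. by move=> x0; exact: bmf_from. Qed.

Lemma bmf_v x : 0 <= x -> bmf (fun y : measurableTypeR R => \1_(from x) y * v y).
Proof. by move=> x0; apply: bmf_from => // y y0; exact: ltW (v_gt0 y0). Qed.

Lemma from_rho_ge0 x y : 0 <= x -> 0 <= \1_(from x) y * rho y.
Proof.
move=> x0; case: (leP x y) => xy; last by rewrite from0// mul0r.
by rewrite from1// mul1r rho_ge0//; exact: le_trans xy.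
Qed.

Lemma le_big_jumps x y n : 0 <= x -> x <= y -> big_jumps y n <= big_jumps x n.
Proof.
move=> x0 xy; apply: (le_green chainX); [|exact: bmf_rho|].
  by apply: bmf_rho; exact: le_trans xy.
move=> w _; case: (leP y w) => yw; last by rewrite from0// mul0r from_rho_ge0.
by rewrite !from1//; exact: le_trans yw.
Qed.

(** Below z the test function vanishes, so its generator there is its one-step expectation. Thus [g]
    may charge upward jumps across z as well as sites above z. *)
Lemma green_test a L z x0 g n : good x0 -> x0 <= z -> 0 < L -> 0 < a ->
  (forall y, z <= y -> 32 * L * b <= v y * (a + huber L (y - z))) ->
  bmf g ->
  (forall y, S y -> z <= y -> g y <= (a / (a + huber L (y - z))) ^+ 2 *
    (hslope L (y - z) * v y / 4 + trunc K s y (hgain L (y - z)) / 2)) ->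
  (forall y, S y -> y < z -> g y <= kop K (test a L z) y) ->
  green X n g <= a * (1 + big_jumps z n).
Proof.
move=> gx xz L0 a0 C bg gz g0; have z0 : 0 <= z by case: gx => x00 _; lra.
have L0' := ltW L0; have br := bmf_rho z0.
rewrite mulrDr mulr1 /big_jumps -(greenZ X n a br).
apply: (@green_lyapunov (test a L z)) => //; [exact: bmf_test|exact: bmfZ| |].
  by move=> y; exact: test_bounds.
move=> y Sy; have [zy|yz] := leP z y; last first.
  by rewrite from0// mul0r mulr0 subr0 (test0 _ _ (ltW yz)) subr0 g0.
rewrite from1// mul1r.
have := test_lower gx xz L0 a0 Sy zy (C y zy); have := gz y Sy zy.
have /andP[t0 ta] := test_bounds z y a0 L0'.
have y0 : 0 <= y by lra.
have := ler_wpM2r (rho_ge0 y0) ta; lra.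
Qed.

Lemma good_le x0 x1 : good x0 -> x0 <= x1 -> good x1.
Proof.
move=> [x00 H] x01; split; first exact: le_trans x01.
by move=> y Sy x1y; apply: H => //; exact: le_trans x1y.
Qed.

Lemma good_ex : exists x0, good x0.
Proof.
have e4 : 0 < 4^-1 :> R by rewrite invr_gt0.
have [x1 H1] := reg_moment1 reg e4; have [x2 H2] := reg_moment2 reg b_gt0.
have b4 : 0 < 4 * b by rewrite mulr_gt0.
have [x3 H3] := reg_sv_small reg b4.
exists (`|x1| + `|x2| + `|x3|); split; first by rewrite !addr_ge0.
move=> y Sy xy; have := ler_norm x1; have := ler_norm x2; have := ler_norm x3.
have := normr_ge0 x1; have := normr_ge0 x2; have := normr_ge0 x3 => *.
have h3 : s y * v y <= 4 * b by apply: H3; lra.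
have : `|trunc K s y (fun t => t ^+ 2) - b| <= b by apply: H2 => //; lra.
have : `|trunc K s y (fun t => t ^+ 1) - v y| <= 4^-1 * v y by apply: H1 => //; lra.
rewrite !ler_norml => /andP[h11 h12] /andP[h21 h22].
by split; lra.
Qed.

Ltac clear_context := clear - reg chainX b_gt0 v_gt0 v_decr p_decr
  p_ge0 s_gt0 large_jumps xv_infty p_sum rho.

(** Let J be the Green function of [w], the large-jump rate above z damped by the Huber slope. On
    the block [2^k, 2^(k+1)[ the test function of height 2^k bounds the Green function of slope
    times v by 36 2^k (1 + J). Weighting by p(2^k) and summing gives J <= 36 eps (1 + J) plus a
    remainder, where eps bounds the tail of the sum of 2^k p(2^k); as J is finite for each n, it can
    be absorbed. *)
Lemma big_jumps_small e : 0 < e -> exists x0, 0 <= x0 /\ forall n, big_jumps x0 n <= e.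
Proof.
move=> e0; have [g0 gg] := good_ex; have [y0 yv] := xv_infty (64 * b).
(* [36 * eps <= 1 / 2] absorbs J; [36 * eps <= e / 4] and a remainder of at most e / 4 then leave J
   <= e. *)
have [eps eps0 [eps1 eps2]] : exists2 eps, 0 < eps & 36 * eps <= e / 4 /\ 36 * eps <= 1 / 2.
  exists (Num.min (e / 144) (72^-1)); first by rewrite lt_min invr_gt0 divr_gt0 ?ltr0n.
  split.
    have : Num.min (e / 144) (72^-1) <= e / 144 by rewrite ge_min lexx.
    by lra.
  have : Num.min (e / 144) (72^-1) <= 72^-1 by rewrite ge_min lexx orbT.
  by lra.
have [k0 Hk0] := p_sum eps0.
have pow_ge (k : nat) : k%:R <= 2 ^+ k :> R by rewrite -natrX ler_nat ltnW// ltn_expl.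
have pow_gt0 (k : nat) : 0 < 2 ^+ k :> R by exact: exprn_gt0.
have powS (k : nat) : 2 ^+ k.+1 = 2 * 2 ^+ k :> R by rewrite exprS.
have pow1 (k : nat) : 1 <= 2 ^+ k :> R by apply: exprn_ege1; rewrite ler1n.
have pow_le (j k : nat) : (j <= k)%N -> 2 ^+ j <= 2 ^+ k :> R.
  by move=> jk; rewrite ler_weXn2l// ler1n.
have pk0 (k : nat) : 0 <= 2 ^+ k * p (2 ^+ k).
  by rewrite mulr_ge0 ?p_ge0 ?(ltW (pow_gt0 _)).
pose M := maxn k0 (Num.bound (`|y0| + `|g0|)).
have zge : `|y0| + `|g0| <= 2 ^+ M.
  apply: le_trans (pow_ge M); apply: le_trans (ltW (archi_boundP _)) _ => //.
  by rewrite ler_nat leq_maxr.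
pose z : R := 2 ^+ M.
have z1 : 1 <= z by exact: pow1.
have y0z : y0 <= z by have := ler_norm y0; have := normr_ge0 g0; rewrite /z; lra.
have g0z : g0 <= z by have := ler_norm g0; have := normr_ge0 y0; rewrite /z; lra.
have sumM n : (M <= n)%N -> \sum_(M <= k < n) 2 ^+ k * p (2 ^+ k) <= eps.
  move=> Mn; apply: le_trans (Hk0 n).
  by rewrite [leRHS](@big_cat_nat _ _ _ M)//= ?leq_maxl// lerDr sumr_ge0.
pose kk (y : measurableTypeR R) := hslope 1 (y - z).
have kk01 y : 0 <= kk y <= 1 by exact: hslope_bounds.
have bkk : bmf kk by exact: bmf_hslope.
have z0 : 0 <= z by exact: le_trans ler01 z1.
move=> {zge}.
pose w (y : measurableTypeR R) := kk y * (\1_(from z) y * rho y).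
have bw : bmf w by apply: bmfM => //; exact: bmf_rho.
have w0 y : 0 <= w y.
  by have /andP[h1 _] := kk01 y; rewrite mulr_ge0// from_rho_ge0.
pose blk (k : nat) (y : measurableTypeR R) : R :=
  \1_(from (2 ^+ k)) y - \1_(from (2 ^+ k.+1)) y.
have bblk k : bmf (blk k).
  by apply: bmfB; apply: bmf_indic; exact: measurable_from.
have blkE k y : blk k y = if (2 ^+ k <= y) && (y < 2 ^+ k.+1) then 1 else 0.
  rewrite /blk; case: (leP (2 ^+ k) y) => h1; last first.
    by rewrite !from0 ?subrr//; have := pow_le _ _ (leqnSn k); lra.
  case: (ltP y (2 ^+ k.+1)) => h2; first by rewrite from1// from0// subr0.
  by rewrite !from1// subrr.
have bv : bmf (fun y : measurableTypeR R => \1_(from z) y * v y) by exact: bmf_v.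
pose g k (y : measurableTypeR R) := blk k y * (kk y * (\1_(from z) y * v y)).
have bg k : bmf (g k) by apply: bmfM => //; exact: bmfM.
(* 36 is 9 times 4: on the block the ratio 2^k / (2^k + huber) is at least 1/3, and [test_lower]
   keeps a quarter of the drift. *)
have block n k : (M <= k)%N -> green X n (g k) <= 36 * 2 ^+ k * (1 + green X n w).
  move=> Mk; have a1 := pow1 k; have zk : z <= 2 ^+ k by exact: pow_le.
  have := @green_lyapunov (test (2 ^+ k) 1 z) (fun y => 36^-1 * g k y)
    (fun y => 2 ^+ k * w y) (2 ^+ k) n (bmf_test _ (pow_gt0 k) ler01)
    (bmfZ _ (bg k)) (bmfZ _ bw) (fun y => test_bounds z y (pow_gt0 k) ler01).
  rewrite !greenZ// => H; suff : 36^-1 * green X n (g k) <= 2 ^+ k + 2 ^+ k * green X n w.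
    by lra.
  apply: H => y Sy; have /andP[kk0 kk1] := kk01 y.
  have [zy|yz] := leP z y; last first.
    rewrite /g /w from0// !mul0r !mulr0 subr0 (test0 _ _ (ltW yz)) subr0.
    by apply: kop_test_ge0.
  have y00 : 0 <= y by exact: le_trans zy.
  have vy := v_gt0 y00.
  (* Here 2^k >= z and huber >= y - z - 1/2, so the sum is at least y / 2, and y v y >= 64 b. *)
  have C : 32 * 1 * b <= v y * (2 ^+ k + huber 1 (y - z)).
    have h1 : y / 2 <= 2 ^+ k + huber 1 (y - z).
      by have := huber_ge_linear (y - z) (@ler01 R); move: a1 zk zy z1; clear_context; lra.
    have h2 := yv y (le_trans y0z zy).
    by have := ler_wpM2l (ltW vy) h1; move: h2; clear_context; lra.
  have := test_lower gg g0z ltr01 (pow_gt0 k) Sy zy C.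
  apply: le_trans; rewrite /w from1// mul1r.
  have h1 : test (2 ^+ k) 1 z y * rho y <= 2 ^+ k * (kk y * rho y).
    by rewrite mulrA ler_wpM2r ?rho_ge0// test_le_hslope.
  suff : 36^-1 * g k y <= (2 ^+ k / (2 ^+ k + huber 1 (y - z))) ^+ 2 *
    (hslope 1 (y - z) * v y / 4 + trunc K s y (hgain 1 (y - z)) / 2).
    by move: h1; clear_context; lra.
  rewrite /g blkE from1// mul1r -/(kk y).
  have G0 : 0 <= trunc K s y (hgain 1 (y - z)).
    by apply: trunc_ge0 => t _; exact: hgain_ge0.
  have kv0 : 0 <= kk y * v y by rewrite mulr_ge0// ltW.
  case: ifPn => [/andP[yk1 yk2]|_]; last first.
    by rewrite mul0r mulr0 mulr_ge0 ?sqr_ge0// addr_ge0// divr_ge0.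
  have hu0 := huber_ge0 (y - z) (@ler01 R).
  have hu : huber 1 (y - z) <= 2 * 2 ^+ k.
    have := huber_le_linear (@ler01 R) (_ : 0 <= y - z).
    by rewrite subr_ge0 => /(_ zy); rewrite powS in yk2; move: yk2 z0; clear_context; lra.
  have r3 : 3^-1 <= 2 ^+ k / (2 ^+ k + huber 1 (y - z)).
    by rewrite ler_pdivlMr ?ltr_wpDr//; move: hu; clear_context; lra.
  have r9 : 9^-1 <= (2 ^+ k / (2 ^+ k + huber 1 (y - z))) ^+ 2.
    rewrite (_ : 9^-1 = 3^-1 ^+ 2); last by rewrite exprVn -natrX.
    by rewrite lerXn2r ?nnegrE// (le_trans _ r3).
  rewrite mul1r; apply: (@le_trans _ _ (9^-1 * (kk y * v y / 4))).
    by clear_context; lra.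
  apply: ler_pM => //; first by rewrite divr_ge0.
  by move: G0; clear_context; lra.
(* The blocks stop at 2^N; over n steps the states beyond contribute at most n p(2^N) v(0). *)
have key n N : (M <= N)%N ->
    green X n w <= 36 * eps * (1 + green X n w) + n%:R * (p (2 ^+ N) * v 0).
  move=> MN.
  have J0 : 0 <= green X n w by exact: green_ge0.
  apply: (@le_trans _ _ (green X n (fun y => \sum_(k <- index_iota M N)
      p (2 ^+ k) * g k y + p (2 ^+ N) * v 0))).
    apply: (le_green chainX) => //.
      by apply: bmfD; [apply: bmf_sum => k _; exact: bmfZ|exact: bmf_cst].
    move=> y _; have [zy|yz] := leP z y; last first.
      rewrite /w from0// mul0r mulr0 addr_ge0//.
        by apply: sumr_ge0 => k _; rewrite /g from0// mul0r !mulr0.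
      by rewrite mulr_ge0 ?p_ge0 ?(ltW (pow_gt0 _))// ltW// v_gt0.
    have y00 : 0 <= y by exact: le_trans zy.
    have vy := v_gt0 y00; have /andP[kk0 kk1] := kk01 y.
    rewrite /w from1// mul1r.
    have tel : \sum_(k <- index_iota M N) blk k y = 1 - \1_(from (2 ^+ N)) y.
      have -> : \sum_(M <= k < N) blk k y = \sum_(M <= k < N)
          ((- \1_(from (2 ^+ k.+1)) y) - (- \1_(from (2 ^+ k)) y)).
        by apply: eq_bigr => k _; rewrite /blk opprK addrC.
      by rewrite (telescope_sumr (fun k => - \1_(from (2 ^+ k)) y))// opprK addrC -/z from1.
    have -> : kk y * rho y = \sum_(k <- index_iota M N) blk k y * (kk y * rho y) +
        \1_(from (2 ^+ N)) y * (kk y * rho y).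
      by rewrite -mulr_suml tel; clear_context; lra.
    apply: lerD.
      apply: ler_sum => k _; rewrite /g blkE from1// mul1r.
      case: ifPn => [/andP[yk1 yk2]|_]; last by rewrite !mul0r mulr0.
      rewrite !mul1r /rho mulrCA ler_wpM2r//.
        by rewrite mulr_ge0// ltW.
      by apply: p_decr => //=; rewrite in_itv/= andbT// ltW.
    have [yN|yN] := leP (2 ^+ N) y; last first.
      by rewrite from0// mul0r mulr_ge0 ?p_ge0 ?(ltW (pow_gt0 _))// ltW// v_gt0.
    rewrite from1// mul1r; apply: (@le_trans _ _ (rho y)).
      by rewrite ler_piMl// rho_ge0.
    apply: ler_pM; rewrite ?p_ge0 ?(ltW vy)//.
      by apply: p_decr => //=; rewrite in_itv/= andbT// ltW.
    by apply: v_decr => //=; rewrite in_itv/= andbT.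
  rewrite greenD//; [|by apply: bmf_sum => k _; exact: bmfZ|exact: bmf_cst].
  rewrite green_cst [X in _ + X]mulrC; apply: lerD => //.
  rewrite green_sum; last by move=> k; exact: bmfZ.
  apply: (@le_trans _ _ (\sum_(M <= k < N) (36 * (1 + green X n w)) *
      (2 ^+ k * p (2 ^+ k)))).
    apply: ler_sum_nat => k /andP[Mk _]; rewrite greenZ//.
    have := block n k Mk; have pp : 0 <= p (2 ^+ k) by rewrite p_ge0// ltW.
    by move=> /(ler_wpM2l pp); clear_context; lra.
  rewrite -mulr_sumr; have := sumM N MN.
  have h36 : 0 <= 36 * (1 + green X n w) by rewrite mulr_ge0// addr_ge0.
  by move=> /(ler_wpM2l h36); clear_context; lra.
(* From z + 1 on the slope is 1, so [w] is the undamped rate. *)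
exists (z + 1); split; first by rewrite addr_ge0.
move=> n; apply: (@le_trans _ _ (green X n w)).
  apply: (le_green chainX) => //; first by apply: bmf_rho; rewrite addr_ge0.
  move=> y _; have [zy|yz] := leP (z + 1) y; last by rewrite from0// mul0r.
  have zy' : z <= y by apply: le_trans zy; rewrite lerDl.
  by rewrite /w /kk !from1 ?hslope_right ?mul1r// lerBrDl.
have J0 : 0 <= green X n w by exact: green_ge0.
suff : green X n w <= 36 * eps * (1 + green X n w) + e / 4.
  by have := ler_wpM2r J0 eps2; move: eps1; clear_context; lra.
(* This [N] depends on n: together with 2^N p(2^N) <= eps it brings n p(2^N) v(0) below e / 4. *)
pose N := maxn M (Num.bound (n%:R * v 0 * eps / (e / 4))).
apply: le_trans (key n N (leq_maxl _ _)) _; rewrite lerD2l.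
have v00 : 0 < v 0 by exact: v_gt0.
have nv0 : 0 <= n%:R * v 0 by rewrite mulr_ge0// ltW.
have pN : 2 ^+ N * p (2 ^+ N) <= eps.
  have := sumM N.+1 (leq_trans (leq_maxl _ _) (leqnSn _)).
  rewrite big_nat_recr ?leq_maxl//=; apply: le_trans.
  by rewrite lerDr sumr_ge0.
have NB : n%:R * v 0 * eps / (e / 4) <= 2 ^+ N.
  apply: le_trans (pow_ge N); apply: le_trans (ltW (archi_boundP _)) _ => //.
    by rewrite divr_ge0// ?mulr_ge0// ltW.
  by rewrite ler_nat leq_maxr.
rewrite -(ler_pM2l (pow_gt0 N)).
move: NB; rewrite ler_pdivrMr; last by lra.
by have := ler_wpM2l nv0 pN; clear_context; lra.
Qed.

End lyapunov.

Lemma nneg_series_tail {R : realType} (u : nat -> R) (C e : R) : 0 < e ->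
  (forall n, 0 <= u n) -> (forall n, \sum_(0 <= k < n) u k <= C) ->
  exists N, forall m n, (N <= m)%N -> \sum_(m <= k < n) u k <= e.
Proof.
move=> e0 u0 uC.
have nd : nondecreasing_seq (series u).
  by apply/nondecreasing_seqP => k; rewrite !seriesEnat/= big_nat_recr//= lerDl.
have cv : cvgn (series u).
  by apply: nondecreasing_is_cvgn => //; exists C => _ [n _ <-]; exact: uC.
have le n : series u n <= limn (series u) by exact: nondecreasing_cvgn_le.
have /cvgrPdist_le /(_ _ e0)[N _ NP] : series u n @[n --> \oo] --> limn (series u) by [].
exists N => m n Nm; have [mn|nm] := leqP m n; last by rewrite big_geq ?(ltW e0)// ltnW.
have -> : \sum_(m <= k < n) u k = series u n - series u m.
  by rewrite !seriesEnat/= (@big_cat_nat _ _ _ m 0 n)//= addrAC subrr add0r.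
have := NP m Nm; rewrite /= ler_norml => /andP[_ h]; have := le n; lra.
Qed.

(** * Escape to infinity in probability *)

Section escape.
Context {R : realType} {d : measure_display} {T : measurableType d}.
Variable K : R.-pker (measurableTypeR R) ~> (measurableTypeR R).
Variables (S : set R) (P : probability T R) (X : nat -> {RV P >-> R}).
Variables (v s p : R -> R) (b : R) (tl : nat -> R).
Hypothesis reg : regime K S v s p b tl.
Hypothesis chainX : markov_chain S K X.

Let b_gt0 := reg_b_gt0 reg.
Let v_gt0 := reg_v_gt0 reg.
Let bmX f n : bmf f -> bmf (fun w => f (X n w)) := @bmfX _ _ _ _ X f n.

Lemma v_le x y : 0 <= x -> x <= y -> v y <= v x.
Proof.
by move=> x0 xy; apply: (reg_v_decr reg); rewrite //= in_itv/= andbT//; exact: le_trans xy.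
Qed.

Definition above x : set (measurableTypeR R) := [set t : R | x < t].

Lemma measurable_above x : measurable (above x).
Proof.
rewrite (_ : above x = [set` `]x, +oo[]); first exact: measurable_itv.
by apply/seteqP; split => t; rewrite /above/= in_itv/= andbT.
Qed.

Lemma above_in x y : x < y -> \1_(above x) y = 1 :> R.
Proof. by move=> xy; rewrite indicE mem_set. Qed.

Lemma above_notin x y : y <= x -> \1_(above x) y = 0 :> R.
Proof. by rewrite leNgt => /negP yx; rewrite indicE memNset. Qed.

Lemma bmf_above_set x : bmf (\1_(above x) : measurableTypeR R -> R).
Proof. by apply: bmf_indic; exact: measurable_above. Qed.

Lemma kop_ge0 f y : (forall x, 0 <= f x) -> 0 <= kop K f y.
Proof. by move=> f0; apply: bmf_int_ge0 => t; exact: f0. Qed.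

Lemma le_kop f g y : bmf f -> bmf g -> (forall x, f x <= g x) -> kop K f y <= kop K g y.
Proof. by move=> bf bg fg; apply: le_bmf_int => [||t]; [exact: bmf_shift..|]. Qed.

Lemma kopZ (c : R) f y : bmf f -> kop K (fun x => c * f x) y = c * kop K f y.
Proof. by move=> bf; rewrite /kop /jint bmf_intZ//; exact: bmf_shift. Qed.

(* An initial level from which [test] functions of slope 1 may be used. *)
Definition start x0 := good K S v s b x0 /\ forall y, x0 <= y -> 64 * b <= y * v y.

Lemma start_le x0 x1 : start x0 -> x0 <= x1 -> start x1.
Proof.
move=> [g H] x01; split; first exact: good_le x01.
by move=> y x1y; apply: H; exact: le_trans x1y.
Qed.

Lemma start_ge0 x0 : start x0 -> 0 <= x0.
Proof. by case => -[]. Qed.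

Lemma start_small (e : R) : 0 < e ->
  exists x0, start x0 /\ forall x n, x0 <= x -> big_jumps X v p x n <= e.
Proof.
move=> e0; have [x1 g1] := good_ex reg; have [x2 H2] := reg_yv_large reg (64 * b).
have [x3 [x30 H3]] := big_jumps_small reg chainX e0.
have [g10 _] := g1.
exists (x1 + `|x2| + x3); split; first split.
- by apply: good_le g1 _; have := normr_ge0 x2; lra.
- by move=> y xy; apply: H2; have := ler_norm x2; lra.
- move=> x n xx; apply: le_trans (H3 n); apply: (le_big_jumps reg chainX) => //.
  by have := normr_ge0 x2; lra.
Qed.

Lemma start_cond a z y : start z -> z + 1 <= a -> z <= y ->
  32 * 1 * b <= v y * (a + huber 1 (y - z)).
Proof.
move=> sz za zy; have [_ /(_ y zy) H] := sz; have z0 := start_ge0 sz.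
have y0 : 0 <= y by lra.
have := huber_ge_linear (y - z) (@ler01 R) => h; have b0 := b_gt0.
have : v y * y <= v y * (a + huber 1 (y - z)).
  by rewrite ler_wpM2l ?(ltW (v_gt0 y0))//; lra.
by lra.
Qed.

(** The limsup gives only visits to high levels. For large [a] the function [test a 1 z] is at most
    a e / 4 up to r and at least a (1 - e / 4) above r'. Once r' has been visited, its mean stays
    near its supremum [a], up to the cost of large jumps, so the chain is rarely at or below r. *)
Lemma escape (r e : R) : 0 < e ->
  {ae P, forall w, limn_esup (fun n => (X n w)%:E) = +oo%E} ->
  exists N, forall n, (N <= n)%N -> 1 - e <= expect X n \1_(above r).
Proof.
move=> e0 limX; have e4 : 0 < e / 4 by rewrite divr_gt0.
have [z [sz jz]] := start_small e4.
have z0 := start_ge0 sz.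
(* Up to r the test function is at most |r - z|, which is at most a e / 4; z + 1 <= a is the
   condition of [start_cond]. *)
pose a := z + 1 + (`|r - z| / (e / 4)).
have rz0 : 0 <= `|r - z| / (e / 4) by rewrite divr_ge0// ltW.
have a0 : 0 < a by rewrite /a; lra.
(* Above r' the Huber function u is at least 4 a / e, whence u / (a + u) >= 1 - e / 4. *)
pose r' := z + 1 + a / (e / 4).
have ae0 : 0 < a / (e / 4) by rewrite divr_gt0.
have [N HN] := hit_cvg1 r' e4 limX; exists N => n Nn.
pose c := a * (1 - e / 4).
have bt : bmf (test a 1 z) by exact: bmf_test.
have z0' : 0 <= z by [].
have bro := bmf_rho reg z0'.
have t01 y := test_bounds z y a0 (@ler01 R).
have H : c * fine (P (hit X r' n)) - green X n (fun y => a * (\1_(from z) y * (p y * v y)))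
    <= expect X n (test a 1 z).
  apply: (expect_ge_hit (K := K) (S := S)) => //.
  - exact: bmfZ.
  - by move=> y; case/andP: (t01 y).
  - by move=> y; rewrite mulr_ge0 ?(ltW a0)//; exact: (from_rho_ge0 reg).
  - move=> y Sy; have [zy|yz] := leP z y; last first.
      rewrite from0// mul0r mulr0 subr0 (test0 _ _ (ltW yz)).
      exact: kop_test_ge0.
    rewrite from1// mul1r.
    have za : z + 1 <= a by rewrite /a; lra.
    have [gz _] := sz.
    have := test_lower reg gz (lexx z) ltr01 a0 Sy zy (start_cond sz za zy).
    have y0 : 0 <= y by lra.
    have G0 : 0 <= trunc K s y (hgain 1 (y - z)).
      by apply: trunc_ge0 => t _; exact: hgain_ge0.
    have /andP[k0 _] := hslope_bounds (y - z) (@ler01 R).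
    have vy := v_gt0 y0; have py := reg_p_ge0 reg y0.
    have kv : 0 <= hslope 1 (y - z) * v y by rewrite mulr_ge0// ltW.
    have Q0 : 0 <= (a / (a + huber 1 (y - z))) ^+ 2 *
        (hslope 1 (y - z) * v y / 4 + trunc K s y (hgain 1 (y - z)) / 2).
      by rewrite mulr_ge0 ?sqr_ge0//; lra.
    have pv : 0 <= p y * v y by rewrite mulr_ge0// ltW.
    have /andP[_ ta] := t01 y; have := ler_wpM2r pv ta.
    by lra.
  - move=> y ry; rewrite /c /test /hyper.
    have hu : a / (e / 4) <= huber 1 (y - z).
      by have := huber_ge_linear (y - z) (@ler01 R); rewrite /r' in ry; lra.
    have hu' : a <= huber 1 (y - z) * (e / 4) by rewrite -ler_pdivrMr.
    rewrite -mulrA ler_pM2l// ler_pdivlMr; last by lra.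
    by nra.
have hN := HN n Nn.
have : c * fine (P (hit X r' n)) - a * (e / 4) <= expect X n (test a 1 z).
  apply: le_trans H; rewrite (greenZ X n a bro) lerB// ler_wpM2l ?(ltW a0)//.
  exact: jz.
have : expect X n (test a 1 z) <= a * (e / 4) + a * expect X n \1_(above r).
  have ba := bmf_above_set r.
  rewrite -(expect_cst X n (a * (e / 4))) -(expectZ X n a ba) -expectD; last 2 first.
  - exact: bmf_cst.
  - exact: bmfZ.
  apply: (le_expect chainX) => //.
    by apply: bmfD; [exact: bmf_cst|exact: bmfZ].
  move=> y _; have [ry|yr] := ltP r y.
    rewrite above_in// mulr1; have /andP[_ ta] := t01 y.
    by have : 0 <= a * (e / 4) by [rewrite mulr_ge0// ltW]; lra.
  rewrite above_notin// mulr0 addr0.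
  have h1 : `|r - z| <= a * (e / 4) by rewrite -ler_pdivrMr// /a; lra.
  have [zy|yz] := leP z y; last first.
    by rewrite (test0 _ _ (ltW yz)) mulr_ge0// ltW.
  apply: le_trans h1; apply: le_trans (ler_norm _).
  have h2 : huber 1 (y - z) <= 1 * (y - z) by apply: huber_le_linear => //; rewrite subr_ge0.
  have h0 := huber_ge0 (y - z) (@ler01 R).
  rewrite /test /hyper ler_pdivrMr; last by lra.
  have : 0 <= (r - z) * huber 1 (y - z) by rewrite mulr_ge0//; lra.
  have : a * huber 1 (y - z) <= a * (r - z) by rewrite ler_pM2l//; lra.
  lra.
rewrite /c; set q := fine _ in hN *; move=> h1 h2.
have q1 : q <= 1.
  rewrite /q -[leRHS]/(fine 1%E) fine_le//; last exact: probability_le1 (measurable_hit X r' n).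
  by rewrite fin_num_measure//; exact: measurable_hit.
have : a * (1 - e / 4) * q <= a * (2 * (e / 4) + expect X n \1_(above r)) by lra.
rewrite -mulrA ler_pM2l// => h3.
by nra.
Qed.

End escape.

(** * Green function of a unit cell and of the far right *)

Section cell_bounds.
Context {R : realType} {d : measure_display} {T : measurableType d}.
Variable K : R.-pker (measurableTypeR R) ~> (measurableTypeR R).
Variables (S : set R) (P : probability T R) (X : nat -> {RV P >-> R}).
Variables (v s p : R -> R) (b : R) (tl : nat -> R).
Hypothesis reg : regime K S v s p b tl.
Hypothesis chainX : markov_chain S K X.

Let b_gt0 := reg_b_gt0 reg.
Let v_gt0 := reg_v_gt0 reg.
Let v_le := v_le reg.

Definition level x0 := start K S v s b x0 /\ forall x n, x0 <= x -> big_jumps X v p x n <= 1.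

Lemma level_ex : exists x0, level x0.
Proof. by have [x0 [h1 h2]] := start_small reg chainX ltr01; exists x0. Qed.

Lemma level_le x0 x1 : level x0 -> x0 <= x1 -> level x1.
Proof.
move=> [h1 h2] x01; split; first exact: start_le x01.
by move=> x n x1x; apply: h2; exact: le_trans x1x.
Qed.

(** Left of x, v y >= v x and the height 64 b L / v x suffices alone. Right of x, 1 / v grows with
    slope at most 1 / (64 b) while the Huber function grows with slope L, so the product stays above
    32 L b. *)
Lemma local_cond L x z y : 0 < L -> 0 <= z -> z <= x -> z <= y ->
  (forall y, x <= y -> (v y)^-1 <= (v x)^-1 + (64 * b)^-1 * (y - x)) ->
  L * v x <= 64 * b ->
  32 * L * b <= v y * (64 * b * L / v x + huber L (y - z)).
Proof.
move=> L0 z0 zx zy iv vL; have b0 := b_gt0.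
have vx : 0 < v x by apply: v_gt0; lra.
have vy : 0 < v y by apply: v_gt0; lra.
have f0 := huber_ge0 (y - z) (ltW L0).
have [xy|yx] := leP x y; last first.
  have vxy : v x <= v y by apply: v_le; lra.
  have aE : v x * (64 * b * L / v x) = 64 * b * L by rewrite mulrC divfK// gt_eqF.
  have a0 : 0 <= 64 * b * L / v x by rewrite divr_ge0 ?(ltW vx)// !mulr_ge0// ltW.
  have := ler_wpM2r a0 vxy; have := mulr_ge0 (ltW vy) f0.
  have : 0 <= L * b by rewrite mulr_ge0// ltW.
  by lra.
have H := iv y xy.
have fL := huber_ge_linear (y - z) (ltW L0).
set w := (v x)^-1 in H *.
have wE : v x * w = 1 by rewrite mulfV// gt_eqF.
have w0 : 0 < w by rewrite invr_gt0.
have Lb0 : 0 < 32 * L * b by rewrite !mulr_gt0.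
have h1 : L ^+ 2 / 2 <= 32 * b * L * w.
  have := ler_wpM2r (ltW w0) (ler_wpM2l (ltW L0) vL).
  by rewrite mulrA -mulrA wE; lra.
have h2 : 32 * L * b * (v y)^-1 <= 64 * b * L * w + huber L (y - z).
  have := ler_wpM2l (ltW Lb0) H.
  have -> : 32 * L * b * (w + (64 * b)^-1 * (y - x)) = 32 * L * b * w + L * (y - x) / 2.
    by field; rewrite gt_eqF.
  have : 0 <= L * (x - z) by rewrite mulr_ge0 ?subr_ge0// ltW.
  have : 0 <= L * (y - x) by rewrite mulr_ge0 ?subr_ge0// ltW.
  by lra.
have := ler_wpM2l (ltW vy) h2.
by rewrite mulrCA mulfV ?mulr1// gt_eqF.
Qed.

Definition cell x : set (measurableTypeR R) := [set t : R | x < t <= x + 1].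

Lemma measurable_cell x : measurable (cell x).
Proof.
rewrite (_ : cell x = [set` `]x, x + 1]]); first exact: measurable_itv.
by apply/seteqP; split => t; rewrite /cell/= in_itv/=.
Qed.

Ltac clear_context := clear - reg chainX b_gt0 v_gt0 v_le.

(** Choose l so that jumps longer than l carry at most b / 4 of the second moment. With z = x - l
    and L = 2 l + 1, a jump of length at most l from a point of the cell stays in the quadratic part
    of the Huber function, so the gain there is at least half of b / 2 minus half of b / 4, that is
    b / 8. *)
Lemma local_bound : exists C x1, 0 < C /\ forall x n, x1 <= x ->
  green X n \1_(cell x) <= C / v x.
Proof.
have b0 := b_gt0.
have [x0 l0] := level_ex; have b4 : 0 < b / 4 by rewrite divr_gt0.
have [m Hm] := reg_unif_int reg b4.
pose l : R := m%:R; have l0' : 0 <= l by rewrite ler0n.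
have [L LE] : exists L, L = 2 * l + 1 by eexists.
have L0 : 0 < L by lra.
have b64 : 0 < (64 * b)^-1 by rewrite invr_gt0 mulr_gt0.
have [x2 H2] := reg_inv_v reg b64.
have bL : 0 < 64 * b / L by rewrite divr_gt0// mulr_gt0.
have [x3 H3] := reg_v_small reg bL.
have b2 : 0 < b / 2 by rewrite divr_gt0.
have [x4 H4] := reg_moment2 reg b2.
have sx0 : start K S v s b x0 by case: l0.
have x00 := start_ge0 sx0.
exists (64 * (64 * (2 * L))), (x0 + l + `|x2| + `|x3| + `|x4|); split; first by rewrite !mulr_gt0.
move=> x n xx.
have n2 := ler_norm x2; have n3 := ler_norm x3; have n4 := ler_norm x4.
have z2 := normr_ge0 x2; have z3 := normr_ge0 x3; have z4 := normr_ge0 x4.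
have [z zE] : exists z, z = x - l by eexists.
have x0z : x0 <= z by lra.
have z0 : 0 <= z by lra. have zx : z <= x by lra.
have x2x : x2 <= x by lra. have x4z : x4 <= z by lra. have x3x : x3 <= x by lra.
move=> {n2 n3 n4 z2 z3 z4 xx}.
have vx : 0 < v x by exact: v_gt0 (le_trans z0 zx).
pose a := 64 * b * L / v x.
have a0 : 0 < a by rewrite divr_gt0// !mulr_gt0.
have Lv : L * v x <= 64 * b by rewrite mulrC -ler_pdivlMr//; exact: H3.
have La : L * L <= a.
  by rewrite /a ler_pdivlMr//; have := ler_wpM2l (ltW L0) Lv; lra.
have gx0 : good K S v s b x0 by case: sx0.
have bc : bmf (\1_(cell x) : measurableTypeR R -> R).
  by apply: bmf_indic; exact: measurable_cell.
(* b / 64 is the product of 1/4 from the squared ratio, 1/2 from [test_lower] and the gain b / 8. *)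
have : green X n (fun y => b / 64 * \1_(cell x) y) <= a * (1 + big_jumps X v p z n).
  apply: (green_test reg chainX n gx0 x0z L0 a0).
  - move=> y zy; apply: local_cond => //.
    by move=> w xw; exact: H2.
  - exact: bmfZ.
  - move=> y Sy zy; have y0 : 0 <= y by exact: le_trans zy.
    have vy := v_gt0 y0.
    have /andP[k0 kL] := hslope_bounds (y - z) (ltW L0).
    have f0 := huber_ge0 (y - z) (ltW L0).
    have G0 : 0 <= trunc K s y (hgain L (y - z)).
      by apply: trunc_ge0 => t _; apply: hgain_ge0; exact: ltW.
    have kv : 0 <= hslope L (y - z) * v y by rewrite mulr_ge0// ltW.
    rewrite indicE; case: (boolP (y \in _)) => [|_]; last first.
      by rewrite mulr0 mulr_ge0 ?sqr_ge0// addr_ge0// divr_ge0.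
    rewrite inE /cell/= => /andP[xy yx].
    have f1 : huber L (y - z) <= a.
      apply: le_trans La; apply: le_trans (huber_le_linear (ltW L0) _) _.
        by rewrite subr_ge0.
      by rewrite ler_wpM2l ?(ltW L0)//; move: yx zE LE l0'; clear_context; lra.
    have r2 : 2^-1 <= a / (a + huber L (y - z))
      by rewrite ler_pdivlMr ?ltr_wpDr//; move: f1; clear_context; lra.
    have r4 : 4^-1 <= (a / (a + huber L (y - z))) ^+ 2.
      rewrite (_ : 4^-1 = 2^-1 ^+ 2); last by rewrite expr2; clear_context; lra.
      by rewrite lerXn2r ?nnegrE// (le_trans _ r2).
    have G : b / 8 <= trunc K s y (hgain L (y - z)).
      have bo : tbm (s y) (fun t => \1_(over m) t * `|t| ^+ 2).
        have bo : bmf (\1_(over m) : measurableTypeR R -> R).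
          by apply: bmf_indic; exact: measurable_over.
        apply: eq_bmf (bmfM (tbm_pow (s y) 2) bo) => t; rewrite -normrX ger0_norm ?sqr_ge0//.
        by rewrite -mulrA [X in _ * X]mulrC.
      have bt := tbm_pow (s y) 2.
      have : trunc K s y (fun t => 2^-1 * t ^+ 2 + (- 2^-1) * (\1_(over m) t * `|t| ^+ 2))
          <= trunc K s y (hgain L (y - z)).
        apply: le_trunc.
        - exact: (tbmD (tbmZ 2^-1 bt) (tbmZ (- 2^-1) bo)).
        - by apply: tbm_hgain; exact: ltW.
        - move=> t ts; rewrite -normrX (ger0_norm (sqr_ge0 t)) indicE.
          case: (boolP (t \in _)) => [_|].
            by rewrite mul1r; have := hgain_ge0 (y - z) t (ltW L0); clear_context; lra.
          move=> /negP; rewrite inE /over/= => /negP; rewrite -leNgt => tm.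
          rewrite mul0r; move: tm; rewrite ler_norml -/l => /andP[t1 t2].
          by rewrite hgain_mid; move: zE LE xy yx t1 t2; clear_context; lra.
      rewrite (truncD K (tbmZ 2^-1 bt) (tbmZ (- 2^-1) bo)) !truncZ//.
      have := Hm y Sy y0; have := H4 y Sy.
      move=> /(_ (le_trans x4z zy)); rewrite ler_norml => /andP[].
      by move: (trunc K s y _) (trunc K s y _) => u w; clear_context; lra.
    rewrite mulr1; apply: (@le_trans _ _ (4^-1 * (b / 16))); first by clear_context; lra.
    have kv0 : 0 <= hslope L (y - z) * v y / 4 by rewrite divr_ge0.
    by apply: ler_pM => //; move: b0 G kv0; clear_context; lra.
  - move=> y Sy yz; rewrite indicE memNset.
      by rewrite mulr0; apply: kop_test_ge0 => //; exact: ltW.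
    by rewrite /cell/= => /andP[xy _]; have := lt_trans xy (lt_le_trans yz zx); rewrite ltxx.
rewrite greenZ//.
have [_ /(_ z n x0z) J] := l0.
move=> H; have : b / 64 * green X n \1_(cell x) <= a * 2.
  by apply: le_trans H _; rewrite ler_pM2l//; move: J; clear_context; lra.
rewrite /a ler_pdivlMr// => H'.
have : b * (green X n \1_(cell x) * v x) <= b * (64 * (64 * (2 * L))).
  have : (64 * b * L / v x) * v x = 64 * b * L by rewrite divfK// gt_eqF.
  by have := ler_wpM2r (ltW vx) H'; clear_context; lra.
by rewrite ler_pM2l.
Qed.

(** A polynomial weight on the scale 1 / v x; it dominates the exponentially weighted errors right
    of the window in [generator_right]. *)
Definition decay x y : R := ((1 + v x * Num.max 0 (y - x))^-1) ^+ 3.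

Lemma decay_bounds x y : 0 <= x -> 0 <= decay x y <= 1.
Proof.
move=> x0; have vx := v_gt0 x0.
have h : 0 <= v x * Num.max 0 (y - x) by rewrite mulr_ge0 ?(ltW vx)// le_max lexx.
have i0 : 0 <= (1 + v x * Num.max 0 (y - x))^-1 by rewrite invr_ge0; lra.
rewrite /decay exprn_ge0//= exprn_ile1// invf_le1; lra.
Qed.

Lemma bmf_decay x : 0 <= x -> bmf (fun y : measurableTypeR R => \1_(from x) y * decay x y).
Proof.
move=> x0; have vx := v_gt0 x0.
apply: bmfM; first by apply: bmf_indic; exact: measurable_from.
split; last first.
  by exists 1 => y; have /andP[h1 h2] := decay_bounds y x0; rewrite ger0_norm.
apply: nonincreasing_measurable => // y w yw; rewrite /decay.
have h : forall u : R, 0 < 1 + v x * Num.max 0 u.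
  by move=> u; have : 0 <= v x * Num.max 0 u by [rewrite mulr_ge0 ?(ltW vx)// le_max lexx]; lra.
rewrite lerXn2r ?nnegrE ?invr_ge0 ?(ltW (h _))//.
rewrite lef_pV2 ?posrE// lerD2l ler_pM2l//.
by rewrite ge_max le_max lexx/= le_max lerD2r yw orbT.
Qed.

(** Put u = v x (y - x). For height 64 b / v x the slope of the test function is at least c^2 (1 +
    u)^-2, and v y >= v x / (1 + u) because 1 / v has slope at most 1. The drift thus dominates v x
    (1 + u)^-3, which explains the cube; the height, of order 1 / v x, supplies the other factor 1 /
    v x. *)
Lemma decay_bound : exists C x1, 0 < C /\ forall x n, x1 <= x ->
  green X n (fun y => \1_(from x) y * decay x y) <= C / v x ^+ 2.
Proof.
have b0 := b_gt0.
have [x0 l0] := level_ex.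
have b64 : 0 < (64 * b)^-1 by rewrite invr_gt0 mulr_gt0.
have [x2 H2] := reg_inv_v reg b64.
have [x5 H5] := reg_inv_v reg ltr01.
have b64' : 0 < 64 * b by rewrite mulr_gt0.
have [x3 H3] := reg_v_small reg b64'.
have [x6 H6] := reg_v_small reg ltr01.
have sx0 : start K S v s b x0 by case: l0.
have x00 := start_ge0 sx0.
(* With v x <= 1, the ratio a / (a + huber) is at least 64 b / (64 b + 1 + u), which is at least c /
   (1 + u). *)
pose c := 64 * b / (64 * b + 1).
have c0 : 0 < c by rewrite divr_gt0//; lra.
exists (8 * (64 * b) / c ^+ 2), (x0 + 1 + `|x2| + `|x3| + `|x5| + `|x6|); split.
  by rewrite divr_gt0 ?exprn_gt0// !mulr_gt0.
move=> x n xx.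
have n2 := ler_norm x2; have n3 := ler_norm x3; have n5 := ler_norm x5; have n6 := ler_norm x6.
have z2 := normr_ge0 x2; have z3 := normr_ge0 x3; have z5 := normr_ge0 x5; have z6 := normr_ge0 x6.
have [z zE] : exists z, z = x - 1 by eexists.
have x0z : x0 <= z by lra.
have z0 : 0 <= z by lra. have zx : z <= x by lra.
have x0' : 0 <= x by lra.
have x2x : x2 <= x by lra. have x3x : x3 <= x by lra.
have x5x : x5 <= x by lra. have x6x : x6 <= x by lra.
move=> {n2 n3 n5 n6 z2 z3 z5 z6 xx}.
have vx : 0 < v x by exact: v_gt0.
have v1 : v x <= 1 by exact: H6.
pose a := 64 * b * 1 / v x.
have a0 : 0 < a by rewrite divr_gt0// !mulr_gt0.
have Lv : 1 * v x <= 64 * b by rewrite mul1r; exact: H3.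
have gx0 : good K S v s b x0 by case: sx0.
have bd := bmf_decay x0'.
pose q := c ^+ 2 * v x / 4.
have q0 : 0 < q by rewrite /q divr_gt0// mulr_gt0// exprn_gt0.
have : green X n (fun y => q * (\1_(from x) y * decay x y)) <= a * (1 + big_jumps X v p z n).
  apply: (green_test reg chainX n gx0 x0z ltr01 a0).
  - move=> y zy; apply: local_cond => //.
    by move=> w xw; exact: H2.
  - exact: bmfZ.
  - move=> y Sy zy; have y0 : 0 <= y by exact: le_trans zy.
    have vy := v_gt0 y0.
    have /andP[k0 kL] := hslope_bounds (y - z) (@ler01 R).
    have f0 := huber_ge0 (y - z) (@ler01 R).
    have G0 : 0 <= trunc K s y (hgain 1 (y - z)).
      by apply: trunc_ge0 => t _; exact: hgain_ge0.
    have kv : 0 <= hslope 1 (y - z) * v y by rewrite mulr_ge0// ltW.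
    have [xy|yx] := leP x y; last first.
      by rewrite from0// mul0r mulr0 mulr_ge0 ?sqr_ge0// addr_ge0// divr_ge0.
    rewrite from1// mul1r hslope_right//; last by move: zE xy; clear_context; lra.
    rewrite /decay (max_idPr _) ?subr_ge0//.
    set u := v x * (y - x); have u0 : 0 <= u by rewrite mulr_ge0 ?subr_ge0// ltW.
    have u1 : 0 < 1 + u by rewrite ltr_pwDl.
    have vyu : v x * (1 + u)^-1 <= v y.
      have := H5 x y x5x xy; rewrite mul1r => /(ler_wpM2l (ltW vx)).
      rewrite mulrDr mulfV ?gt_eqF// -/u => /(ler_wpM2r (ltW vy)).
      rewrite -mulrA mulVf ?gt_eqF// mulr1 => h.
      by rewrite ler_pdivrMr// mulrC.
    have f1 : huber 1 (y - z) <= y - z.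
      have := huber_le_linear (@ler01 R) (_ : 0 <= y - z).
      by rewrite subr_ge0 mul1r => /(_ zy).
    have r1 : c * (1 + u)^-1 <= a / (a + huber 1 (y - z)).
      rewrite ler_pdivlMr ?ltr_wpDr//.
      rewrite -(ler_pM2r vx).
      have aE : a * v x = 64 * b by rewrite /a mulr1 divfK// gt_eqF.
      have cE : c * (64 * b + 1) = 64 * b by rewrite /c divfK// gt_eqF// addr_gt0.
      have iE : (1 + u)^-1 * (1 + u) = 1 by rewrite mulVf// gt_eqF.
      have ci0 : 0 <= c * (1 + u)^-1 by rewrite mulr_ge0 ?invr_ge0 ?ltW.
      have h1 : (a + huber 1 (y - z)) * v x <= (64 * b + 1) * (1 + u).
        have h2 : huber 1 (y - z) * v x <= u + v x.
          have := ler_wpM2r (ltW vx) f1; rewrite /u zE; clear_context; lra.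
        have : 0 <= 64 * b * u by rewrite mulr_ge0// mulr_ge0// ltW.
        by rewrite (mulrDl a) aE; move: h2 v1; clear_context; lra.
      have := ler_wpM2l ci0 h1; rewrite aE mulrA.
      suff -> : c * (1 + u)^-1 * ((64 * b + 1) * (1 + u)) = 64 * b by [].
      by rewrite mulrACA cE iE mulr1.
    apply: (@le_trans _ _ ((c * (1 + u)^-1) ^+ 2 * (v x * (1 + u)^-1 / 4))).
      by rewrite /q le_eqVlt; apply/orP; left; apply/eqP; ring.
    have i0 : 0 <= (1 + u)^-1 by rewrite invr_ge0 ltW.
    have ci0 : 0 <= c * (1 + u)^-1 by exact: mulr_ge0 (ltW c0) i0.
    have vi0 : 0 <= v x * (1 + u)^-1 by exact: mulr_ge0 (ltW vx) i0.
    apply: ler_pM; [exact: sqr_ge0|exact: divr_ge0| |].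
      by rewrite lerXn2r ?nnegrE// (le_trans _ r1).
    by rewrite mul1r; move: vyu G0; clear_context; lra.
  - move=> y Sy yz; rewrite from0; last by lra.
    by rewrite mul0r mulr0; apply: kop_test_ge0.
rewrite greenZ//.
have [_ /(_ z n x0z) J] := l0.
move=> H; have : q * green X n (fun y => \1_(from x) y * decay x y) <= a * 2.
  by apply: le_trans H _; rewrite ler_pM2l//; move: J; clear_context; lra.
have v20 : 0 < v x ^+ 2 by rewrite exprn_gt0.
rewrite ler_pdivlMr// ler_pdivlMr ?exprn_gt0//.
move: (green _ _ _) => g; rewrite /q /a mulr1 -(ler_pM2r vx).
have -> : 64 * b / v x * 2 * v x = 2 * (64 * b) by rewrite mulrAC divfK ?gt_eqF//; ring.
by clear_context; lra.
Qed.

End cell_bounds.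

(** * Jumps over x from below a fixed level *)

Section upcrossings.
Context {R : realType} {d : measure_display} {T : measurableType d}.
Variable K : R.-pker (measurableTypeR R) ~> (measurableTypeR R).
Variables (S : set R) (P : probability T R) (X : nat -> {RV P >-> R}).
Variables (v s p : R -> R) (b : R) (tl : nat -> R).
Hypothesis reg : regime K S v s p b tl.
Hypothesis chainX : markov_chain S K X.

Lemma expect_above_small k (e : R) : 0 < e ->
  exists x1, forall x, x1 <= x -> expect X k \1_(above x) <= e.
Proof.
move=> e0; pose F n := X k @^-1` [set t | t <= n%:R].
pose B n : set (measurableTypeR R) := [set t : R | t <= n%:R].
have mB n : measurable (B n).
  rewrite (_ : B n = [set` `]-oo, n%:R]]); first exact: measurable_itv.
  by apply/seteqP; split => t; rewrite /B/= in_itv/=.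
have bB n : bmf (\1_(B n) : measurableTypeR R -> R) by exact: bmf_indic.
have mF n : measurable (F n).
  by rewrite -[F n]setTI; apply: (measurable_funPT (X k)) => //; exact: mB.
have UF : \bigcup_n F n = setT.
  apply/seteqP; split => // w _; exists (Num.bound `|X k w|) => //=.
  by rewrite /F/= (le_trans (ler_norm _))// ltW// archi_boundP.
have mU : measurable (\bigcup_n F n) by rewrite UF.
have ndF : {homo F : n m / (n <= m)%N >-> (n <= m)%O}.
  move=> n m nm; apply/subsetPset => w; rewrite /F/= => /le_trans; apply.
  by rewrite ler_nat.
have : P (F n) @[n --> \oo] --> 1%E.
  by rewrite -(probability_setT P) -UF; exact: nondecreasing_cvg_mu.
move=> /fine_cvgP[_] /cvgrPdist_le /(_ _ e0)[N _ NP]; exists N%:R => x Nx.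
have := NP N (leqnn N); rewrite /= ler_norml => /andP[_].
have -> : P (F N) = (expect X k \1_(B N))%:E by rewrite expectE//; exact: mB.
rewrite /= => H.
have ba := bmf_above_set x.
suff : expect X k \1_(above x) + expect X k \1_(B N) <= 1 by lra.
rewrite -expectD// -(expect_cst X k 1); apply: (le_expect chainX).
- exact: bmfD.
- exact: bmf_cst.
move=> y _; have [xy|yx] := ltP x y.
  rewrite above_in// indicE memNset ?addr0// /B/= => yN.
  by have := le_lt_trans (le_trans yN Nx) xy; rewrite ltxx.
by rewrite above_notin// add0r indicE; case: (_ \in _).
Qed.

(** Below x0, where states may be negative, no estimate of the jumps is at hand; all that enters is
    the probability of landing above x. *)
Definition upcross x0 x (y : R) : R := (1 - \1_(from x0) y) * kop K \1_(above x) y.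

Lemma upcrossE x0 x y : upcross x0 x y = if x0 <= y then 0 else kop K \1_(above x) y.
Proof.
rewrite /upcross; case: leP => xy; first by rewrite from1// subrr mul0r.
by rewrite from0// subr0 mul1r.
Qed.

Lemma kop_above_ge0 x y : 0 <= kop K \1_(above x) y.
Proof. by apply: kop_ge0 => t; rewrite indicE. Qed.

Lemma upcross_ge0 x0 x y : 0 <= upcross x0 x y.
Proof. by rewrite upcrossE; case: ifP => // _; exact: kop_above_ge0. Qed.

Lemma bmf_upcross x0 x : bmf (upcross x0 x : measurableTypeR R -> R).
Proof.
apply: bmfM; last by apply: bmf_kop; exact: bmf_above_set.
by apply: bmfB; [exact: bmf_cst|apply: bmf_indic; exact: measurable_from].
Qed.

(** A jump from below x0 to above x0 + 1 lifts the test function from 0 to at least [c], so the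
    expected number of such jumps is bounded uniformly in n. The tail of this convergent series
    settles late times for all x at once; the finitely many early times are settled by tightness of
    each X k as x grows. *)
Lemma upcross_small x0 (e : R) : level K S X v s p b x0 -> 0 < e ->
  exists x1, forall x n, x1 <= x -> green X n (upcross x0 x) <= e.
Proof.
move=> [sx jx] e0; have x00 := start_ge0 sx.
pose a := x0 + 1; have a0 : 0 < a by rewrite /a; lra.
(* The Huber function of slope 1 is at least 1/2 at distance 1. *)
pose c : R := hyper a (2^-1).
have c0 : 0 < c by rewrite /c /hyper divr_gt0 ?mulr_gt0 ?invr_gt0//; lra.
pose x' := x0 + 1.
have gx : good K S v s b x0 by case: sx.
have bu x := bmf_upcross x0 x.
have bound n : green X n (upcross x0 x') <= c^-1 * (a * 2).
  have : green X n (fun y => c * upcross x0 x' y) <= a * (1 + big_jumps X v p x0 n).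
    apply: (green_test reg chainX n gx (lexx x0) ltr01 a0).
    - by move=> y xy; apply: (start_cond reg) => //; rewrite /a; lra.
    - exact: (bmfZ c (bu x')).
    - move=> y Sy xy; rewrite upcrossE xy mulr0; apply: mulr_ge0; first exact: sqr_ge0.
      have y0 : 0 <= y by lra.
      have vy := reg_v_gt0 reg y0.
      have /andP[k0 kL] := hslope_bounds (y - x0) (@ler01 R).
      have G0 : 0 <= trunc K s y (hgain 1 (y - x0)).
        by apply: trunc_ge0 => t _; exact: hgain_ge0.
      have : 0 <= hslope 1 (y - x0) * v y by rewrite mulr_ge0// ltW.
      by lra.
    - move=> y Sy yx; rewrite upcrossE (leNgt x0 y) yx/=.
      have ba := bmf_above_set x'.
      rewrite -(kopZ K c y ba); apply: le_kop; [exact: bmfZ|exact: bmf_test|].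
      move=> t; have [xt|tx] := ltP x' t; last first.
        by rewrite above_notin// mulr0; have /andP[] := test_bounds x0 t a0 (@ler01 R).
      rewrite above_in// mulr1 /c /test; apply: hyper_nd => //.
      by have := huber_ge_linear (t - x0) (@ler01 R); rewrite /x' in xt; lra.
  rewrite greenZ// => H; rewrite -(ler_pM2l c0) mulrA mulfV ?mul1r ?gt_eqF//.
  by apply: le_trans H _; rewrite ler_pM2l//; have := jx x0 n (lexx x0); lra.
have e2 : 0 < e / 2 by rewrite divr_gt0.
have u0 k : 0 <= expect X k (upcross x0 x').
  by apply: expect_ge0 => y; exact: upcross_ge0.
have uC n : \sum_(0 <= k < n) expect X k (upcross x0 x') <= c^-1 * (a * 2).
  by rewrite big_mkord; exact: bound.
have [N HN] := nneg_series_tail e2 u0 uC.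
pose ee := e / 2 / N.+1%:R; have eN : 0 < ee by rewrite !divr_gt0// ltr0n.
have [x1 H1] : exists x1, forall x k, x1 <= x -> (k <= N.+1)%N ->
    expect X k \1_(above x) <= ee.
  elim: N.+1 => [|m [x1 H1]].
    have [x1 H1] := expect_above_small 0 eN; exists x1 => x k xx.
    by rewrite leqn0 => /eqP ->; exact: H1.
  have [x2 H2] := expect_above_small m.+1 eN.
  exists (Num.max x1 x2) => x k; rewrite ge_max => /andP[h1 h2].
  by rewrite leq_eqVlt => /orP[/eqP ->|]; [exact: H2|rewrite ltnS; exact: H1].
exists (Num.max x' x1) => x n; rewrite ge_max => /andP[xx' xx1].
have ux y : upcross x0 x y <= upcross x0 x' y.
  rewrite !upcrossE; case: ifP => // _; apply: le_kop; [exact: bmf_above_set..|].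
  move=> t; have [xt|tx] := ltP x t; last by rewrite above_notin// indicE.
  by rewrite !above_in//; exact: le_lt_trans xt.
have uk y : upcross x0 x y <= kop K \1_(above x) y.
  by rewrite upcrossE; case: ifP => // _; exact: kop_above_ge0.
have E1 k : (k < N)%N -> expect X k (upcross x0 x) <= ee.
  move=> kN; apply: (@le_trans _ _ (expect X k.+1 \1_(above x))).
    rewrite (expect_kop chainX); last exact: bmf_above_set.
    by apply: (le_expect chainX) => //; apply: bmf_kop; exact: bmf_above_set.
  by apply: H1 => //; exact: leqW.
have E2 k : expect X k (upcross x0 x) <= expect X k (upcross x0 x').
  exact: (le_expect chainX).
have eeN : ee * N.+1%:R = e / 2 by rewrite divfK// pnatr_eq0.
have H2 m : (m <= N)%N -> \sum_(0 <= k < m) expect X k (upcross x0 x) <= e / 2.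
  move=> mN; apply: (@le_trans _ _ (\sum_(0 <= k < m) ee)).
    by apply: ler_sum_nat => k /andP[_ km]; apply: E1; exact: leq_trans mN.
  rewrite sumr_const_nat subn0 -[ee *+ m]mulr_natr -eeN.
  by apply: ler_wpM2l; [exact: ltW|rewrite ler_nat leqW].
rewrite /green -(big_mkord xpredT (fun k => expect X k (upcross x0 x))).
have [nN|Nn] := leqP n N; first by have := H2 n nN; lra.
rewrite (@big_cat_nat _ _ _ N)//=; last exact: ltnW.
have : \sum_(N <= k < n) expect X k (upcross x0 x) <= e / 2.
  by apply: le_trans (HN N n (leqnn N)); apply: ler_sum => k _; exact: E2.
by have := H2 N (leqnn N); lra.
Qed.

End upcrossings.

Section expR_bounds.
Context {R : realType}.

Lemma expR_le2 (x : R) : x <= 2^-1 -> expR x <= 2.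
Proof.
move=> x2; have := expR_ge1Dx (- x); rewrite expRN => h.
have e0 := expR_gt0 x.
have : expR x * 2^-1 <= expR x * (expR x)^-1 by rewrite ler_pM2l//; lra.
by rewrite mulfV ?gt_eqF//; lra.
Qed.

(** Fourth power of 1 + u <= (1 + 4 b) exp(u / (4 b)). Of the four factors 1 + u, one pays for the
    growth of the relative errors and three for [decay]. *)
Lemma expR_poly4 (b u : R) : 0 < b -> 0 <= u ->
  (1 + u) ^+ 4 * expR (- (u / b)) <= (1 + 4 * b) ^+ 4.
Proof.
move=> b0 u0; rewrite expRN -ler_pdivlMr ?invr_gt0 ?expR_gt0// invrK.
have -> : expR (u / b) = expR (u / b / 4) ^+ 4.
  by rewrite -expRM_natl; congr expR; lra.
rewrite -exprMn lerXn2r ?nnegrE ?mulr_ge0 ?expR_ge0//; [lra|lra|].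
have h : 1 + u / b / 4 <= expR (u / b / 4) by exact: expR_ge1Dx.
have ub : 0 <= u / b by rewrite divr_ge0// ltW.
have : (1 + 4 * b) * (1 + u / b / 4) <= (1 + 4 * b) * expR (u / b / 4).
  by rewrite ler_pM2l//; lra.
have : b * (u / b) = u by rewrite mulrC divfK// gt_eqF.
by lra.
Qed.

End expR_bounds.

(** * The potential and its generator *)

Section potential.
Context {R : realType}.
Variables (K : R.-pker (measurableTypeR R) ~> (measurableTypeR R)).
Variables (S : set R) (v s p : R -> R) (b : R) (tl : nat -> R).
Hypothesis reg : regime K S v s p b tl.

Let b_gt0 := reg_b_gt0 reg.
Let v_gt0 := reg_v_gt0 reg.
Let v_le := v_le reg.

(* For Brownian motion with drift v x and variance b this is, up to the bounded
   oscillation of v, the potential of the indicator of ]x, x + h]: its slope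
   grows like (2 / b) (y - x) up to 2 h / b and then decays exponentially. *)
Definition potential x h : measurableTypeR R -> R := fun y =>
  h / v x * (1 - expR (- (2 * v x / (b * h) * huber h (y - x)))).

Lemma potential_bounds x h y : 0 <= x -> 0 < h -> 0 <= potential x h y <= h / v x.
Proof.
move=> x0 h0; have vx := v_gt0 x0; have b0 := b_gt0.
have c0 : 0 < h / v x by rewrite divr_gt0.
have e0 : 0 <= 2 * v x / (b * h) * huber h (y - x).
  rewrite mulr_ge0 ?huber_ge0 ?(ltW h0)// divr_ge0 ?mulr_ge0//; exact: ltW.
have e1 : expR (- (2 * v x / (b * h) * huber h (y - x))) <= 1.
  by rewrite expR_le1; lra.
have e2 := expR_ge0 (- (2 * v x / (b * h) * huber h (y - x))).
by rewrite /potential mulr_ge0 ?(ltW c0)//=; [rewrite ler_piMr ?(ltW c0)//; lra|lra].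
Qed.

Lemma potential_nd x h y z : 0 <= x -> 0 < h -> y <= z -> potential x h y <= potential x h z.
Proof.
move=> x0 h0 yz; have vx := v_gt0 x0; have b0 := b_gt0.
have c0 : 0 < h / v x by rewrite divr_gt0.
rewrite /potential ler_pM2l// lerD2l lerN2 ler_expR lerN2.
rewrite ler_wpM2l//; first by rewrite divr_ge0 ?mulr_ge0//; exact: ltW.
by apply: huber_nd; [exact: ltW|lra].
Qed.

Lemma bmf_potential x h : 0 <= x -> 0 < h -> bmf (potential x h).
Proof.
move=> x0 h0; split; last first.
  exists (h / v x) => y; have /andP[h1 h2] := potential_bounds y x0 h0.
  by rewrite ger0_norm.
by apply: nondecreasing_measurable => // y z yz; exact: potential_nd.
Qed.

Lemma potential0 x h y : y <= x -> potential x h y = 0.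
Proof.
by move=> yx; rewrite /potential huber0 ?subr_le0// mulr0 oppr0 expR0 subrr mulr0.
Qed.

(** Right of the window k = h, the second moment is near b, and the first is near v x as long as v y
    is: drift and diffusion cancel, which fixes the rate 2 v x / (b h). Inside the window both are
    small, the exponential is near 1 and the gain G near b / 2, so D G is near 1. The rest is the
    Taylor remainder and the large jumps, each of which moves the potential by at most h / v x. *)
Lemma kop_potential x h y eta D : 0 <= x -> 0 < h -> S y -> 0 <= y ->
  let k := hslope h (y - x) in let G := trunc K s y (hgain h (y - x)) in
  eta = 2 * v x / b * s y ->
  D = 2 / b * expR (- (2 * v x / (b * h) * huber h (y - x))) ->
  `|kop K (potential x h) y - potential x h y -
     D * (k * trunc K s y (fun t => t ^+ 1) -
          v x / (b * h) * k ^+ 2 * trunc K s y (fun t => t ^+ 2) + G)| <=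
  D * (2 * eta * expR (2 * eta)) * (G + 2 * v x / b * k * trunc K s y (fun t => t ^+ 2)) +
  h / v x * (p y * v y).
Proof.
move=> x0 h0 Sy y0 k G etaE DE; have vx := v_gt0 x0; have b0 := b_gt0.
have h0' := ltW h0; have sy := reg_s_gt0 reg y0.
pose be := 2 * v x / (b * h).
have be0 : 0 < be by rewrite divr_gt0// mulr_gt0.
have beh : be * h = 2 * v x / b.
  by rewrite /be; field; rewrite !gt_eqF.
have be2 : be / 2 = v x / (b * h) by rewrite /be; field; rewrite !gt_eqF.
have cbe : h / v x * be = 2 / b by rewrite /be; field; rewrite !gt_eqF.
have b1 := tbm_pow (s y) 1; have b2 := tbm_pow (s y) 2.
have bg := tbm_hgain (s y) (y - x) h0'.
pose psi t := D * (k * t ^+ 1 + (- (be / 2 * k ^+ 2) * t ^+ 2 + hgain h (y - x) t)).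
pose ee := D * (2 * eta * expR (2 * eta)).
pose chi t := ee * (hgain h (y - x) t + be * h * k * t ^+ 2).
have b1' := tbmZ k b1; have b2' := tbmZ (- (be / 2 * k ^+ 2)) b2.
have bi := tbmD b1' (tbmD b2' bg).
have bj := tbmD bg (tbmZ (be * h * k) b2).
have bpsi : tbm (s y) psi by exact: tbmZ bi.
have bchi : tbm (s y) chi by exact: tbmZ bj.
have kh : 0 <= k <= h by exact: hslope_bounds.
have incr t : `|t| < s y ->
    `|potential x h (y + t) - potential x h y - psi t| <= chi t.
  move=> ts; have c0 : 0 <= h / v x by rewrite divr_ge0 ?ltW.
  have dl : `|k * t + hgain h (y - x) t| <= h * `|t|.
    have := huber_dist (y - x) t h0'.
    by rewrite (hgain_split _ (erefl (hslope h (y - x)))) -/k addrAC subrr add0r.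
  have etaE' : eta = be * h * s y by rewrite etaE beh.
  have DE' : D = h / v x * be * expR (- (be * huber h (y - x))) by rewrite cbe DE.
  have := expR_increment c0 be0 h0' kh (ltW ts) (hgain_ge0 (y - x) t h0')
    (hgain_le_abs (y - x) t h0') dl etaE' DE'.
  rewrite /potential (_ : y + t - x = y - x + t); last by lra.
  rewrite (hgain_split _ (erefl (hslope h (y - x)))) -/k -/be.
  have -> : psi t = D * (k * t - be / 2 * k ^+ 2 * t ^+ 2 + hgain h (y - x) t).
    by rewrite /psi; ring.
  by [].
have := kop_near (reg_large reg) Sy y0 (bmf_potential x0 h0)
  (fun z => potential_bounds z x0 h0) bpsi bchi incr.
rewrite /psi /chi (truncZ K _ bi) (truncZ K _ bj).
rewrite (truncD K b1' (tbmD b2' bg)) (truncD K b2' bg) (truncD K bg (tbmZ _ b2)).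
rewrite !truncZ// -/G;
set M1 := trunc K s y (fun t => t ^+ 1); set M2 := trunc K s y (fun t => t ^+ 2).
rewrite /ee beh be2.
by rewrite (_ : k * M1 - v x / (b * h) * k ^+ 2 * M2 + G =
  k * M1 + (- (v x / (b * h) * k ^+ 2) * M2 + G)); last ring.
Qed.

Lemma gain_ge0 y u h : 0 <= h -> 0 <= trunc K s y (hgain h u).
Proof. by move=> h0; apply: trunc_ge0 => t _; exact: hgain_ge0. Qed.

Lemma gain_le_moment y u h : 0 <= h ->
  trunc K s y (hgain h u) <= trunc K s y (fun t => t ^+ 2) / 2.
Proof.
move=> h0; rewrite mulrC -truncZ; last exact: tbm_pow.
apply: le_trunc; [exact: tbm_hgain|exact: (tbmZ _ (tbm_pow (s y) 2))|].
by move=> t _; have := hgain_le_sqr u t h0; lra.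
Qed.

Let bover m : bmf (\1_(over m) : measurableTypeR R -> R).
Proof. by apply: bmf_indic; exact: measurable_over. Qed.

(** At distance j from the curved part only jumps longer than j see the curvature, and their gain is
    at most h |t|. *)
Lemma gain_tail y u h j : S y -> 0 <= y -> 0 <= h ->
  u <= - j%:R \/ h + j%:R <= u -> trunc K s y (hgain h u) <= h * tl j.
Proof.
move=> Sy y0 h0 uj.
have bo : tbm (s y) (fun t => \1_(over j) t * `|t|).
  apply: eq_bmf (bmfM (tbm_abs (s y)) (bover j)) => t.
  by rewrite -mulrA [X in _ * X]mulrC.
apply: (@le_trans _ _ (h * trunc K s y (fun t => \1_(over j) t * `|t|))).
  rewrite -truncZ//; apply: le_trunc; [exact: tbm_hgain|exact: tbmZ|].
  move=> t ts; rewrite indicE; case: (boolP (t \in _)) => [_|].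
    by rewrite mul1r hgain_le_abs.
  move=> /negP; rewrite inE /over/= => /negP; rewrite -leNgt => tj.
  by rewrite mul0r mulr0 (hgain_far h0 _ uj tj).
by rewrite ler_wpM2l//; exact: (reg_trunc_tl reg).
Qed.

Lemma gain_out y u h D : 0 <= h -> 0 <= D -> s y <= D ->
  u <= - D \/ h + D <= u -> trunc K s y (hgain h u) = 0.
Proof.
move=> h0 D0 sD uD; apply: trunc0 => t ts.
by apply: (hgain_far h0 D0 uD); exact: le_trans (ltW ts) sD.
Qed.

Lemma gain_mid y u h (m : nat) : 0 <= h -> m%:R <= u -> u <= h - m%:R ->
  `|trunc K s y (hgain h u) - trunc K s y (fun t => t ^+ 2) / 2| <=
  trunc K s y (fun t => \1_(over m) t * `|t| ^+ 2) / 2.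
Proof.
move=> h0 mu uh; have bt := tbm_pow (s y) 2; have bg := tbm_hgain (s y) u h0.
have bo : tbm (s y) (fun t => \1_(over m) t * `|t| ^+ 2).
  apply: eq_bmf (bmfM (tbm_pow (s y) 2) (bover m)) => t.
  rewrite -normrX ger0_norm ?sqr_ge0//.
  by rewrite -mulrA [X in _ * X]mulrC.
have H := gain_le_moment y u h0.
rewrite ler0_norm; last by lra.
suff : trunc K s y (fun t => 2^-1 * t ^+ 2 + (- 2^-1) * (\1_(over m) t * `|t| ^+ 2))
    <= trunc K s y (hgain h u).
  rewrite (truncD K (tbmZ 2^-1 bt) (tbmZ (- 2^-1) bo)) !truncZ//; lra.
apply: le_trunc => //.
  exact: (tbmD (tbmZ 2^-1 bt) (tbmZ (- 2^-1) bo)).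
move=> t ts; rewrite -normrX (ger0_norm (sqr_ge0 t)) indicE.
case: (boolP (t \in _)) => [_|].
  by rewrite mul1r; have := hgain_ge0 u t h0; lra.
move=> /negP; rewrite inE /over/= => /negP; rewrite -leNgt => tm.
have m0 : 0 <= m%:R :> R by rewrite ler0n.
move: tm; rewrite ler_norml => /andP[t1 t2].
by rewrite mul0r hgain_mid; lra.
Qed.

End potential.

(** The arithmetic of [generator_inside]: x is the drift term, y the diffusion term, g the gain, E
    the exponential, q the Taylor factor and z its second-moment part. All but 2 g / b is O(e). *)
Lemma inside_algebra {R : realType} (A x y z g r E q b e : R) :
  0 < b -> 0 < e -> 16 * e <= b -> 0 <= g -> g <= b ->
  0 <= E -> E <= 1 -> 1 - 2 * e / b <= E -> 0 <= q -> q <= 16 * e / b ->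
  0 <= x -> x <= 2 * e -> 0 <= y -> y <= 2 * e -> 0 <= z -> z <= 4 * e ->
  `|A - 2 / b * E * (x - y + g)| <= 2 / b * E * q * (g + z) + r ->
  `|A - 1| <= 2 / b * `|g - b / 2| + 60 * e / b + r.
Proof.
move=> b0 e0 eb g0 gb E0 E1 E1' q0 q1 x0 x1 y0 y1 z0 z1.
have [i iE] : exists i, i = b^-1 by eexists.
rewrite -iE in E1' q1 *.
have ib : b * i = 1 by rewrite iE mulfV// gt_eqF.
have i0 : 0 < i by rewrite iE invr_gt0.
have [D DE] : exists D, D = 2 * i * E by eexists.
rewrite -DE.
have D0 : 0 <= D by rewrite DE mulr_ge0// mulr_ge0// ltW.
have D2 : D <= 2 * i by have := ler_wpM2l (ltW i0) E1; rewrite DE; lra.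
have D2' : 2 * i - D <= 4 * e * i * i.
  by have := ler_wpM2l (ltW i0) E1'; rewrite DE; lra.
have rem : D * q * (g + z) <= 40 * e * i.
  have s1 : D * q <= 2 * i * (16 * e * i) by apply: ler_pM.
  have s2 : g + z <= 5 / 4 * b by lra.
  have s3 : 0 <= g + z by lra.
  have s4 : 0 <= D * q by rewrite mulr_ge0.
  apply: le_trans (ler_pM s4 s3 s1 s2) _.
  rewrite (_ : 2 * i * (16 * e * i) * (5 / 4 * b) = 40 * e * i * (b * i)); last by field.
  by rewrite ib mulr1.
have drift : `|D * (x - y)| <= 4 * e * i.
  rewrite normrM (ger0_norm D0).
  have : `|x - y| <= 2 * e by rewrite ler_norml; lra.
  by move=> /(ler_pM D0 (normr_ge0 _) D2) /le_trans; apply; lra.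
have Dg : `|D * g - 1| <= 2 * i * `|g - b / 2| + 4 * e * i.
  have -> : D * g - 1 = 2 * i * (g - b / 2) - (2 * i - D) * g.
    by transitivity (D * g - b * i); [rewrite ib|field].
  apply: le_trans (ler_normB _ _) _; rewrite normrM (@ger0_norm _ (2 * i)); last by lra.
  have d0 : 0 <= 2 * i - D by lra.
  rewrite lerD2l ger0_norm; last exact: mulr_ge0.
  apply: le_trans (ler_pM d0 g0 D2' gb) _.
  have -> : 4 * e * i * i * b = 4 * e * i * (b * i) by ring.
  by rewrite ib; lra.
move=> kp.
have -> : A - 1 = (A - D * (x - y + g)) + (D * (x - y) + (D * g - 1)) by ring.
apply: le_trans (ler_normD _ _) _.
have := ler_normD (D * (x - y)) (D * g - 1).
have ei : 0 < e * i by rewrite mulr_gt0.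
by move: (D * q * _) rem kp => w rem kp; lra.
Qed.

Lemma right_algebra {R : realType} (A M1 M2 g r D W u q eta b e h v vy Cw w : R) :
  0 < b -> 0 < e -> 16 * e <= b -> 0 < h -> 0 < v -> 0 <= g -> 0 <= u ->
  0 <= D -> D <= 4 / b * W -> 0 <= q -> D * q <= 4 / b * W -> 0 <= W -> W <= 1 ->
  W * (1 + u) <= Cw -> W * (1 + u) <= Cw * w -> 0 <= eta ->
  eta <= 2 * e / b * (1 + u) -> vy <= v -> v - vy <= e * u * v -> `|M1 - vy| <= e * vy ->
  `|M2 - b| <= e -> M2 <= 2 * b -> 0 <= M2 ->
  `|A - D * (h * M1 - v / (b * h) * h ^+ 2 * M2 + g)| <=
    D * (2 * eta * q) * (g + 2 * v / b * h * M2) + r ->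
  `|A| <= 4 / b * (1 + Cw) * g + 4 / b * (1 + 17 / b) * Cw * (e * (h * v) * w) + r.
Proof.
move=> b0 e0 eb h0 v0 g0 u0 D0 DW q0 DqW W0 W1 WC WCw eta0 etaU vyv vyu M1y M2b M22 M20.
have [i iE] : exists i, i = b^-1 by eexists.
have ib : b * i = 1 by rewrite iE mulfV// gt_eqF.
have i0 : 0 < i by rewrite iE invr_gt0.
have -> : h * M1 - v / (b * h) * h ^+ 2 * M2 + g = h * (M1 - v * (i * M2)) + g.
  by rewrite iE; field; rewrite !gt_eqF.
rewrite -iE in DW DqW etaU *.
have hv : 0 < h * v by rewrite mulr_gt0.
have drift : `|M1 - v * (i * M2)| <= v * (e * (1 + u + i)).
  have -> : M1 - v * (i * M2) = (M1 - vy) + (- (v - vy)) + v * i * (- (M2 - b)).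
    by transitivity (M1 - v * (i * M2) + v * (b * i - 1)); [rewrite ib subrr mulr0 addr0|ring].
  apply: le_trans (ler_normD _ _) _; apply: le_trans (lerD (ler_normD _ _) (lexx _)) _.
  rewrite normrN (ger0_norm (_ : 0 <= v - vy)); last by lra.
  rewrite [X in _ + X]normrM normrN (@ger0_norm _ (v * i)); last by rewrite mulr_ge0// ltW.
  have h1 : v * i * `|M2 - b| <= v * i * e by rewrite ler_wpM2l// mulr_ge0// ltW.
  have h2 : e * vy <= e * v by rewrite ler_wpM2l// ltW.
  by move: (`|M1 - vy|) (`|M2 - b|) M1y h1 => m1 m2 M1y h1; lra.
have e1u : 0 <= e * (1 + u + i) by rewrite mulr_ge0 ?addr_ge0// ltW.
have dr : `|D * (h * (M1 - v * (i * M2)))| <= 4 * i * (1 + i) * (e * (h * v)) * (W * (1 + u)).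
  rewrite normrM (ger0_norm D0) normrM (gtr0_norm h0).
  have s1 : h * `|M1 - v * (i * M2)| <= h * (v * (e * (1 + u + i))).
    by rewrite ler_wpM2l// ltW.
  have s2 : 0 <= h * `|M1 - v * (i * M2)| by rewrite mulr_ge0// ltW.
  apply: le_trans (ler_pM D0 s2 DW s1) _.
  have s3 : 1 + u + i <= (1 + i) * (1 + u).
    by have := mulr_ge0 (ltW i0) u0; clear; lra.
  have s4 : 0 <= 4 * i * W * (h * v * e).
    by rewrite mulr_ge0 ?mulr_ge0// ltW.
  by have := ler_wpM2l s4 s3; clear; lra.
have z1 : 2 * v * i * h * M2 <= 4 * (h * v).
  have : 2 * (h * v) * i * M2 <= 2 * (h * v) * i * (2 * b).
    by rewrite ler_wpM2l// mulr_ge0 ?mulr_ge0// ltW.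
  rewrite (_ : 2 * (h * v) * i * (2 * b) = 4 * (h * v) * (b * i)); last by ring.
  by rewrite ib mulr1; clear; lra.
have z0 : 0 <= 2 * v * i * h * M2.
  by rewrite !mulr_ge0// ltW.
have rem : D * (2 * eta * q) * (g + 2 * v * i * h * M2) <=
    16 * i * (e * i) * (W * (1 + u)) * (g + 4 * (h * v)).
  have s1 : D * (2 * eta * q) <= 16 * i * (e * i) * (W * (1 + u)).
    have t1 : D * q * (2 * eta) <= 4 * i * W * (2 * (2 * e * i * (1 + u))).
      apply: ler_pM => //; [exact: mulr_ge0|exact: mulr_ge0|].
      by move: etaU; clear; lra.
    by move: t1; clear; lra.
  have s4 : 0 <= D * (2 * eta * q) by rewrite !mulr_ge0.
  apply: ler_pM => //; first exact: addr_ge0.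
  by rewrite lerD2l.
have gD : `|D * g| <= 4 * i * g.
  rewrite ger0_norm ?mulr_ge0// ler_wpM2r//; apply: le_trans DW _.
  by rewrite ler_piMr// mulr_ge0// ltW.
move=> kp.
have -> : A = (A - D * (h * (M1 - v * (i * M2)) + g)) +
   (D * (h * (M1 - v * (i * M2))) + D * g) by ring.
apply: le_trans (ler_normD _ _) _.
have := ler_normD (D * (h * (M1 - v * (i * M2)))) (D * g).
have ei16 : 16 * (e * i) <= 1.
  by have := ler_wpM2r (ltW i0) eb; rewrite ib; lra.
move: dr gD kp rem.
move: (D * (2 * eta * q) * _) (`|D * (h * _)|) (`|D * g|) (`|_ + D * g|) (`|A - _|).
move=> a1 a2 a3 a4 a5 h2 h3 h4 h1 h5.
move=> {DW DqW etaU D0 q0 eta0 vyv vyu M1y M2b M22 M20 drift z1 z0 W1 eb e1u}.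
have iC : 0 <= e * i by rewrite mulr_ge0// ltW.
have Q0 : 0 <= W * (1 + u) by rewrite mulr_ge0// addr_ge0.
have k1 : 16 * i * (e * i) * (W * (1 + u)) * g <= i * Cw * g.
  rewrite ler_wpM2r//.
  have : 16 * (e * i) * (W * (1 + u)) <= 1 * Cw by apply: ler_pM => //; rewrite mulr_ge0.
  by move=> /(ler_wpM2l (ltW i0)); clear; lra.
have k2 : 16 * i * (e * i) * (4 * (h * v)) * (W * (1 + u)) <=
    16 * i * (e * i) * (4 * (h * v)) * (Cw * w).
  by rewrite ler_wpM2l// !mulr_ge0// ltW.
have k3 : 4 * i * (1 + i) * (e * (h * v)) * (W * (1 + u)) <=
    4 * i * (1 + i) * (e * (h * v)) * (Cw * w).
  by rewrite ler_wpM2l// !mulr_ge0 ?addr_ge0// ltW.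
have k4 : 0 <= i * Cw * g.
  by rewrite mulr_ge0// mulr_ge0 ?(ltW i0)//; exact: le_trans WC.
by move: h1 h2 h3 h4 h5 k1 k2 k3 k4; clear; lra.
Qed.

(** * The generator of the potential left of, inside and right of the window *)

Section generator.
Context {R : realType}.
Variables (K : R.-pker (measurableTypeR R) ~> (measurableTypeR R)).
Variables (S : set R) (v s p : R -> R) (b : R) (tl : nat -> R).
Hypothesis reg : regime K S v s p b tl.

Let b_gt0 := reg_b_gt0 reg.
Let v_gt0 := reg_v_gt0 reg.
Let v_le := v_le reg.

Definition accurate (e x0 : R) := [/\ 0 <= x0,
  forall y, S y -> x0 <= y -> `|trunc K s y (fun t => t ^+ 1) - v y| <= e * v y,
  forall y, S y -> x0 <= y -> `|trunc K s y (fun t => t ^+ 2) - b| <= e,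
  forall y, x0 <= y -> s y * v y <= e &
  forall x y, x0 <= x -> x <= y -> (v y)^-1 <= (v x)^-1 + e * (y - x)].

Lemma accurate_ex e : 0 < e -> exists x0, accurate e x0.
Proof.
move=> e0; have [x1 H1] := reg_moment1 reg e0; have [x2 H2] := reg_moment2 reg e0.
have [x3 H3] := reg_sv_small reg e0; have [x4 H4] := reg_inv_v reg e0.
have := ler_norm x1; have := ler_norm x2; have := ler_norm x3; have := ler_norm x4.
have := normr_ge0 x1; have := normr_ge0 x2; have := normr_ge0 x3; have := normr_ge0 x4 => *.
exists (`|x1| + `|x2| + `|x3| + `|x4|); split.
- by lra.
- by move=> y Sy xy; apply: H1 => //; lra.
- by move=> y Sy xy; apply: H2 => //; lra.
- by move=> y xy; apply: H3; lra.
- by move=> x y xx xy; apply: H4 => //; lra.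
Qed.

Lemma accurate_le e x0 x1 : accurate e x0 -> x0 <= x1 -> accurate e x1.
Proof.
move=> [a0 a1 a2 a3 a4] x01; split.
- by lra.
- by move=> y Sy xy; apply: a1 => //; lra.
- by move=> y Sy xy; apply: a2 => //; lra.
- by move=> y xy; apply: a3; lra.
- by move=> x y xx xy; apply: a4 => //; lra.
Qed.

Lemma accurate_v e x0 x y : accurate e x0 -> x0 <= x -> x <= y ->
  v x <= v y * (1 + e * (v x * (y - x))).
Proof.
move=> [x00 _ _ _ a4] x0x xy.
have vx : 0 < v x by apply: v_gt0; lra.
have vy : 0 < v y by apply: v_gt0; lra.
have := ler_wpM2l (mulr_ge0 (ltW vx) (ltW vy)) (a4 x y x0x xy).
rewrite -mulrA mulfV ?gt_eqF// mulr1 mulrDr.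
by rewrite [v x * v y]mulrC -mulrA mulfV ?gt_eqF//; lra.
Qed.

Variables (e x0 x h : R).
Hypothesis e_gt0 : 0 < e.
Hypothesis e_le4 : 4 * e <= 1.
Hypothesis e_leb : 16 * e <= b.
Hypothesis acc : accurate e x0.
Hypothesis x0x : x0 <= x.
Hypothesis h_gt0 : 0 < h.
Hypothesis hv_le : h * v x <= e.

Let G y := trunc K s y (hgain h (y - x)).
Let incr y := kop K (potential v b x h) y - potential v b x h y.
Let r y := h / v x * (p y * v y).

(** The slope is 0 and the exponential is 1, so only the gain is left, with coefficient 2 / b; 16 e
    <= b keeps the Taylor factor below 1/2, and 3 / b is rounded up. *)
Lemma generator_left y : S y -> x0 <= y -> y <= x ->
  `|incr y| <= 4 / b * G y + r y.
Proof.
move=> Sy x0y yx; have b0 := b_gt0; have e0 := e_gt0; have eb := e_leb.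
have [x00 a1 a2 a3 a4] := acc.
have x0' : 0 <= x by lra. have y0 : 0 <= y by lra.
have vx : 0 < v x by exact: v_gt0.
have ssx : s y <= s x by apply: (reg_s_incr reg); rewrite //= in_itv/= andbT.
have sx := a3 x x0x.
have G0 : 0 <= G y by apply: gain_ge0; exact: ltW.
have := kop_potential reg x0' h_gt0 Sy y0 erefl erefl.
rewrite /= -/(G y) -/(incr y) -/(r y).
have -> : hslope h (y - x) = 0 by rewrite /hslope subr_le0 yx.
rewrite huber0 ?subr_le0// mulr0 oppr0 expR0 !mulr1 expr0n/= !mulr0 !mul0r subrr add0r addr0.
set eta := 2 * v x / b * s y.
have eta8 : eta <= 8^-1.
  rewrite /eta mulrAC ler_pdivrMr//.
  have : v x * s y <= v x * s x by rewrite ler_wpM2l// ltW.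
  by lra.
have E2 : expR (2 * eta) <= 2 by apply: expR_le2; lra.
have eta0 : 0 <= eta.
  by rewrite /eta mulr_ge0 ?(ltW (reg_s_gt0 reg y0))// divr_ge0 ?mulr_ge0// ltW.
have q : 2 * eta * expR (2 * eta) <= 2^-1.
  have : 2 * eta * expR (2 * eta) <= 2 * eta * 2 by rewrite ler_wpM2l//; lra.
  by lra.
have bG : 0 <= 2 / b * G y by rewrite mulr_ge0// divr_ge0// ltW.
have := ler_wpM2r bG q.
rewrite !ler_norml => h1 /andP[h2 h3].
by apply/andP; split; lra.
Qed.

Lemma generator_inside y : S y -> x <= y -> y <= x + h ->
  `|incr y - 1| <= 2 / b * `|G y - b / 2| + 60 * e / b + r y.
Proof.
move=> Sy xy yxh; have b0 := b_gt0; have e0 := e_gt0; have eb := e_leb; have e4 := e_le4.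
have hv := hv_le; have h0 := h_gt0; have x0x' := x0x.
have [x00 a1 a2 a3 a4] := acc.
have x0' : 0 <= x by lra. have y0 : 0 <= y by lra. have x0y : x0 <= y by have := x0x; lra.
have vx : 0 < v x by exact: v_gt0. have vy : 0 < v y by exact: v_gt0.
have vyx : v y <= v x by exact: v_le.
have vxy := accurate_v acc x0x xy.
have u0 : 0 <= v x * (y - x) by rewrite mulr_ge0 ?subr_ge0// ltW.
have ue : v x * (y - x) <= e.
  apply: le_trans hv; rewrite mulrC ler_wpM2r ?(ltW vx)//; lra.
have vx2 : v x <= 2 * v y.
  apply: le_trans vxy _; rewrite mulrC ler_wpM2r ?(ltW vy)//.
  have : e * (v x * (y - x)) <= e * e by rewrite ler_wpM2l// ltW.
  have : e * e <= 1 * e by rewrite ler_wpM2r// ?ltW//; lra.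
  by lra.
have sy := a3 y x0y.
have m1h := a1 y Sy x0y; have m2h := a2 y Sy x0y.
rewrite !ler_norml in m1h m2h.
have sy0 := reg_s_gt0 reg y0.
have G0 : 0 <= G y by apply: gain_ge0; exact: ltW.
have GM := gain_le_moment K s y (y - x) (ltW h_gt0).
rewrite -/(G y) in GM.
have := kop_potential reg x0' h_gt0 Sy y0 erefl erefl.
rewrite /= -/(G y) -/(incr y) -/(r y).
set M1 := trunc K s y (fun t => t ^+ 1) in m1h *; set M2 := trunc K s y _ in GM m2h *.
move: m1h m2h => /andP[m11 m12] /andP[m21 m22].
have ev : e * v y <= 4^-1 * v y by rewrite ler_wpM2r ?(ltW vy)//; lra.
have M10 : 0 <= M1 by lra. have M1U : M1 <= 2 * v x by lra.
have M20 : 0 <= M2 by lra. have M2U : M2 <= 2 * b by lra. have Gb : G y <= b by lra.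
have yx0 : 0 <= y - x by lra. have yxh' : y - x <= h by lra. have v2s : v x * s y <= 2 * e.
  have : v x * s y <= 2 * v y * s y by rewrite ler_wpM2r// ltW.
  by lra.
have hv2 : h * (2 * v x) <= 2 * e by lra.
move=> {m11 m12 m21 m22 GM vxy u0 ue ev vyx vx2 sy vy x0y y0 x0' x00 a1 a2 a3 a4 xy yxh x0x'}.
set k := hslope h (y - x).
have /andP[k0 kh] := hslope_bounds (y - x) (ltW h_gt0); rewrite -/k in k0 kh.
set eta := 2 * v x / b * s y.
have eta4 : eta <= 4 * e / b.
  rewrite /eta mulrAC ler_pdivrMr// divfK ?gt_eqF//.
  by lra.
have eb4 : 4 * e / b <= 4^-1 by rewrite ler_pdivrMr//; lra.
have E2 : expR (2 * eta) <= 2 by apply: expR_le2; lra.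
have eta0 : 0 <= eta by rewrite /eta mulr_ge0 ?(ltW sy0)// divr_ge0 ?mulr_ge0// ltW.
set be := 2 * v x / (b * h) * huber h (y - x).
have be0 : 0 <= be.
  by rewrite /be mulr_ge0 ?huber_ge0 ?(ltW h0)// divr_ge0 ?mulr_ge0// ltW.
have bee : be <= 2 * e / b.
  have hu : huber h (y - x) <= h * h.
    apply: le_trans (huber_le_linear (ltW h0) yx0) _.
    by rewrite ler_wpM2l ?(ltW h0).
  apply: (@le_trans _ _ (2 * v x / (b * h) * (h * h))).
    by rewrite ler_wpM2l// divr_ge0 ?mulr_ge0// ltW.
  have -> : 2 * v x / (b * h) * (h * h) = 2 * (h * v x) / b by field; rewrite !gt_eqF.
  by rewrite ler_wpM2r ?invr_ge0 ?(ltW b0)//; lra.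
set E := expR (- be) .
have E1 : E <= 1 by rewrite /E expR_le1 oppr_le0.
have E1' : 1 - 2 * e / b <= E by apply: le_trans (expR_ge1Dx _); lra.
have X0 : 0 <= k * M1 by rewrite mulr_ge0.
have X1 : k * M1 <= 2 * e.
  by apply: le_trans hv2; exact: ler_pM.
have Y0 : 0 <= v x / (b * h) * k ^+ 2 * M2.
  by rewrite mulr_ge0// mulr_ge0 ?sqr_ge0// divr_ge0 ?mulr_ge0// ltW.
have Y1 : v x / (b * h) * k ^+ 2 * M2 <= 2 * e.
  apply: (@le_trans _ _ (v x / (b * h) * h ^+ 2 * (2 * b))).
    apply: ler_pM => //.
      by rewrite mulr_ge0 ?sqr_ge0// divr_ge0 ?mulr_ge0// ltW.
    rewrite ler_wpM2l ?divr_ge0 ?mulr_ge0 ?(ltW vx) ?(ltW h0) ?(ltW b0)//.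
    by rewrite lerXn2r ?nnegrE// ltW.
  have -> : v x / (b * h) * h ^+ 2 * (2 * b) = 2 * (h * v x) by field; rewrite !gt_eqF.
  by lra.
have Z0 : 0 <= 2 * v x / b * k * M2.
  by rewrite mulr_ge0// mulr_ge0// divr_ge0 ?mulr_ge0// ltW.
have Z1 : 2 * v x / b * k * M2 <= 4 * e.
  apply: (@le_trans _ _ (2 * v x / b * h * (2 * b))).
    apply: ler_pM => //.
      by rewrite mulr_ge0// divr_ge0 ?mulr_ge0// ltW.
    by rewrite ler_wpM2l// divr_ge0 ?mulr_ge0// ltW.
  have -> : 2 * v x / b * h * (2 * b) = 4 * (h * v x) by field; rewrite !gt_eqF.
  by lra.
have q0 : 0 <= 2 * eta * expR (2 * eta) by apply: mulr_ge0; [apply: mulr_ge0|exact: expR_ge0].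
have q1 : 2 * eta * expR (2 * eta) <= 16 * e / b.
  have : 2 * eta * expR (2 * eta) <= 2 * eta * 2 by rewrite ler_wpM2l// mulr_ge0.
  by lra.
move=> kp; apply: (inside_algebra b0 e0 eb G0 Gb _ E1 E1' q0 q1 X0 X1 Y0 Y1 Z0 Z1 kp).
exact: expR_ge0.
Qed.

End generator.

Section generator_right.
Context {R : realType}.
Variables (K : R.-pker (measurableTypeR R) ~> (measurableTypeR R)).
Variables (S : set R) (v s p : R -> R) (b : R) (tl : nat -> R).
Hypothesis reg : regime K S v s p b tl.

Let v_gt0 := reg_v_gt0 reg.
Let v_le := v_le reg.

Ltac clear_context := clear - reg v_gt0 v_le.

(** The truncation level s y may grow with y, so the Taylor factor exp(2 eta) may too; but v x <= v
    y (1 + e u) gives eta <= 2 e (1 + u) / b, where u = v x (y - x). Half of the decay exp(-2 u / b)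
    of the potential's slope pays for this factor, and the other half is compared with a power of 1
    + u. *)
Lemma generator_right e x0 x h y : 0 < e -> 4 * e <= 1 -> 16 * e <= b ->
  accurate K S v s b e x0 -> x0 <= x -> 0 < h -> h * v x <= e ->
  S y -> x + h <= y ->
  `|kop K (potential v b x h) y - potential v b x h y| <=
  4 / b * (1 + (1 + 4 * b) ^+ 4) * trunc K s y (hgain h (y - x)) +
  4 / b * (1 + 17 / b) * (1 + 4 * b) ^+ 4 * (e * (h * v x) * decay v x y) +
  h / v x * (p y * v y).
Proof.
move=> e0 e4 eb acc x0x h0 hv Sy xhy.
have b0 := reg_b_gt0 reg; have e1 : e <= 1 by lra.
have [x00 a1 a2 a3 a4] := acc.
have x0' : 0 <= x by lra. have y0 : 0 <= y by lra.
have x0y : x0 <= y by lra. have xy : x <= y by lra.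
have vx : 0 < v x by exact: v_gt0. have vy : 0 < v y by exact: v_gt0.
have vyx : v y <= v x by exact: v_le.
have vxy := accurate_v reg acc x0x xy.
have [u uE] : exists u, u = v x * (y - x) by eexists.
rewrite -uE in vxy.
have u0 : 0 <= u by rewrite uE mulr_ge0 ?subr_ge0// ltW.
have sy := a3 y x0y; have sy0 := reg_s_gt0 reg y0.
have m1h := a1 y Sy x0y; have m2h := a2 y Sy x0y.
have M2b : trunc K s y (fun t => t ^+ 2) <= 2 * b /\ 0 <= trunc K s y (fun t => t ^+ 2).
  by move: m2h; rewrite ler_norml => /andP[]; lra.
case: M2b => M22 M20.
have G0 : 0 <= trunc K s y (hgain h (y - x)) by apply: gain_ge0; exact: ltW.
have := kop_potential reg x0' h0 Sy y0 erefl erefl.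
rewrite /=.
have hs : hslope h (y - x) = h by apply: hslope_right; rewrite ?(ltW h0) ?lerBrDl.
have hu : huber h (y - x) = h * (y - x) - h ^+ 2 / 2
  by apply: huber_right; rewrite ?(ltW h0) ?lerBrDl.
rewrite hs hu.
have [i iE] : exists i, i = b^-1 by eexists.
have ib : b * i = 1 by rewrite iE mulfV// gt_eqF.
have i0 : 0 < i by rewrite iE invr_gt0.
have [eta etaE] : exists eta, eta = 2 * v x / b * s y by eexists.
rewrite -etaE.
have eta0 : 0 <= eta by rewrite etaE mulr_ge0 ?(ltW sy0)// divr_ge0 ?mulr_ge0// ltW.
have etaU : eta <= 2 * e / b * (1 + u).
  have h1 : v x * s y <= e * (1 + u).
    have : v x * s y <= v y * (1 + e * u) * s y by rewrite ler_wpM2r// ltW.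
    have : s y * v y * (1 + e * u) <= e * (1 + e * u).
      by rewrite ler_wpM2r// addr_ge0// mulr_ge0// ltW.
    have : e * (e * u) <= e * u.
      by rewrite ler_wpM2l ?(ltW e0)// ler_piMl// ltW.
    by clear_context; lra.
  by rewrite etaE -iE; have := ler_wpM2l (ltW i0) h1; clear_context; lra.
have beE : 2 * v x / (b * h) * (h * (y - x) - h ^+ 2 / 2) = 2 * i * u - i * (h * v x).
  by rewrite uE iE; field; rewrite !gt_eqF.
rewrite beE.
have [E EE] : exists E, E = expR (- (2 * i * u - i * (h * v x))) by eexists.
rewrite -EE.
have E0 : 0 <= E by rewrite EE expR_ge0.
have [W WE] : exists W, W = expR (- (u / b)) by eexists.
have W0 : 0 <= W by rewrite WE expR_ge0.
have ub0 : 0 <= u / b by rewrite divr_ge0// ltW.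
have W1 : W <= 1 by rewrite WE expR_le1 oppr_le0.
have P4 := expR_poly4 b0 u0.
rewrite -WE in P4.
have EqW : E * expR (2 * eta) <= 2 * W.
  rewrite EE WE -expRD.
  have -> : - (2 * i * u - i * (h * v x)) + 2 * eta =
    (2 * eta - i * u + i * (h * v x)) + - (u / b) by rewrite -iE; ring.
  rewrite expRD ler_wpM2r ?expR_ge0//; apply: expR_le2.
  have h1 := ler_wpM2l (ltW i0) hv.
  have h2 : i * (16 * e) <= 1 by have := ler_wpM2l (ltW i0) eb; move: ib; clear_context; lra.
  have h3 : i * u * (4 * e) <= i * u * 1 by rewrite ler_wpM2l// mulr_ge0// ltW.
  by move: etaU; rewrite -iE; move: h1 h2 h3; clear_context; lra.
have q1 : 1 <= expR (2 * eta) by apply: le_trans (expR_ge1Dx _); rewrite lerDl mulr_ge0.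
have EW : E <= 2 * W by apply: le_trans EqW; rewrite ler_peMr.
have u1 : 1 <= 1 + u by rewrite lerDl.
have WC : W * (1 + u) <= (1 + 4 * b) ^+ 4.
  apply: le_trans P4; rewrite mulrC ler_wpM2r//.
  by rewrite -[leLHS]expr1 ler_weXn2l.
have WCw : W * (1 + u) <= (1 + 4 * b) ^+ 4 * decay v x y.
  rewrite /decay (max_idPr _) ?subr_ge0// -uE.
  have j0 : 0 <= ((1 + u)^-1) ^+ 3 by rewrite exprn_ge0// invr_ge0 (le_trans ler01 u1).
  apply: le_trans (ler_wpM2r j0 P4); rewrite le_eqVlt; apply/orP; left; apply/eqP.
  by field; rewrite gt_eqF// (lt_le_trans ltr01 u1).
move=> kp; have D0 : 0 <= 2 / b * E by rewrite mulr_ge0// divr_ge0// ltW.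
apply: (right_algebra (D := 2 / b * E) (q := expR (2 * eta)) (u := u) (W := W)
  (eta := eta) (vy := v y) b0 e0 eb h0 vx G0 u0) kp => //.
- by rewrite -iE; have := ler_wpM2l (ltW i0) EW; clear_context; lra.
- by rewrite -iE; have := ler_wpM2l (ltW i0) EqW; clear_context; lra.
- have : v y * (e * u) <= v x * (e * u) by rewrite ler_wpM2r// mulr_ge0// ltW.
  by move: vxy; clear_context; lra.
Qed.

End generator_right.

Section naturals.
Context {R : realType}.

Lemma nat_floor (r : R) : 0 <= r -> exists j : nat, j%:R <= r < j.+1%:R.
Proof.
move=> r0; have ex : exists n : nat, r < n.+1%:R.
  exists (Num.bound r); apply: lt_le_trans (archi_boundP r0) _.
  by rewrite ler_nat.
have [j rj jmin] := ex_minnP ex; exists j; rewrite rj andbT.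
case: j rj jmin => [//|j] rj jmin; rewrite leNgt; apply/negP => rj'.
by have := jmin _ rj'; rewrite ltnn.
Qed.

Lemma nat_ceil (r : R) : 0 < r -> exists j : nat, j%:R < r <= j.+1%:R.
Proof.
move=> r0; have ex : exists n : nat, r <= n.+1%:R.
  exists (Num.bound r); apply: le_trans (ltW (archi_boundP (ltW r0))) _.
  by rewrite ler_nat.
have [j rj jmin] := ex_minnP ex; exists j; rewrite rj andbT.
case: j rj jmin => [//|j] rj jmin; rewrite ltNge; apply/negP => rj'.
by have := jmin _ rj'; rewrite ltnn.
Qed.

Lemma term_le_sum (F : nat -> R) j N : (forall k, 0 <= F k) -> (j < N)%N ->
  F j <= \sum_(0 <= k < N) F k.
Proof.
move=> F0 jN; rewrite big_mkord (bigD1 (Ordinal jN))//= lerDl.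
by apply: sumr_ge0.
Qed.

End naturals.

(** * Pointwise comparison of the generator with the indicator of the window *)

Section errors.
Context {R : realType} {d : measure_display} {T : measurableType d}.
Variable K : R.-pker (measurableTypeR R) ~> (measurableTypeR R).
Variables (S : set R) (P : probability T R) (X : nat -> {RV P >-> R}).
Variables (v s p : R -> R) (b : R) (tl : nat -> R).
Hypothesis reg : regime K S v s p b tl.
Hypothesis chainX : markov_chain S K X.

Let v_gt0 := reg_v_gt0 reg.
Let v_le := v_le reg.

Definition window x h : set (measurableTypeR R) := [set t : R | x < t <= x + h].

Lemma measurable_window x h : measurable (window x h).
Proof.
rewrite (_ : window x h = [set` `]x, x + h]]); first exact: measurable_itv.
by apply/seteqP; split => t; rewrite /window/= in_itv/=.
Qed.

Lemma window_in x h y : x < y <= x + h -> \1_(window x h) y = 1 :> R.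
Proof. by move=> H; rewrite indicE mem_set. Qed.

Lemma window_notin x h y : y <= x \/ x + h < y -> \1_(window x h) y = 0 :> R.
Proof.
move=> H; rewrite indicE memNset// /window/= => /andP[h1 h2].
by case: H => H; [move: (lt_le_trans h1 H)|move: (lt_le_trans H h2)]; rewrite ltxx.
Qed.

Lemma cell_in (x y : R) : x < y -> y <= x + 1 -> \1_(cell x) y = 1 :> R.
Proof. by move=> h1 h2; rewrite indicE mem_set// /cell/= h1. Qed.

Lemma cell_ge0 (x y : R) : 0 <= \1_(cell x) y :> R.
Proof. by rewrite indicE. Qed.

Definition C2 : R := 4 / b * (1 + 17 / b) * (1 + 4 * b) ^+ 4.
Definition C3 : R := 4 / b * (1 + (1 + 4 * b) ^+ 4).

Lemma C2_ge0 : 0 <= C2.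
Proof.
have b0 := ltW (reg_b_gt0 reg).
have i0 : 0 <= b^-1 by rewrite invr_ge0.
by rewrite /C2; apply: mulr_ge0; [apply: mulr_ge0|apply: exprn_ge0]; lra.
Qed.

Lemma C3_ge : 4 / b <= C3.
Proof.
have b0 := ltW (reg_b_gt0 reg).
have i0 : 0 <= b^-1 by rewrite invr_ge0.
rewrite /C3 ler_peMr; [by []|lra|].
by rewrite lerDl; apply: exprn_ge0; lra.
Qed.

(** Bounds the gain on the two cells j steps outside the window. For small j only the crude bound b
    is affordable; from m on, the bounds h tl(j) add up to at most e h. *)
Definition tau (h : R) (m j : nat) : R := if (j < m)%N then b else h * tl j.

Lemma tau_ge0 h m j : 0 <= h -> 0 <= tau h m j.
Proof.
move=> h0; rewrite /tau; case: ifP => _; first exact: ltW (reg_b_gt0 reg).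
by rewrite mulr_ge0// (reg_tl_ge0 reg).
Qed.

Definition outer x h m N (y : R) : R := \sum_(0 <= j < N) tau h m j *
  (\1_(cell (x - j.+1%:R)) y + \1_(cell (x + h + j%:R)) y).

Definition edges x h m (y : R) : R := \sum_(0 <= j < m)
  (\1_(cell (x + j%:R)) y + \1_(cell (x + h - j.+1%:R)) y).

Definition inner x N (y : R) : R := \sum_(0 <= j < N) \1_(cell (x + j%:R)) y.

Lemma outer_ge0 x h m N y : 0 <= h -> 0 <= outer x h m N y.
Proof.
by move=> h0; apply: sumr_ge0 => j _; rewrite mulr_ge0 ?tau_ge0// addr_ge0 ?cell_ge0.
Qed.

Lemma edges_ge0 x h m y : 0 <= edges x h m y.
Proof. by apply: sumr_ge0 => j _; rewrite addr_ge0 ?cell_ge0. Qed.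

Lemma inner_ge0 x N y : 0 <= inner x N y.
Proof. by apply: sumr_ge0 => j _; exact: cell_ge0. Qed.

Variables (e x0 x h : R) (m N Nh : nat).
Hypothesis e_gt0 : 0 < e.
Hypothesis e_le4 : 4 * e <= 1.
Hypothesis e_leb : 16 * e <= b.
Hypothesis acc : accurate K S v s b e x0.
Hypothesis x0x : x0 <= x.
Hypothesis h_gt0 : 0 < h.
Hypothesis hv_le : h * v x <= e.
Hypothesis unif : forall y, S y -> 0 <= y ->
  trunc K s y (fun t => \1_(over m) t * `|t| ^+ 2) <= e.
Hypothesis N_ge : 4 * e / v x <= N%:R.
Hypothesis Nh_ge : h <= Nh%:R.

Let G y := trunc K s y (hgain h (y - x)).
Let incr y := kop K (potential v b x h) y - potential v b x h y.

Let facts : [/\ 0 <= x0, 0 <= x, 0 < v x, 0 < b & 0 <= h].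
Proof.
have [x00 _ _ _ _] := acc; have x0' : 0 <= x by have := x0x; lra.
by split => //; [exact: v_gt0|exact: reg_b_gt0 reg|exact: ltW].
Qed.

Lemma G_le_b y : S y -> x0 <= y -> G y <= b.
Proof.
move=> Sy x0y; have [x00 _ a2 _ _] := acc; have [_ _ _ b0 h0] := facts.
have := gain_le_moment K s y (y - x) h0; have := a2 y Sy x0y.
by have eb := e_leb; have e0 := e_gt0; rewrite /G ler_norml => /andP[]; lra.
Qed.

Lemma outer_left y : S y -> x0 <= y -> y <= x -> G y <= outer x h m N y.
Proof.
move=> Sy x0y yx; have [x00 a1 a2 a3 a4] := acc; have [_ x0' vx b0 h0] := facts.
have y0 : 0 <= y by lra.
have xy0 : 0 <= x - y by lra.
have [j /andP[j1 j2]] := nat_floor xy0.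
have [jN|Nj] := ltnP j N; last first.
  rewrite /G (@gain_out _ _ _ _ _ _ (x - y))//; [exact: outer_ge0| |by left; lra].
  have ssx : s y <= s x by apply: (reg_s_incr reg); rewrite //= in_itv/= andbT.
  have := a3 x x0x => sv.
  have : s x <= e / v x by rewrite ler_pdivlMr.
  have Nj' : N%:R <= j%:R :> R by rewrite ler_nat.
  have := N_ge; have : 0 <= e / v x by rewrite divr_ge0// ltW// e_gt0.
  by lra.
have F0 k : 0 <= tau h m k * (\1_(cell (x - k.+1%:R)) y + \1_(cell (x + h + k%:R)) y).
  by rewrite mulr_ge0 ?tau_ge0// addr_ge0 ?cell_ge0.
apply: le_trans (term_le_sum F0 jN).
have j3 : j.+1%:R = j%:R + 1 :> R by rewrite -natr1.
rewrite cell_in; [|lra|lra].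
apply: (@le_trans _ _ (tau h m j)).
  rewrite /tau; case: ifP => _; first exact: G_le_b.
  by apply: (gain_tail reg) => //; left; lra.
by rewrite ler_peMr ?tau_ge0// lerDl cell_ge0.
Qed.

Lemma outer_right y : S y -> x0 <= y -> x + h < y -> G y <= outer x h m N y.
Proof.
move=> Sy x0y xhy; have [x00 a1 a2 a3 a4] := acc; have [_ x0' vx b0 h0] := facts.
have y0 : 0 <= y by lra.
have xy0 : 0 < y - x - h by lra.
have [j /andP[j1 j2]] := nat_ceil xy0.
have [jN|Nj] := ltnP j N; last first.
  rewrite /G (@gain_out _ _ _ _ _ _ (y - x - h))//; [exact: outer_ge0|lra| |by right; lra].
  have vy : 0 < v y by exact: v_gt0.
  have sv := a3 y x0y.
  (* Far to the right s y may exceed s x, but it is at most e / v y, whose growth in y has slope at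
     most e^2 <= 1/4; hence s y stays below the distance to the window. *)
  have s1 : s y <= e * (v y)^-1 by rewrite ler_pdivlMr.
  have xy : x <= y by lra.
  have e0 := e_gt0; have e4 := e_le4.
  have s2 := ler_wpM2l (ltW e0) (a4 x y x0x xy).
  have hE : h <= e * (v x)^-1 by rewrite ler_pdivlMr.
  have Nj' : N%:R <= j%:R :> R by rewrite ler_nat.
  have N' := N_ge.
  have i0 : 0 <= e * (v x)^-1 by rewrite mulr_ge0 ?invr_ge0// ltW.
  have ee : e * e <= 4^-1 by nra.
  have s3 : e * e * (y - x) <= 4^-1 * (y - x) by rewrite ler_wpM2r//; lra.
  by lra.
have F0 k : 0 <= tau h m k * (\1_(cell (x - k.+1%:R)) y + \1_(cell (x + h + k%:R)) y).
  by rewrite mulr_ge0 ?tau_ge0// addr_ge0 ?cell_ge0.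
apply: le_trans (term_le_sum F0 jN).
have j3 : j.+1%:R = j%:R + 1 :> R by rewrite -natr1.
rewrite [\1_(cell (x + h + _)) _]cell_in; [|lra|lra].
apply: (@le_trans _ _ (tau h m j)).
  rewrite /tau; case: ifP => _; first exact: G_le_b.
  by apply: (gain_tail reg) => //; right; lra.
by rewrite ler_peMr ?tau_ge0// lerDr cell_ge0.
Qed.

(* In order: jumps larger than s, jumps over x from below x0, drift to the right
   of the window, cells outside the window (within N of it), cells near its two
   ends, cells inside it. *)
Definition error y : R :=
  h / v x * (\1_(from x0) y * (p y * v y)) + h / v x * upcross K x0 x y +
  C2 * (e * (h * v x)) * (\1_(from x) y * decay v x y) +
  C3 * outer x h m N y + 6 * edges x h m y + 64 * e / b * inner x Nh y.

Lemma generator_error y : S y -> `|incr y - \1_(window x h) y| <= error y.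
Proof.
move=> Sy; have [x00 x0' vx b0 h0] := facts; have e0 := e_gt0.
have e4 := e_le4; have eb := e_leb; have xx := x0x.
have c0 : 0 <= h / v x by rewrite divr_ge0// ltW.
have t1 : 0 <= h / v x * (\1_(from x0) y * (p y * v y)).
  by rewrite mulr_ge0//; exact: (from_rho_ge0 reg).
have t2 : 0 <= h / v x * upcross K x0 x y by rewrite mulr_ge0// upcross_ge0.
have t3 : 0 <= C2 * (e * (h * v x)) * (\1_(from x) y * decay v x y).
  have /andP[d0 _] := decay_bounds reg y x0'.
  have hv0 : 0 <= e * (h * v x) by rewrite mulr_ge0 ?mulr_ge0// ltW.
  apply: mulr_ge0; first by apply: mulr_ge0 => //; exact: C2_ge0.
  by apply: mulr_ge0 => //; rewrite indicE.
have C30 : 0 <= C3 by apply: le_trans C3_ge; rewrite divr_ge0// ltW.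
have t4 : 0 <= C3 * outer x h m N y by rewrite mulr_ge0// outer_ge0.
have t5 := edges_ge0 x h m y.
have eb0 : 0 <= 64 * e / b by rewrite divr_ge0 ?mulr_ge0// ltW.
have t6 : 0 <= 64 * e / b * inner x Nh y by rewrite mulr_ge0// inner_ge0.
have [x0y|yx0] := leP x0 y; last first.
  have yx : y <= x by lra.
  have pot0 : potential v b x h y = 0 by exact: potential0.
  rewrite window_notin ?subr0; last by left.
  rewrite /incr pot0 subr0 ger0_norm; last first.
    by apply: kop_ge0 => z; have /andP[] := potential_bounds reg z x0' h_gt0.
  have ba := bmf_above_set x.
  have : kop K (potential v b x h) y <= h / v x * kop K \1_(above x) y.
    rewrite -(kopZ K _ y ba); apply: le_kop.
    - exact: (bmf_potential reg).
    - exact: (bmfZ _ ba).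
    - move=> z; have [xz|zx] := ltP x z.
      by rewrite above_in// mulr1; have /andP[] := potential_bounds reg z x0' h_gt0.
    by rewrite above_notin// mulr0 (potential0 _ _ _ zx).
  rewrite /error (upcrossE K x0 x y) (leNgt x0 y) yx0/=.
  by move: t2; rewrite (upcrossE K x0 x y) (leNgt x0 y) yx0/=; lra.
rewrite /error from1// mul1r; rewrite from1// mul1r in t1.
have G0 : 0 <= G y by apply: gain_ge0.
have c34 := C3_ge.
have [yx|xy] := leP y x.
  rewrite window_notin ?subr0; last by left.
  have := generator_left reg e0 eb acc xx h_gt0 Sy x0y yx.
  have := ler_pM (_ : 0 <= 4 / b) G0 c34 (outer_left Sy x0y yx).
  rewrite divr_ge0 ?(ltW b0)// -/(G y) -/(incr y) => /(_ isT).
  by lra.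
have [yxh|xhy] := leP y (x + h); last first.
  rewrite window_notin ?subr0; last by right.
  have := generator_right reg e0 e4 eb acc xx h_gt0 hv_le Sy (ltW xhy).
  rewrite -/(G y) -/(incr y) -/C2 -/C3.
  have := ler_wpM2l C30 (outer_right Sy x0y xhy).
  rewrite from1 ?(ltW xy)// mul1r; rewrite from1 ?(ltW xy)// mul1r in t3.
  by lra.
rewrite window_in ?xy//.
have := generator_inside reg e0 e4 eb acc xx h_gt0 hv_le Sy (ltW xy) yxh.
rewrite -/(G y) -/(incr y) => H.
have Gb := G_le_b Sy x0y.
suff : `|incr y - 1| <= h / v x * (p y * v y) + 6 * edges x h m y +
    64 * e / b * inner x Nh y by lra.
move=> {t2 t3 t4 C30 c34 c0}.
(* Near an end of the window the gain is known only to lie in [0, b]: apart from large jumps the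
   error is at most 1 + 4, which the weight 6 covers. *)
have edge : (exists j, (j < m)%N /\ (\1_(cell (x + j%:R)) y = 1 :> R \/
    \1_(cell (x + h - j.+1%:R)) y = 1 :> R)) ->
    `|incr y - 1| <= h / v x * (p y * v y) + 6 * edges x h m y + 64 * e / b * inner x Nh y.
  move=> [j [jm Hj]].
  have h1 : 1 <= edges x h m y.
    have F0 k : 0 <= \1_(cell (x + k%:R)) y + \1_(cell (x + h - k.+1%:R)) y :> R.
      by rewrite addr_ge0 ?cell_ge0.
    apply: le_trans (term_le_sum F0 jm).
    by case: Hj => ->; rewrite ?lerDl ?lerDr cell_ge0.
  have h2 : `|G y - b / 2| <= b / 2 by rewrite ler_norml; lra.
  have h3 : 2 / b * `|G y - b / 2| <= 1.
    apply: (@le_trans _ _ (2 / b * (b / 2))).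
      by rewrite ler_wpM2l// divr_ge0// ltW.
    by rewrite (_ : 2 / b * (b / 2) = 1)//; field; rewrite gt_eqF.
  have h4 : 60 * e / b <= 4 by rewrite ler_pdivrMr//; lra.
  by lra.
have yx0 : 0 < y - x by rewrite subr_gt0.
have [ym|my] := ltP (y - x) m%:R.
  have [j /andP[j1 j2]] := nat_ceil yx0.
  rewrite ltrBrDl in j1; rewrite lerBlDl -natr1 addrA in j2.
  move=> {H t1 t6}; apply: edge; exists j; split; last by left; exact: cell_in.
  by rewrite -(ltr_nat R); lra.
have [ym|my'] := ltP (x + h - y) m%:R.
  have yh0 : 0 <= x + h - y by rewrite subr_ge0.
  have [j /andP[j1 j2]] := nat_floor yh0.
  move=> {H t1 t6}; apply: edge; exists j; split.
    by rewrite -(ltr_nat R); lra.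
  by right; apply: cell_in; rewrite -natr1; move: j1 j2; lra.
move=> {edge}; have [_ _ a2 _ _] := acc.
have y0 : 0 <= y by exact: le_trans x00 x0y.
(* Half of [e] comes from jumps longer than m, half from the second moment. *)
have h1 : `|G y - b / 2| <= e.
  have yxm : y - x <= h - m%:R by lra.
  have g1 := gain_mid K s y h0 my yxm.
  have := unif Sy y0; have := a2 y Sy x0y; rewrite -/(G y) in g1.
  move: g1 => {H t1 t6}; rewrite !ler_norml => /andP[? ?] /andP[? ?] ?.
  by apply/andP; split; lra.
have h2 : 2 / b * `|G y - b / 2| <= 2 / b * e by rewrite ler_wpM2l// divr_ge0// ltW.
have [j /andP[j1 j2]] := nat_ceil yx0.
have h3 : 1 <= inner x Nh y.
  rewrite ltrBrDl in j1; rewrite lerBlDl -natr1 addrA in j2.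
  have F0 k : 0 <= \1_(cell (x + k%:R)) y :> R by exact: cell_ge0.
  have jN : (j < Nh)%N.
    by move: Nh_ge; rewrite -(ltr_nat R) => {H t1 t6 h1 h2}; lra.
  by apply: le_trans (term_le_sum F0 jN); rewrite cell_in.
have := ler_wpM2l eb0 h3.
by move=> {j1 j2 my my'}; lra.
Qed.

End errors.

(** * The renewal measure of a window *)

Section core.
Context {R : realType} {d : measure_display} {T : measurableType d}.
Variable K : R.-pker (measurableTypeR R) ~> (measurableTypeR R).
Variables (S : set R) (P : probability T R) (X : nat -> {RV P >-> R}).
Variables (v s p : R -> R) (b : R) (tl : nat -> R).
Hypothesis reg : regime K S v s p b tl.
Hypothesis chainX : markov_chain S K X.

Let v_gt0 := reg_v_gt0 reg.
Let v_le := v_le reg.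

Let bcell x : bmf (\1_(cell x) : measurableTypeR R -> R).
Proof. by apply: bmf_indic; exact: measurable_cell. Qed.

Lemma sum_tau h (m N : nat) (e : R) : 0 <= h ->
  (forall n, \sum_(m <= j < n) tl j <= e) -> 0 <= e ->
  \sum_(0 <= j < N) tau b tl h m j <= m%:R * b + h * e.
Proof.
move=> h0 He e0; have b0 := ltW (reg_b_gt0 reg).
have he : 0 <= h * e by rewrite mulr_ge0.
have small n : (n <= m)%N -> \sum_(0 <= j < n) tau b tl h m j <= m%:R * b.
  move=> nm; apply: (@le_trans _ _ (\sum_(0 <= j < n) b)).
    by apply: ler_sum_nat => j /andP[_ jn]; rewrite /tau (leq_trans jn nm).
  rewrite sumr_const_nat subn0 -[b *+ n]mulr_natl.
  by rewrite ler_wpM2r// ler_nat.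
have [Nm|mN] := leqP N m; first by have := small N Nm; lra.
rewrite (@big_cat_nat _ _ _ m)//=; last exact: ltnW.
apply: lerD; first exact: small.
apply: (@le_trans _ _ (h * \sum_(m <= j < N) tl j)).
  rewrite mulr_sumr; apply: ler_sum_nat => j /andP[mj _].
  by rewrite /tau ltnNge mj.
by rewrite ler_wpM2l.
Qed.

Section sums.
Variables (x h B : R) (n : nat).

Lemma green_outer (m N : nat) : 0 <= h -> 0 <= B ->
  (forall j, (j < N)%N -> green X n \1_(cell (x - j.+1%:R)) <= B /\
    green X n \1_(cell (x + h + j%:R)) <= B) ->
  green X n (outer b tl x h m N) <= (2 * B) * \sum_(0 <= j < N) tau b tl h m j.
Proof.
move=> h0 B0 H; rewrite /outer green_sum; last first.
  by move=> j; apply: bmfZ; exact: bmfD.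
rewrite mulr_sumr; apply: ler_sum_nat => j /andP[_ jN].
rewrite greenZ; last exact: bmfD.
rewrite greenD// mulrC ler_wpM2r ?(tau_ge0 reg)//.
by have [h1 h2] := H j jN; lra.
Qed.

Lemma green_edges (m : nat) : (forall j, (j < m)%N ->
    green X n \1_(cell (x + j%:R)) <= B /\ green X n \1_(cell (x + h - j.+1%:R)) <= B) ->
  green X n (edges x h m) <= (2 * B) * m%:R.
Proof.
move=> H; rewrite /edges green_sum; last by move=> j; exact: bmfD.
apply: (@le_trans _ _ (\sum_(0 <= j < m) (2 * B))).
  apply: ler_sum_nat => j /andP[_ jN]; rewrite greenD//.
  by have [h1 h2] := H j jN; lra.
by rewrite sumr_const_nat subn0 mulr_natr.
Qed.

Lemma green_inner (N : nat) : (forall j, (j < N)%N ->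
    green X n \1_(cell (x + j%:R)) <= B) ->
  green X n (inner x N) <= B * N%:R.
Proof.
move=> H; rewrite /inner green_sum//.
apply: (@le_trans _ _ (\sum_(0 <= j < N) B)).
  by apply: ler_sum_nat => j /andP[_ jN]; exact: H.
by rewrite sumr_const_nat subn0 mulr_natr.
Qed.

End sums.

(** Up to x + h + N the distance from x is O(e / v x), so v falls by a factor of at most 4 and one
    bound serves all cells involved. *)
Lemma cell_bound Cl xl e x0 x h N z n : 0 < Cl ->
  (forall x n, xl <= x -> green X n \1_(cell x) <= Cl / v x) ->
  0 < e -> 4 * e <= 1 -> accurate K S v s b e x0 -> x0 <= x ->
  h * v x <= e -> N * v x <= 5 * e -> 0 <= x - N -> xl <= x - N ->
  x - N <= z -> z <= x + h + N ->
  green X n \1_(cell z) <= 4 * Cl / v x.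
Proof.
move=> Cl0 HCl e0 e4 acc x0x hv Nv xN0 xlN zl zr.
have [x00 _ _ _ _] := acc; have x0' : 0 <= x by lra.
have vx : 0 < v x by exact: v_gt0.
have z0 : 0 <= z by lra.
have zx : xl <= z by lra.
have vz : 0 < v z by exact: v_gt0.
apply: le_trans (HCl z n zx) _.
rewrite ler_pdivrMr// mulrAC ler_pdivlMr//.
suff h4 : v x <= 4 * v z by have := ler_wpM2l (ltW Cl0) h4; lra.
have [zx'|xz] := leP z x; first by have := v_le z0 zx'; lra.
have vxz := accurate_v reg acc x0x (ltW xz).
have u3 : v x * (z - x) <= 3.
  by have := ler_wpM2l (ltW vx) zr; lra.
have eu : e * (v x * (z - x)) <= e * 3 by rewrite ler_wpM2l// ltW.
have : v z * (1 + e * (v x * (z - x))) <= v z * 4 by rewrite ler_pM2l//; lra.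
by lra.
Qed.

(** One summand per term of [green_errorE], in that order, the first two giving 2. The factor 8 is
    twice the 4 of [cell_bound]: two cells per index, or Nh <= 2 h. *)
Definition err_const (Cl Cd : R) : R :=
  2 + C2 b * Cd + 8 * (C3 b * Cl * (b + 1)) + 8 * (6 * Cl) + 8 * (64 * Cl) / b.

Lemma err_const_gt0 Cl Cd : 0 < Cl -> 0 < Cd -> 0 < err_const Cl Cd.
Proof.
move=> Cl0 Cd0; have b0 := reg_b_gt0 reg; have c2 := C2_ge0 reg.
have c3 : 0 <= C3 b by apply: le_trans (C3_ge reg); rewrite divr_ge0// ltW.
have h1 : 0 <= C2 b * Cd by rewrite mulr_ge0// ltW.
have h2 : 0 <= C3 b * Cl * (b + 1).
  by apply: mulr_ge0; [apply: mulr_ge0 => //; exact: ltW|lra].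
have h3 : 0 <= Cl / b by rewrite divr_ge0// ltW.
by rewrite /err_const; lra.
Qed.

Section total_error.
Variables (e x0 x h : R) (m N Nh n : nat).

Lemma bmf_error : 0 <= x0 -> 0 <= x ->
  bmf (error K v p b tl e x0 x h m N Nh : measurableTypeR R -> R).
Proof.
move=> x00 x0'; rewrite /error.
have b1 := bmfZ (h / v x) (bmf_rho reg x00).
have b2 := bmfZ (h / v x) (bmf_upcross K x0 x).
have b3 := bmfZ (C2 b * (e * (h * v x))) (bmf_decay reg x0').
have b4 : bmf (fun y : measurableTypeR R => C3 b * outer b tl x h m N y).
  by apply/bmfZ/bmf_sum => k _; apply: bmfZ; exact: bmfD.
have b5 : bmf (fun y : measurableTypeR R => 6 * edges x h m y).
  by apply/bmfZ/bmf_sum => k _; exact: bmfD.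
have b6 : bmf (fun y : measurableTypeR R => 64 * e / b * inner x Nh y).
  by apply/bmfZ/bmf_sum.
exact: (bmfD (bmfD (bmfD (bmfD (bmfD b1 b2) b3) b4) b5) b6).
Qed.

Lemma green_errorE : 0 <= x0 -> 0 <= x ->
  green X n (error K v p b tl e x0 x h m N Nh) =
  h / v x * big_jumps X v p x0 n + h / v x * green X n (upcross K x0 x) +
  C2 b * (e * (h * v x)) * green X n (fun y => \1_(from x) y * decay v x y) +
  C3 b * green X n (outer b tl x h m N) + 6 * green X n (edges x h m) +
  64 * e / b * green X n (inner x Nh).
Proof.
move=> x00 x0'.
have bup : bmf (upcross K x0 x : measurableTypeR R -> R) by exact: bmf_upcross.
have brho := bmf_rho reg x00.
have bdec := bmf_decay reg x0'.
have bout : bmf (outer b tl x h m N : measurableTypeR R -> R).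
  by apply: bmf_sum => k _; apply: bmfZ; exact: bmfD.
have bedg : bmf (edges x h m : measurableTypeR R -> R).
  by apply: bmf_sum => k _; exact: bmfD.
have binn : bmf (inner x Nh : measurableTypeR R -> R) by exact: bmf_sum.
have e1 := bmfD (bmfZ (h / v x) brho) (bmfZ (h / v x) bup).
have e2 := bmfD e1 (bmfZ (C2 b * (e * (h * v x))) bdec).
have e3 := bmfD e2 (bmfZ (C3 b) bout).
have e5 := bmfD e3 (bmfZ 6 bedg).
rewrite /error.
have -> := greenD X n e5 (bmfZ (64 * e / b) binn).
have -> := greenD X n e3 (bmfZ 6 bedg).
have -> := greenD X n e2 (bmfZ (C3 b) bout).
have -> := greenD X n e1 (bmfZ (C2 b * (e * (h * v x))) bdec).
have -> := greenD X n (bmfZ (h / v x) brho) (bmfZ (h / v x) bup).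
by rewrite !greenZ.
Qed.

Ltac clear_context := clear - reg chainX bcell v_le v_gt0 e x0 x h m N Nh n.

Lemma green_error_le Cl Cd : 0 < Cl -> 0 < Cd -> 0 < e -> 0 <= x0 -> 0 <= x -> 0 < h ->
  big_jumps X v p x0 n <= e -> green X n (upcross K x0 x) <= e ->
  green X n (fun y => \1_(from x) y * decay v x y) <= Cd / v x ^+ 2 ->
  (forall z, x - N%:R <= z -> z <= x + h + N%:R ->
    green X n \1_(cell z) <= 4 * Cl / v x) ->
  (forall n, \sum_(m <= j < n) tl j <= e) ->
  m%:R <= h -> m%:R <= e * h -> Nh%:R <= h + 1 -> 1 <= h -> (0 < N)%N ->
  green X n (error K v p b tl e x0 x h m N Nh) <= err_const Cl Cd * e * (h / v x).
Proof.
move=> Cl0 Cd0 e0 x00 x0' h0 J U Dd cellB Ht mh' mh Nhh h1 N0.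
have b0 := reg_b_gt0 reg; have c2 := C2_ge0 reg.
have c3 : 0 <= C3 b by apply: le_trans (C3_ge reg); rewrite divr_ge0// ltW.
have vx : 0 < v x by exact: v_gt0.
have N1 : 1 <= N%:R :> R by rewrite ler1n.
have B0 : 0 <= 4 * Cl / v x by rewrite divr_ge0 ?mulr_ge0// ltW.
rewrite green_errorE//.
have O : green X n (outer b tl x h m N) <= 2 * (4 * Cl / v x) * (m%:R * b + h * e).
  apply: le_trans (green_outer m (ltW h0) B0 _) _; last first.
    apply: ler_wpM2l; first by rewrite mulr_ge0.
    exact: (sum_tau N (ltW h0) Ht (ltW e0)).
  move=> k kN; have kN' : k.+1%:R <= N%:R :> R by rewrite ler_nat.
  have k1 : k.+1%:R = k%:R + 1 :> R by rewrite -natr1.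
  have k0 : 0 <= k%:R :> R by rewrite ler0n.
  by split; apply: cellB; lra.
have Eg : green X n (edges x h m) <= 2 * (4 * Cl / v x) * m%:R.
  apply: green_edges => k km; have km' : k.+1%:R <= m%:R :> R by rewrite ler_nat.
  have k1 : k.+1%:R = k%:R + 1 :> R by rewrite -natr1.
  have k0 : 0 <= k%:R :> R by rewrite ler0n.
  by split; apply: cellB; lra.
have In : green X n (inner x Nh) <= 4 * Cl / v x * Nh%:R.
  apply: green_inner => k kN; have kN' : k.+1%:R <= Nh%:R :> R by rewrite ler_nat.
  have k1 : k.+1%:R = k%:R + 1 :> R by rewrite -natr1.
  have k0 : 0 <= k%:R :> R by rewrite ler0n.
  by apply: cellB; lra.
move=> {cellB Ht}.
have [w wE] : exists w, w = (v x)^-1 by eexists.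
have w0 : 0 < w by rewrite wE invr_gt0.
have vw : v x * w = 1 by rewrite wE mulfV// gt_eqF.
rewrite -wE in O Eg In B0 *.
have hw0 : 0 <= h * w by rewrite mulr_ge0// ltW.
have T1 := ler_wpM2l hw0 J; have T2 := ler_wpM2l hw0 U.
have T3 : C2 b * (e * (h * v x)) * green X n (fun y => \1_(from x) y * decay v x y) <=
    C2 b * Cd * e * (h * w).
  have q0 : 0 <= C2 b * (e * (h * v x)).
    by apply: mulr_ge0 => //; apply: mulr_ge0; [exact: ltW|rewrite mulr_ge0// ltW].
  apply: le_trans (ler_wpM2l q0 Dd) _.
  rewrite le_eqVlt; apply/orP; left; apply/eqP.
  by rewrite wE; field; rewrite gt_eqF.
have mb : m%:R * b + h * e <= e * h * (b + 1).
  by have := ler_wpM2r (ltW b0) mh; clear_context; lra.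
have B20 : 0 <= 2 * (4 * Cl * w) by rewrite mulr_ge0.
have T4 : C3 b * green X n (outer b tl x h m N) <=
    8 * (C3 b * Cl * (b + 1)) * e * (h * w).
  by have := ler_wpM2l c3 (le_trans O (ler_wpM2l B20 mb)); clear_context; lra.
have T5 : 6 * green X n (edges x h m) <= 8 * (6 * Cl) * e * (h * w).
  by have := le_trans Eg (ler_wpM2l B20 mh); clear_context; lra.
have Nh2 : Nh%:R <= 2 * h by lra.
have T6 : 64 * e / b * green X n (inner x Nh) <= 8 * (64 * Cl) / b * e * (h * w).
  have q0 : 0 <= 64 * e / b by rewrite divr_ge0 ?mulr_ge0// ltW.
  by have := ler_wpM2l q0 (le_trans In (ler_wpM2l B0 Nh2)); clear_context; lra.
move: T1 T2 T3 T4 T5 T6; rewrite /err_const.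
move: (h * w * big_jumps _ _ _ _ _) (h * w * green _ _ _) (C2 b * _ * green _ _ _)
  (C3 b * green _ _ _) (6 * green _ _ _) (64 * e / b * green _ _ _).
by clear_context => g1 g2 g3 g4 g5 g6 T1 T2 T3 T4 T5 T6; lra.
Qed.

End total_error.

Lemma unif_int_le (m1 m : nat) y : (m1 <= m)%N ->
  trunc K s y (fun t => \1_(over m) t * `|t| ^+ 2) <=
  trunc K s y (fun t => \1_(over m1) t * `|t| ^+ 2).
Proof.
move=> m1m; have tb k : tbm (s y) (fun t => \1_(over k) t * `|t| ^+ 2).
  have bo : bmf (\1_(over k) : measurableTypeR R -> R).
    by apply: bmf_indic; exact: measurable_over.
  apply: eq_bmf (bmfM (tbm_pow (s y) 2) bo) => t.
  by rewrite -normrX ger0_norm ?sqr_ge0// -mulrA [X in _ * X]mulrC.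
apply: le_trunc => // t _; rewrite ler_wpM2r ?exprn_ge0// !indicE.
case: (boolP (t \in over m)) => [|_]; last by rewrite ler0n.
rewrite inE /over/= => mt; rewrite mem_set//=; apply: le_lt_trans mt.
by rewrite ler_nat.
Qed.

Ltac clear_context := clear - reg chainX bcell v_le v_gt0.

(** Of order h cells are involved, each with Green function O(1 / v x). The error is not small on
    the m cells at each end, but m is fixed before h, so m <= e h for large h; inside the window
    each cell carries O(e), and outside it the gains add up to O(e h). *)
Lemma renewal_error : exists C1 : R, 0 < C1 /\
  forall e, 0 < e -> 4 * e <= 1 -> 16 * e <= b ->
  exists x1, forall x h n, x1 <= x -> x1 <= h -> h * v x <= e ->
  [/\ 0 <= x, 0 < h &
  `|green X n \1_(window x h) -
    (expect X n (potential v b x h) - expect X 0 (potential v b x h))| <=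
    C1 * e * (h / v x)].
Proof.
have b0 := reg_b_gt0 reg.
have [Cl [xl [Cl0 HCl]]] := local_bound reg chainX.
have [Cd [xd [Cd0 HCd]]] := decay_bound reg chainX.
exists (err_const Cl Cd); split => [|e e0 e4 eb]; first exact: err_const_gt0.
have [xs [sx jx]] := start_small reg chainX e0.
have [xa acc] := accurate_ex reg e0.
have [m1 Hm1] := reg_unif_int reg e0.
have [m2 Hm2] := reg_tl_sum reg e0.
pose m := maxn m1 m2.
have Hu y : S y -> 0 <= y -> trunc K s y (fun t => \1_(over m) t * `|t| ^+ 2) <= e.
  by move=> Sy y0; apply: le_trans (Hm1 y Sy y0); apply: unif_int_le; exact: leq_maxl.
have Ht n : \sum_(m <= j < n) tl j <= e by apply: Hm2; rewrite leq_maxr.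
have [xl1 Hl1] := level_ex reg chainX.
have [x0 [xsx0 xax0 xl1x0]] : exists x0, [/\ xs <= x0, xa <= x0 & xl1 <= x0].
  by exists (Num.max xs (Num.max xa xl1)); rewrite !le_max !lexx ?orbT.
have acc0 := accurate_le acc xax0.
have lev0 := level_le Hl1 xl1x0.
have [xu Hu'] := upcross_small reg chainX lev0 e0.
have [xv Hxv] := reg_v_small reg e0.
have [xy Hxy] := reg_yv_large reg (8 * e).
have x00 : 0 <= x0 by case: acc0.
move: acc0 lev0 Hu' Hxv Hxy xsx0 => acc0 lev0 Hu' Hxv Hxy xsx0.
(* The sum of absolute values exceeds every entry and bounds x and h alike. The entries [xy],
   [2 * xl + 4] and 8 keep x - N above [xl] and 0; [m%:R / e] gives m <= e h. *)
exists (\sum_(q <- [:: x0; xu; xv; xy; xd; 2 * xl + 4; 8; m%:R; m%:R / e]) `|q|).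
move=> x h n xx hh hv.
have big q : q \in [:: x0; xu; xv; xy; xd; 2 * xl + 4; 8; m%:R; m%:R / e] -> q <= x /\ q <= h.
  move=> qin; suff : `|q| <= \sum_(q <- [:: x0; xu; xv; xy; xd; 2 * xl + 4; 8; m%:R; m%:R / e]) `|q|.
    have := ler_norm q; move: (bigop _ _ _) xx hh; clear_context => *; split; lra.
  by rewrite (big_rem q)//= lerDl sumr_ge0.
have [x0x _] : x0 <= x /\ x0 <= h by apply: big; rewrite !inE eqxx ?orbT.
have [xux _] : xu <= x /\ xu <= h by apply: big; rewrite !inE eqxx ?orbT.
have [xvx _] : xv <= x /\ xv <= h by apply: big; rewrite !inE eqxx ?orbT.
have [xyx _] : xy <= x /\ xy <= h by apply: big; rewrite !inE eqxx ?orbT.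
have [xdx _] : xd <= x /\ xd <= h by apply: big; rewrite !inE eqxx ?orbT.
have [xlx _] : (2 * xl + 4) <= x /\ (2 * xl + 4) <= h by apply: big; rewrite !inE eqxx ?orbT.
have [x8 h8] : 8 <= x /\ 8 <= h by apply: big; rewrite !inE eqxx ?orbT.
have [_ mh'] : m%:R <= x /\ m%:R <= h by apply: big; rewrite !inE eqxx ?orbT.
have [_ mh] : (m%:R / e) <= x /\ (m%:R / e) <= h by apply: big; rewrite !inE eqxx ?orbT.
move: mh; rewrite ler_pdivrMr// mulrC => mh.
move=> {big xx hh}.
have x0' : 0 <= x by exact: le_trans x0x.
have h0 : 0 < h by move: h8; clear_context; lra.
split => //.
have vx : 0 < v x by exact: v_gt0.
have ve := Hxv x xvx; have xvx' := Hxy x xyx.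
have r0 : 0 <= 4 * e / v x by rewrite divr_ge0 ?mulr_ge0// ltW.
(* N = j + 1 exceeds 4 e / v x by at most 1, and v x <= e turns this into N v x <= 5 e. *)
have [j /andP[j1 j2]] := nat_floor r0.
have [j' /andP[j1' j2']] := nat_ceil h0.
have NE : j.+1%:R = j%:R + 1 :> R by rewrite -natr1.
have NhE : j'.+1%:R = j'%:R + 1 :> R by rewrite -natr1.
have NV : j.+1%:R * v x <= 5 * e.
  move: j1; rewrite ler_pdivlMr// NE mulrDl mul1r => j1.
  by move: j1 ve; clear_context; lra.
have Nx : j.+1%:R <= x / 2 + 1.
  have : 4 * e / v x <= x / 2.
    by rewrite ler_pdivrMr//; move: xvx'; clear_context; lra.
  by rewrite NE; move: j1; clear_context; lra.
have xN0 : 0 <= x - j.+1%:R by move: Nx x8; clear_context; lra.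
have xlN : xl <= x - j.+1%:R by move: Nx x8 xlx; clear_context; lra.
have gen y (Sy : S y) := generator_error reg e0 e4 eb acc0 x0x h0 hv Hu (ltW j2) j2' Sy.
have ger : green X n (error K v p b tl e x0 x h m j.+1 j'.+1) <=
    err_const Cl Cd * e * (h / v x).
  apply: green_error_le => //.
  - exact: jx.
  - exact: Hu'.
  - exact: HCd.
  - move=> z zl zr; apply: (cell_bound n Cl0 HCl e0 e4 acc0 x0x hv NV xN0 xlN zl zr).
  - by rewrite NhE; move: j1'; clear_context; lra.
  - by move: h8; clear_context; lra.
have bpot := bmf_potential reg x0' h0.
have be := bmf_error e h m j.+1 j'.+1 x00 x0'.
have bwin : bmf (\1_(window x h) : measurableTypeR R -> R).
  by apply: bmf_indic; exact: measurable_window.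
have bin : bmf (fun y => kop K (potential v b x h) y - potential v b x h y).
  by apply: bmfB => //; exact: bmf_kop.
rewrite -(green_kop chainX n bpot) -greenB//.
rewrite ler_norml; apply/andP; split.
  apply: le_trans (_ : - green X n (error K v p b tl e x0 x h m j.+1 j'.+1) <= _).
    by rewrite lerN2.
  rewrite -mulN1r -greenZ//; apply: (le_green chainX); [exact: bmfZ|exact: bmfB|].
  move=> y Sy; rewrite mulN1r; have := gen y Sy; rewrite ler_norml => /andP[].
  by clear_context; lra.
apply: le_trans ger; apply: (le_green chainX); [exact: bmfB|by []|].
move=> y Sy; have := gen y Sy; rewrite ler_norml => /andP[].
by clear_context; lra.
Qed.

End core.

(** * Passage to the limit in n *)

Section limit.
Context {R : realType} {d : measure_display} {T : measurableType d}.
Variable K : R.-pker (measurableTypeR R) ~> (measurableTypeR R).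
Variables (S : set R) (P : probability T R) (X : nat -> {RV P >-> R}).
Variables (v s p : R -> R) (b : R) (tl : nat -> R).
Hypothesis reg : regime K S v s p b tl.
Hypothesis chainX : markov_chain S K X.
Hypothesis limsupX : {ae P, forall w, limn_esup (fun n => (X n w)%:E) = +oo%E}.

Let v_gt0 := reg_v_gt0 reg.

Lemma potential_large x h e : 0 <= x -> 0 < h -> 0 < e ->
  exists r, forall y, r <= y -> (1 - e) * (h / v x) <= potential v b x h y.
Proof.
move=> x0 h0 e0; have vx := v_gt0 x0; have b0 := reg_b_gt0 reg.
have [be beE] : exists be, be = 2 * v x / (b * h) by eexists.
have be0 : 0 < be by rewrite beE divr_gt0 ?mulr_gt0.
have bh0 : 0 < be * h * e by rewrite !mulr_gt0.
exists (x + h + (be * h * e)^-1) => y ry.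
have c0 : 0 < h / v x by rewrite divr_gt0.
rewrite /potential [leLHS]mulrC ler_pM2l// -beE lerD2l lerN2.
rewrite expRN -[leRHS]invrK lef_pV2 ?posrE ?invr_gt0 ?expR_gt0//.
apply: le_trans (expR_ge1Dx _).
have hu := huber_ge_linear (y - x) (ltW h0).
have h1 : h * (be * h * e)^-1 <= huber h (y - x).
  have := ler_wpM2l (ltW h0) ry; have := mulr_gt0 h0 h0; lra.
have := ler_wpM2l (ltW be0) h1.
have -> : be * (h * (be * h * e)^-1) = e^-1 by field; rewrite !gt_eqF.
by lra.
Qed.

Ltac clear_context := clear - reg chainX limsupX v_gt0.

(** The potential lies in [0, h / v x], so its mean increment is at most h / v x for every n, which
    also makes the renewal measure finite. From below a single time [N] suffices, at which the chain
    is above [q] with probability near 1. The initial mean is small because the fixed law of X 0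
    puts little mass above x. *)
Lemma renewal_ratio e : 0 < e -> exists2 x1, 0 < x1 & forall x h, x1 <= x -> x1 <= h ->
  h * v x <= x1^-1 ->
  exists2 r, renewal_measure X (window x h) = r%:E & `|r / (h / v x) - 1| <= e.
Proof.
move=> e0; have b0 := reg_b_gt0 reg.
have [C1 [C10 HC1]] := renewal_error reg chainX.
(* The loss is 2 f through (1 - f)^2, f through the initial law and C1 f through the error. *)
have [f [f0 f4 fb fe]] : exists f, [/\ 0 < f, 4 * f <= 1, 16 * f <= b & (3 + C1) * f <= e].
  have C3 : 0 < 3 + C1 by lra.
  exists (Num.min (4^-1) (Num.min (b / 16) (e / (3 + C1)))); split.
  - by rewrite !lt_min invr_gt0 !divr_gt0// ?andbT ltr0n.
  - by rewrite mulrC -ler_pdivlMr// ge_min mul1r lexx.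
  - by rewrite mulrC -ler_pdivlMr// !ge_min lexx orbT.
  - by rewrite mulrC -ler_pdivlMr// !ge_min lexx !orbT.
have [x1 Hx1] := HC1 f f0 f4 fb.
have [x2 Hx2] := expect_above_small chainX 0 f0.
exists (`|x1| + `|x2| + f^-1); first by rewrite ltr_wpDl ?addr_ge0 ?invr_gt0.
move=> x h xx hh hv.
have n1 := ler_norm x1; have n2 := ler_norm x2; have z1 := normr_ge0 x1; have z2 := normr_ge0 x2.
have i0 : 0 < f^-1 by rewrite invr_gt0.
have x1x : x1 <= x by lra. have x1h : x1 <= h by lra. have x2x : x2 <= x by lra.
have hvf : h * v x <= f.
  apply: le_trans hv _; rewrite -[leRHS]invrK lef_pV2 ?posrE//; lra.
move=> {hv hh xx n1 n2 z1 z2 i0}.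
have [x0 h0 _] := Hx1 x h 0%N x1x x1h hvf.
have err n : `|green X n \1_(window x h) -
    (expect X n (potential v b x h) - expect X 0 (potential v b x h))| <=
    C1 * f * (h / v x).
  by have [_ _ H] := Hx1 x h n x1x x1h hvf.
have vx := v_gt0 x0.
have [c cE] : exists c, c = h / v x by eexists.
have c0 : 0 < c by rewrite cE divr_gt0.
rewrite -cE in err *.
have bp := bmf_potential reg x0 h0.
have pb y : 0 <= potential v b x h y <= c by rewrite cE; exact: (potential_bounds reg).
have E0ge n : 0 <= expect X n (potential v b x h).
  by apply: expect_ge0 => y; case/andP: (pb y).
have Ele n : expect X n (potential v b x h) <= c.
  rewrite -(expect_cst X n c); apply: (le_expect chainX) => //; first exact: bmf_cst.
  by move=> y _; case/andP: (pb y).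
have up n : green X n \1_(window x h) <= (1 + C1 * f) * c.
  have := err n; rewrite ler_norml => /andP[_]; have := Ele n; have := E0ge 0%N.
  by move: (green _ _ _) (expect _ _ _) (expect _ _ _) => g a0 a1 *; lra.
have rup := renewal_le_green (B := window x h) (measurable_window x h) up.
have rge n := green_le_renewal X n (B := window x h) (measurable_window x h).
have [r rE] : exists r, renewal_measure X (window x h) = r%:E.
  exists (fine (renewal_measure X (window x h))); rewrite fineK// ge0_fin_numE.
    exact: le_lt_trans rup (ltry _).
  by apply: le_trans (rge 0%N); rewrite /green big_ord0.
exists r => //; rewrite rE lee_fin in rup.
have {}rge n : green X n \1_(window x h) <= r by rewrite -lee_fin -rE.
have [q Hq] := potential_large x0 h0 f0; rewrite -cE in Hq.
have [N HN] := escape reg chainX q f0 limsupX.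
have EN := HN N (leqnn N).
have ba := bmf_above_set q.
have low : (1 - f) * c * expect X N \1_(above q) <= expect X N (potential v b x h).
  rewrite -expectZ//; apply: (le_expect chainX) => //; first exact: bmfZ.
  move=> y _; have [qy|yq] := ltP q y; first by rewrite above_in// mulr1 Hq// ltW.
  by rewrite above_notin// mulr0; case/andP: (pb y).
have E0f : expect X 0 (potential v b x h) <= c * f.
  have bx := bmf_above_set x.
  apply: (@le_trans _ _ (c * expect X 0 \1_(above x))).
    rewrite -expectZ//; apply: (le_expect chainX) => //; first exact: bmfZ.
    move=> y _; have [xy|yx] := ltP x y.
      by rewrite above_in// mulr1; case/andP: (pb y).
    by rewrite above_notin// mulr0 potential0.
  by rewrite ler_pM2l//; exact: Hx2.
have f1 : 0 <= 1 - f.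
  by move: f0 f4; clear_context; lra.
have l1 : (1 - f) * c * (1 - f) <= (1 - f) * c * expect X N \1_(above q).
  by rewrite ler_wpM2l// mulr_ge0// ltW.
have l2 : (1 - 2 * f) * c <= (1 - f) * c * (1 - f).
  by have := mulr_ge0 (sqr_ge0 f) (ltW c0); clear_context; lra.
have eN := err N; rewrite ler_norml in eN.
have rN := rge N.
have fc : (3 + C1) * f * c <= e * c by rewrite ler_pM2r.
have fc0 : 0 <= f * c by rewrite mulr_ge0// ltW.
rewrite -(ler_pM2r c0).
have -> : `|r / c - 1| * c = `|r - c|.
  by rewrite -{2}(gtr0_norm c0) -normrM mulrBl divfK ?gt_eqF// mul1r.
rewrite ler_norml.
move: eN => /andP[eN1 _]; apply/andP; split.
  move: eN1 rN low l1 l2 E0f fc fc0; clear_context.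
  by move: (green _ _ _) (expect _ _ _) (expect _ _ _) (expect _ _ _) => *; lra.
by move: rup fc fc0; clear_context; lra.
Qed.

End limit.

(** * The hypotheses in epsilon form *)

Section asymptotics.
Context {R : realType}.

Lemma near_pinfty (Q : R -> Prop) :
  (\forall x \near pinfty_nbhs R, Q x) <-> exists x0, forall x, x0 <= x -> Q x.
Proof.
split=> [[M [_ HM]]|[x0 H]].
  by exists (M + 1) => x Mx; apply: HM; lra.
by exists x0; split; [exact: num_real|move=> x /ltW; exact: H].
Qed.

Variables (v s p : R -> R).
Hypothesis v_gt0 : forall x : R, 0 <= x -> 0 < v x.
Hypothesis v_decr : nonincreasing_on `[0, +oo[ v.
Hypothesis v_diff : forall x : R, 0 < x -> derivable v x 1.
Hypothesis xv_infty : x * v x @[x --> +oo] --> +oo.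
Hypothesis dv_o : derive1 v =o_ (pinfty_nbhs R) (fun x => v x ^+ 2).
Hypothesis s_gt0 : forall x : R, 0 <= x -> 0 < s x.
Hypothesis s_incr : nondecreasing_on `[0, +oo[ s.
Hypothesis s_o : s =o_ (pinfty_nbhs R) (fun x => (v x)^-1).
Hypothesis p_decr : nonincreasing_on `[0, +oo[ p.
Hypothesis p_ge0 : forall x : R, 0 <= x -> 0 <= p x.
Hypothesis p_int : exists a : R,
     0 <= a /\ lebesgue_measure.-integrable `[a, +oo[ (EFin \o p).

Lemma yv_large A : exists x0, forall y, x0 <= y -> A <= y * v y.
Proof. by apply/near_pinfty; move/cvgryPge: xv_infty; exact. Qed.

Lemma o_inv_v (f : R -> R) e : f =o_ (pinfty_nbhs R) (fun x => (v x)^-1) -> 0 < e ->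
  exists x0, forall y, x0 <= y -> `|f y| * v y <= e.
Proof.
move=> /eqoP fo e0; have /near_pinfty[x0 H] := fo e e0.
exists (Num.max x0 0) => y; rewrite ge_max => /andP[xy y0].
have vy := v_gt0 y0; rewrite -ler_pdivlMr//.
by have := H y xy; rewrite [X in e * X]gtr0_norm// invr_gt0.
Qed.

Lemma sv_small (e : R) : 0 < e -> exists x0, forall y, x0 <= y -> s y * v y <= e.
Proof.
move=> e0; have [x0 H] := o_inv_v s_o e0.
exists (Num.max x0 0) => y; rewrite ge_max => /andP[xy y0].
by have := H y xy; rewrite gtr0_norm// s_gt0.
Qed.

(** As [s] is bounded below by s 0 > 0, s v can tend to 0 only if v does. *)
Lemma v_small (e : R) : 0 < e -> exists x0, forall y, x0 <= y -> v y <= e.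
Proof.
move=> e0; have s0 := s_gt0 (lexx 0).
have [x0 H] := sv_small (mulr_gt0 s0 e0).
exists (Num.max x0 0) => y; rewrite ge_max => /andP[xy y0].
rewrite -(ler_pM2l s0); apply: le_trans (H y xy).
rewrite ler_wpM2r ?(ltW (v_gt0 y0))//.
by apply: s_incr; rewrite //= in_itv/= andbT.
Qed.

(* The derivative of 1 / v is - v' / v^2 = o(1). *)
Lemma inv_v_lip (e : R) : 0 < e -> exists x0, forall x y, x0 <= x -> x <= y ->
  (v y)^-1 <= (v x)^-1 + e * (y - x).
Proof.
move=> e0; move/eqoP: dv_o => /(_ e e0) /near_pinfty[x0 H].
exists (Num.max x0 1) => x y; rewrite ge_max => /andP[x0x x1].
rewrite le_eqVlt => /orP[/eqP <-|xy]; first by rewrite subrr mulr0 addr0.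
have pos z : x <= z -> 0 < z by move=> xz; lra.
have D z : x <= z -> is_derive z 1 (fun y => (v y)^-1) (- v z ^- 2 *: derive1 v z).
  move=> xz; have z0 := pos z xz.
  apply: is_deriveV; first by rewrite gt_eqF// v_gt0// ltW.
  by rewrite derive1E; apply: derivableP; exact: v_diff.
have Dz z : z \in `]x, y[%R -> is_derive z 1 (fun y => (v y)^-1) (- v z ^- 2 *: derive1 v z).
  by rewrite in_itv/= => /andP[xz _]; exact: D (ltW xz).
have cont : {within `[x, y], continuous (fun y => (v y)^-1)}.
  apply: derivable_within_continuous => z; rewrite in_itv/= => /andP[xz _].
  by have [] := D z xz.
have [c] := MVT xy Dz cont.
rewrite in_itv/= => /andP[xc cy] E.
have vc : 0 < v c by apply/v_gt0/ltW/pos/ltW.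
have Hc := H c (le_trans x0x (ltW xc)).
rewrite -lerBlDl E ler_pM2r ?subr_gt0//.
apply: le_trans (ler_norm _) _; rewrite normrZ normrN normfV normrX (gtr0_norm vc).
rewrite mulrC ler_pdivrMr ?exprn_gt0//.
by move: Hc; rewrite normrX (gtr0_norm vc).
Qed.

(** Cauchy condensation: on [2^k, 2^(k+1)[, of length 2^k, p is at least p(2^(k+1)), so its integral
    there is at least half of 2^(k+1) p(2^(k+1)). *)
Lemma p_sum (e : R) : 0 < e -> exists k0 : nat, forall n,
  \sum_(k0 <= k < n) 2 ^+ k * p (2 ^+ k) <= e.
Proof.
move=> e0; have [a [a0 pint]] := p_int.
pose D : set (measurableTypeR R) := [set` `[a, +oo[].
have mD : measurable D by exact: measurable_itv.
have pow_gt0 (k : nat) : 0 < 2 ^+ k :> R by exact: exprn_gt0.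
have pow_ge (k : nat) : k%:R <= 2 ^+ k :> R by rewrite -natrX ler_nat ltnW// ltn_expl.
have pow_le (j k : nat) : (j <= k)%N -> 2 ^+ j <= 2 ^+ k :> R.
  by move=> jk; rewrite ler_weXn2l// ler1n.
pose M := fine (\int[lebesgue_measure]_(x in D) (p x)%:E)%E.
pose k1 := Num.bound a.
have ak1 : a <= 2 ^+ k1 by apply: le_trans (pow_ge k1); exact: ltW (archi_boundP a0).
pose I (k : nat) : set (measurableTypeR R) := [set` `[2 ^+ k, 2 ^+ k.+1[%R].
have mI k : measurable (I k) by exact: measurable_itv.
pose c (k : nat) : R := p (2 ^+ (k1 + k).+1).
have c0 k : 0 <= c k by rewrite p_ge0// ltW.
pose u (k : nat) : R := 2 ^+ (k1 + k).+1 * c k.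
have u0 k : 0 <= u k by rewrite mulr_ge0// ltW.
pose J (n : nat) : set (measurableTypeR R) := [set` `[2 ^+ k1, 2 ^+ (k1 + n)[%R].
have mJ n : measurable (J n) by exact: measurable_itv.
have JD n : J n `<=` D.
  by move=> x; rewrite /J/D/= !in_itv/= andbT => /andP[kx _]; exact: le_trans kx.
have ID k : I (k1 + k)%N `<=` D.
  move=> x; rewrite /I/D/= !in_itv/= andbT => /andP[kx _]; apply: le_trans kx.
  by apply: le_trans ak1 _; apply: pow_le; exact: leq_addr.
have JS n : J n.+1 = J n `|` I (k1 + n)%N.
  apply/seteqP; split=> x; rewrite /J/I/= !in_itv/= addnS.
    by move=> /andP[-> xn]; have [?|?] := ltP x (2 ^+ (k1 + n)); [left|right].
  move=> [/andP[-> xn]|/andP[nx ->]]; rewrite ?andbT /=.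
    by apply: lt_le_trans xn _; apply: pow_le; exact: leqnSn.
  by apply: le_trans nx; apply: pow_le; exact: leq_addr.
have dis n : [disjoint J n & I (k1 + n)%N].
  apply/disj_setPS => x [] /=; rewrite /J/I/= !in_itv/= => /andP[_ h1] /andP[h2 _].
  by move: (lt_le_trans h1 h2); rewrite ltxx.
have [mp _] := integrableP _ _ _ pint.
have pE0 x : D x -> (0 <= (p x)%:E)%E.
  by rewrite /D/= in_itv/= andbT lee_fin => ax; apply: p_ge0; exact: le_trans ax.
have low n : ((\sum_(0 <= k < n) 2 ^+ (k1 + k) * c k)%:E <=
    \int[lebesgue_measure]_(x in J n) (p x)%:E)%E.
  elim: n => [|n IH].
    by rewrite big_geq//; apply: integral_ge0 => x Jx; exact: pE0 (JD _ _ Jx).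
  rewrite big_nat_recr; last exact: leq0n.
  rewrite JS.
  rewrite (ge0_integral_setU _ (mJ n) (mI _) _ _ (dis n)).
  - rewrite EFinD; apply: leeD => //.
    apply: (@le_trans _ _ (\int[lebesgue_measure]_(x in I (k1 + n)%N) (c n)%:E)%E).
      rewrite integral_cst//= /I lebesgue_measure_itv/= lte_fin ltr_eXn2l ?ltr1n// leqnn.
      by rewrite -EFinD -EFinM lee_fin mulrC exprS; lra.
    apply: ge0_le_integral => //.
    - by move=> x _; rewrite lee_fin.
    - by apply: measurable_funS mp => //; exact: ID.
    move=> x; rewrite /I/= in_itv/= lee_fin => /andP[x1 x2]; apply: p_decr.
    - by rewrite /= in_itv/= andbT; apply: le_trans x1; exact: ltW.
    - by rewrite /= in_itv/= andbT; exact: ltW.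
    exact: ltW.
  - rewrite -JS; apply: measurable_funS mp => //; exact: JD.
  - by move=> x; rewrite -JS => Jx; exact: pE0 (JD _ _ Jx).
have uM n : \sum_(0 <= k < n) u k <= 2 * M.
  have -> : \sum_(0 <= k < n) u k = 2 * \sum_(0 <= k < n) 2 ^+ (k1 + k) * c k.
    by rewrite big_distrr/=; apply: eq_bigr => k _; rewrite /u exprS mulrA.
  rewrite ler_pM2l// -lee_fin; apply: le_trans (low n) _.
  rewrite /M fineK; last exact: integrable_fin_num.
  by apply: ge0_subset_integral => //; exact: JD.
have [N HN] := nneg_series_tail e0 u0 uM.
exists (k1 + N).+1 => n; have [kn|nk] := leqP (k1 + N).+1 n; last first.
  by rewrite big_geq ?(ltW e0)// ltnW.
have := HN N (n - k1.+1)%N (leqnn N); apply: le_trans.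
rewrite le_eqVlt; apply/orP; left; apply/eqP.
rewrite -addSn -{1}(subnKC (leq_trans (leq_addr N k1.+1) kn)).
rewrite (addnC k1.+1 N) (addnC k1.+1) big_addn addnK; apply: eq_bigr => k _.
by rewrite /u /c addnC addSn.
Qed.

(** For y in [2^k, 2^(k+1)], y p(y) is at most twice 2^k p(2^k), one term of the small tail in
    [p_sum]. *)
Lemma yp_small (e : R) : 0 < e -> exists x0, forall y, x0 <= y -> y * p y <= e.
Proof.
move=> e0; have e2 : 0 < e / 2 by lra.
have [k0 H] := p_sum e2; exists (2 ^+ k0) => y ky.
have p2 (k : nat) : 0 < 2 ^+ k :> R by exact: exprn_gt0.
have y0 : 0 <= y by apply: le_trans ky; exact: ltW.
have [k [kk [ky1 yk]]] : exists k, (k0 <= k)%N /\ 2 ^+ k <= y /\ y <= 2 ^+ k.+1.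
  have [m ym] : exists m : nat, y <= 2 ^+ m.
    exists (Num.bound y); apply: le_trans (ltW (archi_boundP y0)) _.
    by rewrite -natrX ler_nat ltnW// ltn_expl.
  have [km|mk] := leqP k0 m; last first.
    exists k0; split=> //; split=> //; apply: le_trans ym _.
    by rewrite ler_weXn2l ?ler1n// (leq_trans (ltnW mk)).
  elim: m km ym => [|m IH] km ym.
    by exists k0; split => //; split => //; apply: le_trans ym _; rewrite ler_weXn2l ?ler1n.
  have [ym'|my] := leP y (2 ^+ m); last first.
    have [km'|mk] := leqP k0 m; first by exists m; split=> //; split => //; exact: ltW.
    exists k0; split=> //; split=> //; apply: le_trans ym _.
    by rewrite ler_weXn2l ?ler1n// (leq_trans mk).
  have [km'|mk] := leqP k0 m; first exact: IH.
  exists k0; split=> //; split=> //; apply: le_trans ym _.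
  by rewrite ler_weXn2l ?ler1n// (leq_trans mk).
have := H k.+1; rewrite big_nat_recr//=.
have : 0 <= \sum_(k0 <= i < k) 2 ^+ i * p (2 ^+ i).
  by apply: sumr_ge0 => i _; rewrite mulr_ge0 ?p_ge0// ltW.
have : y * p y <= 2 * (2 ^+ k * p (2 ^+ k)).
  rewrite mulrA -exprS; apply: ler_pM => //; first exact: p_ge0.
  by apply: p_decr => //; rewrite /= in_itv/= andbT// ltW.
by move: (\sum_(_ <= _ < _) _) (2 ^+ k * _) => *; lra.
Qed.

(* s <= 1 / v <= y for large y. *)
Lemma sp_small (e : R) : 0 < e -> exists x0, forall y, x0 <= y ->
  [/\ 0 <= y, s y * v y <= 1 & s y * p y <= e].
Proof.
move=> e0; have [x1 H1] := yp_small e0; have [x2 H2] := sv_small (@ltr01 R).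
have [x3 H3] := yv_large 1.
exists (Num.max 0 (Num.max x1 (Num.max x2 x3))) => y; rewrite !ge_max.
move=> /and4P[y0 x1y x2y x3y]; split => //; first exact: H2.
apply: le_trans (H1 y x1y); rewrite ler_wpM2r ?p_ge0//.
by rewrite -(ler_pM2r (v_gt0 y0)); apply: le_trans (H2 y x2y) (H3 y x3y).
Qed.

Section moments.
Variables (K : R.-pker (measurableTypeR R) ~> (measurableTypeR R)) (S : set R).
Hypothesis large_jumps : forall y, S y -> 0 <= y ->
  (jump_law K y [set z | (s y <= `|z|)%R] <= (p y * v y)%:E)%E.

(** The change of truncation costs at most s p v, which is o(v) because s p tends to 0. *)
Lemma trunc_moment1 : truncated_moment K 1 (s x) x / v x
    @[x --> within S (pinfty_nbhs R)] --> (1 : R) ->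
  forall e : R, 0 < e -> exists x0, forall y, S y -> x0 <= y ->
    `|trunc K s y (fun t => t ^+ 1) - v y| <= e * v y.
Proof.
move=> + e e0; have e2 : 0 < e / 2 by lra.
move=> /cvgrPdist_le /(_ _ e2); rewrite near_withinE => /near_pinfty[x1 H1].
have [x2 H2] := sp_small e2; exists (Num.max x1 x2) => y Sy; rewrite ge_max.
move=> /andP[x1y /H2[y0 _ sp]]; have vy := v_gt0 y0.
have := trunc_momentE (rho := fun y => p y * v y) large_jumps 1 Sy y0 (ltW (s_gt0 y0)).
have : s y ^+ 1 * (p y * v y) <= e / 2 * v y by rewrite expr1 mulrA ler_pM2r.
have : `|truncated_moment K 1 (s y) y - v y| <= e / 2 * v y.
  have := H1 y x1y Sy; rewrite -(ler_pM2r vy) -{2}(gtr0_norm vy) -normrM.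
  by rewrite mulrBl divfK ?gt_eqF// mul1r distrC.
move: (truncated_moment _ _ _ _) (trunc _ _ _ _) => u w.
by rewrite !ler_norml => /andP[? ?] ? /andP[? ?]; apply/andP; split; lra.
Qed.

Lemma trunc_moment2 (b : R) : truncated_moment K 2 (s x) x
    @[x --> within S (pinfty_nbhs R)] --> b ->
  forall e : R, 0 < e -> exists x0, forall y, S y -> x0 <= y ->
    `|trunc K s y (fun t => t ^+ 2) - b| <= e.
Proof.
move=> + e e0; have e2 : 0 < e / 2 by lra.
move=> /cvgrPdist_le /(_ _ e2); rewrite near_withinE => /near_pinfty[x1 H1].
have [x2 H2] := sp_small e2; exists (Num.max x1 x2) => y Sy; rewrite ge_max.
move=> /andP[x1y /H2[y0 sv sp]]; have vy := v_gt0 y0.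
have sy := s_gt0 y0; have py := p_ge0 y0.
have := trunc_momentE (rho := fun y => p y * v y) large_jumps 2 Sy y0 (ltW sy).
have : s y ^+ 2 * (p y * v y) <= e / 2.
  rewrite (_ : _ * _ = (s y * v y) * (s y * p y)); last by ring.
  rewrite -[leRHS]mul1r; apply: ler_pM => //; rewrite mulr_ge0// ltW//.
have := H1 y x1y Sy.
move: (truncated_moment _ _ _ _) (trunc _ _ _ _) => u w.
by rewrite !ler_norml => /andP[? ?] ? /andP[? ?]; apply/andP; split; lra.
Qed.

End moments.

End asymptotics.

Theorem theorem3
  (R : realType)
  (S : set R) (K : R.-pker (measurableTypeR R) ~> (measurableTypeR R))
  (d : measure_display) (T : measurableType d) (P : probability T R)
  (X : nat -> {RV P >-> R})
  (chainX : markov_chain S K X)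
  (limsupX : {ae P, forall w, limn_esup (fun n => (X n w)%:E) = +oo%E})
  (v : R -> R)
  (v_gt0 : forall x : R, 0 <= x -> 0 < v x)
  (v_decr : nonincreasing_on `[0, +oo[ v)
  (v_diff : forall x : R, 0 < x -> derivable v x 1)
  (xv_infty : x * v x @[x --> +oo] --> +oo)
  (dv_o : derive1 v =o_ (pinfty_nbhs R) (fun x => v x ^+ 2))
  (b : R) (b_gt0 : 0 < b)
  (s : R -> R)
  (s_gt0 : forall x : R, 0 <= x -> 0 < s x)
  (s_incr : nondecreasing_on `[0, +oo[ s)
  (s_o : s =o_ (pinfty_nbhs R) (fun x => (v x)^-1))
  (m1_v : truncated_moment K 1 (s x) x / v x
            @[x --> within S (pinfty_nbhs R)] --> (1 : R))
  (m2_b : truncated_moment K 2 (s x) x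
            @[x --> within S (pinfty_nbhs R)] --> b)
  (p : R -> R)
  (p_decr : nonincreasing_on `[0, +oo[ p)
  (p_ge0 : forall x : R, 0 <= x -> 0 <= p x)
  (p_int : exists a : R,
     0 <= a /\ lebesgue_measure.-integrable `[a, +oo[ (EFin \o p))
  (large_jumps : forall y, S y -> 0 <= y ->
     (jump_law K y [set z | (s y <= `|z|)%R] <= (p y * v y)%:E)%E)
  (d' : measure_display) (T' : measurableType d') (P' : probability T' R)
  (xihat : {RV P' >-> R})
  (xihat_sq : ('E_P'[fun w => (xihat w ^+ 2)%R] < +oo)%E)
  (small_jumps : forall y, S y -> 0 <= y ->
     st_le (jump_law K y) (fun z : measurableTypeR R =>
                             `|z| * \1_[set z : R | `|z| < s y] z)
           P' xihat)
  (h : R -> R)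
  (h_infty : increases_to_infty h)
  (h_o : h =o_ (pinfty_nbhs R) (fun x => (v x)^-1)) :
  (renewal_measure X `]x, (x + h x)%R] / (h x / v x)%:E)%E
    @[x --> pinfty_nbhs R] --> 1%E.
Proof.
have reg : regime K S v s p b (tail1 xihat).
  split => //.
  - by move=> e; exact: (trunc_moment1 v_gt0 xv_infty s_gt0 s_o p_decr p_ge0 p_int large_jumps m1_v).
  - by move=> e; exact: (trunc_moment2 v_gt0 xv_infty s_gt0 s_o p_decr p_ge0 p_int large_jumps m2_b).
  - move=> e e0; have [m0 Hm] := tail2_cvg0 xihat_sq e0.
    exists m0 => y Sy y0; apply: le_trans (Hm m0 (leqnn m0)).
    exact: (trunc_tail2 xihat_sq small_jumps).
  - exact: tail1_ge0.
  - by move=> m y Sy y0; exact: (trunc_tail1 xihat_sq small_jumps).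
  - move=> e e0; have [m0 Hm] := tail2_cvg0 xihat_sq e0.
    exists m0 => m n mm; have [mn|nm] := leqP m n.
      exact: le_trans (sum_tail1 xihat_sq mn) (Hm m mm).
    by rewrite big_geq ?(ltW e0)// ltnW.
  - exact: (inv_v_lip v_gt0 v_diff dv_o).
  - exact: (v_small v_gt0 s_gt0 s_incr s_o).
  - exact: (sv_small v_gt0 s_gt0 s_o).
  - exact: (yv_large xv_infty).
  - exact: (p_sum p_decr p_ge0 p_int).
(* The quotient is exhibited as a finite real, so that the extended-real limit reduces to a real
   one. *)
have ratio (e : R) : 0 < e -> exists x0, forall x, x0 <= x ->
    exists2 r, (renewal_measure X `]x, (x + h x)%R] / (h x / v x)%:E)%E = r%:E &
               `|r - 1| <= e.
  move=> e0; have [x1 x10 Hx1] := renewal_ratio reg chainX limsupX e0.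
  have [x2 Hx2] : exists x0, forall y, x0 <= y -> `|h y| * v y <= x1^-1.
    by apply: o_inv_v h_o _ => //; rewrite invr_gt0.
  have [_ /cvgryPge /(_ x1) /near_pinfty[x3 Hx3]] := h_infty.
  exists (Num.max x1 (Num.max x2 x3)) => x; rewrite !ge_max.
  move=> /and3P[x1x x2x x3x]; have xh := Hx3 x x3x.
  have h0 : 0 < h x by exact: lt_le_trans xh.
  have vx : 0 < v x by apply: v_gt0; lra.
  have hvx : h x * v x <= x1^-1 by have := Hx2 x x2x; rewrite gtr0_norm.
  have [r] := Hx1 x (h x) x1x xh hvx.
  have -> : window x (h x) = [set` `]x, (x + h x)%R]].
    by apply/seteqP; split => t; rewrite /window/= in_itv.
  move=> -> re; exists (r / (h x / v x)) => //.
  by rewrite inver gt_eqF ?divr_gt0// -EFinM.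
apply/fine_cvgP; split.
  have [x0 H] := ratio 1 ltr01; apply/near_pinfty; exists x0 => x /H[r rE _].
  by rewrite rE.
apply/cvgrPdist_le => e e0; have [x0 H] := ratio e e0.
by apply/near_pinfty; exists x0 => x /H[r rE H1]; rewrite /= rE distrC.
Qed.
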